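(* Let $X$ be a real Banach space, $Y$ a reflexive closed linear subspace of $X$, and $(\Omega,\Sigma,\mu)$ a finite measure space. (a) For every nonempty weakly compact subset $F$ of $L_1(\Sigma,X)$, every sub-$\sigma$-algebra $\Sigma'\subseteq\Sigma$, and every monotone, coercive function $f:\ell_\infty(F)\to\mathbb{R}_{\ge0}$ such that $r_f(\cdot,F):L_1(\Sigma,X)\to\mathbb{R}_{\ge0}$ is lower semicontinuous for the weak topology, one has $\mathrm{Cent}^f_{L_1(\Sigma',Y)}(F)\neq\emptyset$. (b) For every nonempty closed bounded subset $F$ of $L_\infty(\Sigma,X)$ and every monotone, coercive function $f:\ell_\infty(F)\to\mathbb{R}_{\ge0}$ such that $r_f(\cdot,F):L_1(\Sigma,X^* )^*\to\mathbb{R}_{\ge0}$ is lower semicontinuous for the weak* topology, one has $\mathrm{Cent}^f_{L_\infty(\Sigma,Y)}(F)\neq\emptyset$.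
   Context: $L_1(\Sigma,X)$ is the Banach space of Bochner integrable functions $\Omega\to X$; $L_\infty(\Sigma,X)$ is the space of strongly measurable essentially bounded functions $\Omega\to X$ with the essential supremum norm. $L_1(\Sigma',Y)$ is regarded as a subspace of $L_1(\Sigma,X)$, and $L_\infty(\Sigma,X)$ is regarded as canonically embedded in $L_1(\Sigma,X^* )^*$. $\ell_\infty(F)=\{\varphi:F\to\mathbb{R}_{\ge0}:\sup_{t\in F}\varphi(t)<\infty\}$ with the supremum norm and the pointwise order. $f:\ell_\infty(F)\to\mathbb{R}_{\ge0}$ is monotone if $\varphi_1\le\varphi_2$ implies $f(\varphi_1)\le f(\varphi_2)$, and coercive if $f(\varphi)\to\infty$ as $\|\varphi\|_\infty\to\infty$. For $x$ in a Banach space containing $F$, $r_f(x,F)=f\big((\|x-a\|)_{a\in F}\big)$. For a subspace $Z$, $\mathrm{rad}_Z^f(F)=\inf_{z\in Z}r_f(z,F)$ and $\mathrm{Cent}_Z^f(F)=\{z\in Z:r_f(z,F)=\mathrm{rad}_Z^f(F)\}$. *)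

(* Defs.v *)
From HB Require Import structures.
From mathcomp Require Import all_boot all_order all_algebra.
From mathcomp Require Import all_classical all_reals all_analysis.
From mathcomp Require Import measurable_realfun ess_sup_inf.

Set Implicit Arguments.
Unset Strict Implicit.
Unset Printing Implicit Defensive.

Import Order.TTheory GRing.Theory Num.Theory.
Import numFieldNormedType.Exports.

Local Open Scope classical_set_scope.
Local Open Scope ring_scope.

(* V^*: the continuous linear functionals, with the operator norm *)
Section dual_space_def.
Variables (R : realType) (V : normedModType R).

Definition dual_pred : {pred V -> R} :=
  mem [set f : V -> R | scalar f /\ continuous f].

Lemma dual_predP (f : V -> R) :
  f \in dual_pred <-> scalar f /\ continuous f.
Proof. by split; rewrite inE. Qed.

Record dual_space := Dual { dual_fun :> V -> R ; _ : dual_fun \in dual_pred }.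

HB.instance Definition _ := [isSub for dual_fun].
HB.instance Definition _ := [Choice of dual_space by <:].

Lemma dual_submod_closed : submod_closed dual_pred.
Proof.
split.
  by apply/dual_predP; split=> [a x y|x]; [rewrite mulr0 addr0|exact: cvg_cst].
move=> a f g /dual_predP[fl fc] /dual_predP[gl gc]; apply/dual_predP; split.
  move=> b x y; rewrite !fctE /= fl gl.
  by rewrite /GRing.scale /= !mulrDr addrACA mulrCA.
by move=> x; apply: cvgD; [apply: cvgZr; exact: fc|exact: gc].
Qed.

HB.instance Definition _ :=
  GRing.isSubmodClosed.Build R (V -> R) dual_pred dual_submod_closed.
HB.instance Definition _ := [SubChoice_isSubLmodule of dual_space by <:].

Lemma dual_funP (f : dual_space) : scalar f /\ continuous f.
Proof. by case: f => f /= /dual_predP. Qed.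

HB.instance Definition _ (f : dual_space) :=
  GRing.isLinear.Build R V R *%R (dual_fun f) (dual_funP f).1.

Lemma dual_continuous (f : dual_space) : continuous f.
Proof. exact: (dual_funP f).2. Qed.

Definition dual_norm (f : dual_space) : R :=
  sup [set `|f x| | x in [set x : V | `|x| <= 1]].


Lemma dual_bounded (f : dual_space) : exists M, forall x, `|f x| <= M * `|x|.
Proof.
have /linear_boundedP : bounded_near f (nbhs (0 : V)).
  by apply/linear_bounded_continuous; exact: dual_continuous.
by move=> /pinfty_ex_gt0[M _ fM]; exists M.
Qed.

Let A (f : dual_space) := [set `|f x| | x in [set x : V | `|x| <= 1]].

Let A_has_sup f : has_sup (A f).
Proof.
split; first by exists `|f 0|; exists 0 => //=; rewrite normr0.
have [M fM] := dual_bounded f; exists (Num.max M 0) => _ [x /= x1 <-].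
rewrite (le_trans (fM x))// (le_trans (ler_wpM2r _ (_ : _ <= Num.max M 0)))//.
  by rewrite le_max lexx.
by rewrite ler_piMr// le_max lexx orbT.
Qed.

Lemma dual_norm_ge0 f : 0 <= dual_norm f.
Proof.
rewrite (le_trans (normr_ge0 (f 0)))//; apply: (sup_upper_bound (A_has_sup f)).
by exists 0 => //=; rewrite normr0.
Qed.

Lemma le_dual_norm (f : dual_space) x : `|f x| <= dual_norm f * `|x|.
Proof.
have [->|x0] := eqVneq x 0; first by rewrite linear0 !normr0 mulr0.
rewrite -ler_pdivrMr ?normr_gt0//.
apply: (sup_upper_bound (A_has_sup f)); exists (`|x|^-1 *: x) => /=.
  by rewrite normrZ normfV normr_id mulVf// normr_eq0.
by rewrite linearZ /= normrM normfV normr_id mulrC.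
Qed.

Lemma dual_norm_le (f : dual_space) M :
  0 <= M -> (forall x, `|f x| <= M * `|x|) -> dual_norm f <= M.
Proof.
move=> M0 fM; apply: ge_sup; first by case: (A_has_sup f).
by move=> _ [x /= x1 <-]; rewrite (le_trans (fM x))// ler_piMr.
Qed.

Lemma dual_normD f g : dual_norm (f + g) <= dual_norm f + dual_norm g.
Proof.
apply: dual_norm_le => [|x]; first by rewrite addr_ge0// dual_norm_ge0.
by rewrite (le_trans (ler_normD _ _))// mulrDl lerD// le_dual_norm.
Qed.

Let dual_normZ_le a f : dual_norm (a *: f) <= `|a| * dual_norm f.
Proof.
apply: dual_norm_le => [|x]; first by rewrite mulr_ge0// dual_norm_ge0.
by rewrite normrM -mulrA ler_wpM2l// le_dual_norm.
Qed.

Lemma dual_normZ a f : dual_norm (a *: f) = `|a| * dual_norm f.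
Proof.
apply/eqP; rewrite eq_le dual_normZ_le /=.
have [->|a0] := eqVneq a 0; first by rewrite normr0 mul0r dual_norm_ge0.
rewrite -{1}(scale1r f) -(mulVf a0) -scalerA.
rewrite (le_trans (ler_wpM2l _ (dual_normZ_le _ _)))//.
by rewrite mulrA normfV mulfV ?normr_eq0// mul1r.
Qed.

Lemma dual_norm_eq0 f : dual_norm f = 0 -> f = 0.
Proof.
move=> f0; apply/val_inj/funext => x /=.
apply/normr0_eq0/eqP; rewrite eq_le normr_ge0 andbT.
by rewrite (le_trans (le_dual_norm f x))// f0 mul0r.
Qed.

HB.instance Definition _ :=
  @Lmodule_isNormed.Build R dual_space
    dual_norm dual_normD dual_normZ dual_norm_eq0.

End dual_space_def.

(* a linear subspace Y of X as a normed space in its own right *)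
Section submod_normed.
Variables (R : realType) (X : normedModType R) (Y : submodClosed X).

Record submod_space := SubmodSpace { submod_val :> X ; _ : submod_val \in Y }.

HB.instance Definition _ := [isSub for submod_val].
HB.instance Definition _ := [Choice of submod_space by <:].
HB.instance Definition _ := [SubChoice_isSubLmodule of submod_space by <:].

Let nm (y : submod_space) : R := `|val y|.

Let nmD x y : nm (x + y) <= nm x + nm y.
Proof. by rewrite /nm raddfD ler_normD. Qed.

Let nmZ a x : nm (a *: x) = `|a| * nm x.
Proof. by rewrite /nm linearZ normrZ. Qed.

Let nm_eq0 x : nm x = 0 -> x = 0.
Proof. by move=> /normr0_eq0 x0; apply: val_inj. Qed.

HB.instance Definition _ :=
  @Lmodule_isNormed.Build R submod_space nm nmD nmZ nm_eq0.

End submod_normed.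

(* Strong measurability with respect to a sigma-algebra [G] on [T] and values in
   [V]: everywhere limit of [G]-simple functions.  Requiring the convergence
   only almost everywhere yields the same classes modulo equality a.e.  *)
Section strong_measurability.
Variables (T : Type) (R : realType) (V : normedModType R) (G : set (set T)).

Definition simple_function (s : T -> V) :=
  finite_set (range s) /\ forall v, G (s @^-1` [set v]).

Definition strongly_measurable (f : T -> V) :=
  exists2 s : nat -> T -> V, forall n, simple_function (s n) &
    forall t, s n t @[n --> \oo] --> f t.

End strong_measurability.

Section strong_measurability_lemmas.
Context d (T : measurableType d) (R : realType).

Lemma simple_op (V1 V2 W : normedModType R) (op : V1 -> V2 -> W) s1 s2 :
  simple_function (@measurable d T) s1 -> simple_function (@measurable d T) s2 ->
  simple_function (@measurable d T) (fun t => op (s1 t) (s2 t)).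
Proof.
move=> [f1 m1] [f2 m2]; split.
  apply: (sub_finite_set _ (finite_image2 op f1 f2)) => _ [t _ <-].
  by exists (s1 t) => //; exists (s2 t).
move=> v.
rewrite (_ : _ @^-1` _ = \bigcup_(a in (range s1 `*` range s2) `&`
    [set a | op a.1 a.2 = v]) (s1 @^-1` [set a.1] `&` s2 @^-1` [set a.2])).
  apply: fin_bigcup_measurable => [|a _]; last exact: measurableI.
  by apply: finite_setIl; exact: finite_setX.
apply/seteqP; split=> [t /= tv|t [[a b] /= [_ abv] [-> ->]]//].
by exists (s1 t, s2 t).
Qed.

Lemma simple_cst (V : normedModType R) (v : V) :
  simple_function (@measurable d T) (fun=> v).
Proof.
split; first by apply: (sub_finite_set _ (finite_set1 v)) => _ [t _ <-].
move=> w; have [->|vw] := eqVneq v w.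
  by rewrite (_ : _ @^-1` _ = setT)//; apply/seteqP; split.
rewrite (_ : _ @^-1` _ = set0)//; apply/seteqP; split=> // t /= /eqP.
by rewrite (negbTE vw).
Qed.

Lemma strongly_measurable_op (V1 V2 W : normedModType R) (op : V1 -> V2 -> W)
    f1 f2 :
  (forall (u1 : nat -> V1) (u2 : nat -> V2) v1 v2,
     u1 @ \oo --> v1 -> u2 @ \oo --> v2 ->
     op (u1 n) (u2 n) @[n --> \oo] --> op v1 v2) ->
  strongly_measurable (@measurable d T) f1 ->
  strongly_measurable (@measurable d T) f2 ->
  strongly_measurable (@measurable d T) (fun t => op (f1 t) (f2 t)).
Proof.
move=> opc [s1 ss1 c1] [s2 ss2 c2].
exists (fun n t => op (s1 n t) (s2 n t)) => [n|t]; first exact: simple_op.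
by apply: opc; [exact: c1|exact: c2].
Qed.

Lemma strongly_measurable_cst (V : normedModType R) (v : V) :
  strongly_measurable (@measurable d T) (fun=> v).
Proof. by exists (fun _ _ => v) => [n|t]; [exact: simple_cst|exact: cvg_cst]. Qed.

Lemma simple_measurable_fun (s : T -> R) :
  simple_function (@measurable d T) s -> measurable_fun setT s.
Proof.
move=> [fs ms] _ B mB; rewrite setTI.
rewrite (_ : _ @^-1` _ = \bigcup_(a in range s `&` B) (s @^-1` [set a])).
  by apply: fin_bigcup_measurable => // ; exact: finite_setIl.
apply/seteqP; split=> [t /= tB|t [a [_ Ba] /= ->]//].
by exists (s t).
Qed.

Lemma strongly_measurable_measurable_fun (f : T -> R) :
  strongly_measurable (@measurable d T) f -> measurable_fun setT f.
Proof.
move=> [s ss cs]; apply: (@measurable_realfun.measurable_fun_cvg _ _ _ _ s)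
  => [n|t _]; last exact: cs.
exact: simple_measurable_fun.
Qed.

Lemma strongly_measurable_norm (V : normedModType R) (f : T -> V) :
  strongly_measurable (@measurable d T) f -> measurable_fun setT (fun t => `|f t|).
Proof.
move=> mf; apply: strongly_measurable_measurable_fun.
apply: (strongly_measurable_op (op := fun x y : V => `|x| : R) _ mf mf).
by move=> u1 u2 v1 v2 c1 c2; exact: cvg_norm.
Qed.

End strong_measurability_lemmas.

Section Lnorm_extra.
Local Open Scope ereal_scope.
Context d (T : measurableType d) (R : realType).
Variables (mu : {measure set T -> \bar R}) (p : \bar R).
Hypothesis p1 : 1 <= p.

Let mpow (f : T -> R) r : measurable_fun setT f ->
  measurable_fun setT (fun t => `|(EFin \o f) t| `^ r).
Proof.
move=> mf; apply: (measurableT_comp (measurable_poweR r)).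
by apply: measurableT_comp => //; exact/measurable_EFinP.
Qed.

Lemma Lnorm_ae_le (f g : T -> R) :
  measurable_fun setT f -> measurable_fun setT g ->
  (\forall t \ae mu, (`|f t| <= `|g t|)%R) ->
  'N[mu]_p[EFin \o f] <= 'N[mu]_p[EFin \o g].
Proof.
move=> mf mg fg; rewrite unlock /Lnorm; case: p p1 => [r r1|_|//].
- have r0 : (0 < r)%R by rewrite (lt_le_trans ltr01).
  apply: gt0_ler_poweR; first by rewrite invr_ge0 ltW.
  - by rewrite in_itv /= leey andbT integral_ge0// => t _; exact: poweR_ge0.
  - by rewrite in_itv /= leey andbT integral_ge0// => t _; exact: poweR_ge0.
  apply: ae_ge0_le_integral => //.
  + by move=> t _; exact: poweR_ge0.
  + exact: mpow.
  + by move=> t _; exact: poweR_ge0.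
  + exact: mpow.
  + apply: filterS fg => t fgt _ /=.
    by rewrite lee_fin ge0_ler_powR ?nnegrE ?(ltW r0).
- case: ifPn => // _; apply: le_ess_sup.
  by apply: filterS fg => t /=; rewrite lee_fin.
Qed.

Lemma Lnorm_ae_eq (f g : T -> R) :
  measurable_fun setT f -> measurable_fun setT g ->
  (\forall t \ae mu, (`|f t| = `|g t|)%R) ->
  'N[mu]_p[EFin \o f] = 'N[mu]_p[EFin \o g].
Proof.
move=> mf mg fg; apply/eqP; rewrite eq_le !Lnorm_ae_le//.
- by apply: filterS fg => t ->.
- by apply: filterS fg => t ->.
Qed.

Lemma LnormZ_measurable (a : R) (f : T -> R) : measurable_fun setT f ->
  'N[mu]_p[EFin \o f] < +oo ->
  'N[mu]_p[EFin \o (fun t => (a * f t)%R)] = `|a|%:E * 'N[mu]_p[EFin \o f].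
Proof.
move=> mf foo.
have fL : f \in Lfun mu p by rewrite inE; apply/andP; split; rewrite inE.
exact: (LnormZ (Lfun_Sub p1 fL) a).
Qed.

End Lnorm_extra.

(* L_p(Sigma, V): strongly measurable functions whose norm has finite L_p norm
   (for p = 1, the Bochner integrable functions; for p = +oo, the essentially
   bounded ones), modulo equality almost everywhere.  *)
Section lebesgue_bochner.
Context d (T : measurableType d) (R : realType).
Variables (mu : {measure set T -> \bar R}) (p : \bar R) (p1 : (1 <= p)%E).
Variable V : normedModType R.

Definition bochner_pred : {pred T -> V} :=
  mem [set f : T -> V | strongly_measurable (@measurable d T) f /\
    ('N[mu]_p[EFin \o (Num.norm \o f)] < +oo)%E].

Lemma bochner_predP (f : T -> V) : f \in bochner_pred <->
  strongly_measurable (@measurable d T) f /\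
  ('N[mu]_p[EFin \o (Num.norm \o f)] < +oo)%E.
Proof. by split; rewrite inE. Qed.

Record bochner_fun (q1 : (1 <= p)%E) :=
  BochnerFun { bochner_val :> T -> V ; _ : bochner_val \in bochner_pred }.

HB.instance Definition _ := [isSub of bochner_fun p1 for @bochner_val p1].
HB.instance Definition _ := [Choice of bochner_fun p1 by <:].

Lemma bochner_measurable (f : bochner_fun p1) :
  strongly_measurable (@measurable d T) f.
Proof. by case: f => f /= /bochner_predP[]. Qed.

Lemma bochner_finite (f : bochner_fun p1) :
  ('N[mu]_p[EFin \o (Num.norm \o f)] < +oo)%E.
Proof. by case: f => f /= /bochner_predP[]. Qed.

Lemma bochner_submod_closed : submod_closed bochner_pred.
Proof.
split.
  apply/bochner_predP; split; first exact: strongly_measurable_cst.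
  rewrite (_ : _ \o _ = cst 0%E) ?Lnorm0// ?gt_eqF// ?(lt_le_trans lte01)//.
  by apply/funext => t /=; rewrite normr0.
move=> a f g /bochner_predP[mf ff] /bochner_predP[mg fg]; apply/bochner_predP.
have mfg : strongly_measurable (@measurable d T) (a *: f + g).
  apply: (strongly_measurable_op (op := fun x y => a *: x + y) _ mf mg).
  by move=> u1 u2 v1 v2 c1 c2; apply: cvgD => //; exact: cvgZr.
split => //.
have mnf := strongly_measurable_norm mf; have mng := strongly_measurable_norm mg.
have maf : measurable_fun setT (fun t => `|a| * `|f t|) by exact: measurable_funM.
apply: (@le_lt_trans _ _ ('N[mu]_p[EFin \o
  ((fun t => `|a| * `|f t|)%R \+ (fun t => `|g t|)%R)%R])%E).
  apply: Lnorm_ae_le => //; first exact: strongly_measurable_norm.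
    exact: measurable_funD.
  apply: nearW => t /=.
  by rewrite normr_id ger0_norm ?addr_ge0 ?mulr_ge0// -normrZ ler_normD.
apply: (le_lt_trans (eminkowski _ _ _ _)) => //.
rewrite lte_add_pinfty// LnormZ_measurable// normr_id lte_mul_pinfty//.
Qed.

HB.instance Definition _ :=
  GRing.isSubmodClosed.Build R (T -> V) bochner_pred bochner_submod_closed.
HB.instance Definition _ := [SubChoice_isSubLmodule of bochner_fun p1 by <:].

Definition bochner_null : {pred bochner_fun p1} :=
  mem [set f : bochner_fun p1 | \forall t \ae mu, f t = 0].

Lemma bochner_nullP (f : bochner_fun p1) :
  f \in bochner_null <-> \forall t \ae mu, f t = 0.
Proof. by split; rewrite inE. Qed.

Lemma bochner_null_submod_closed : submod_closed bochner_null.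
Proof.
split; first by apply/bochner_nullP; exact: nearW.
move=> a f g /bochner_nullP f0 /bochner_nullP g0; apply/bochner_nullP.
by apply: filterS2 f0 g0 => t /= ft gt; rewrite !fctE/= ft gt scaler0 addr0.
Qed.

HB.instance Definition _ := GRing.isSubmodClosed.Build R (bochner_fun p1)
  bochner_null bochner_null_submod_closed.

Definition Lbochner : Type := {ideal_quot bochner_null}.
HB.instance Definition _ := GRing.Zmodule.on Lbochner.
HB.instance Definition _ := EqQuotient.on Lbochner.

Local Open Scope quotient_scope.

Lemma Lbochner_ind (P : Lbochner -> Prop) :
  (forall f, P (\pi_Lbochner f)) -> forall z, P z.
Proof. by move=> Ppi z; rewrite -[z]reprK; exact: Ppi. Qed.

Lemma Lbochner_eqP (f g : bochner_fun p1) :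
  \pi_Lbochner f = \pi_Lbochner g <-> \forall t \ae mu, f t = g t.
Proof.
have -> : (\pi_Lbochner f = \pi_Lbochner g) <-> (f - g \in bochner_null).
  by rewrite Quotient.idealrBE; split=> [->|/eqP].
rewrite bochner_nullP; split; apply: filterS => t /=.
  by move/eqP; rewrite subr_eq0 => /eqP.
by rewrite !fctE => ->; rewrite subrr.
Qed.

Lemma Lbochner_repr (f : bochner_fun p1) :
  \forall t \ae mu, repr (\pi_Lbochner f) t = f t.
Proof. by apply/Lbochner_eqP; rewrite reprK. Qed.

Lemma Lbochner_piD (f g : bochner_fun p1) :
  \pi_Lbochner (f + g) = \pi_Lbochner f + \pi_Lbochner g.
Proof. by rewrite piE. Qed.

Definition Lbochner_scale (a : R) (z : Lbochner) : Lbochner :=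
  \pi_Lbochner (a *: repr z).

Lemma Lbochner_piZ a (f : bochner_fun p1) :
  Lbochner_scale a (\pi_Lbochner f) = \pi_Lbochner (a *: f).
Proof.
apply/Lbochner_eqP; apply: filterS (Lbochner_repr f) => t /= h.
by rewrite !fctE h.
Qed.

Lemma Lbochner_scaleA a b z :
  Lbochner_scale a (Lbochner_scale b z) = Lbochner_scale (a * b) z.
Proof.
by elim/Lbochner_ind: z => f; rewrite !Lbochner_piZ scalerA.
Qed.

Lemma Lbochner_scale1 : left_id 1 Lbochner_scale.
Proof. by elim/Lbochner_ind => f; rewrite Lbochner_piZ scale1r. Qed.

Lemma Lbochner_scaleDr : right_distributive Lbochner_scale +%R.
Proof.
move=> a; elim/Lbochner_ind => f; elim/Lbochner_ind => g.
by rewrite -Lbochner_piD !Lbochner_piZ scalerDr Lbochner_piD.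
Qed.

Lemma Lbochner_scaleDl z : {morph Lbochner_scale^~ z : a b / a + b}.
Proof.
move=> a b; elim/Lbochner_ind: z => f.
by rewrite !Lbochner_piZ scalerDl Lbochner_piD.
Qed.

HB.instance Definition _ := GRing.Zmodule_isLmodule.Build R Lbochner
  Lbochner_scaleA Lbochner_scale1 Lbochner_scaleDr Lbochner_scaleDl.

Definition Lbochner_norm (z : Lbochner) : R :=
  fine 'N[mu]_p[EFin \o (Num.norm \o repr z)].

Lemma Lbochner_norm_pi (f : bochner_fun p1) :
  (Lbochner_norm (\pi_Lbochner f))%:E = 'N[mu]_p[EFin \o (Num.norm \o f)]%E.
Proof.
rewrite fineK; last by rewrite ge0_fin_numE ?Lnorm_ge0// bochner_finite.
apply: Lnorm_ae_eq => //; try exact/strongly_measurable_norm/bochner_measurable.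
by apply: filterS (Lbochner_repr f) => t /= ->.
Qed.

Lemma Lbochner_normD x y :
  Lbochner_norm (x + y) <= Lbochner_norm x + Lbochner_norm y.
Proof.
elim/Lbochner_ind: x => f; elim/Lbochner_ind: y => g.
rewrite -Lbochner_piD -lee_fin EFinD !Lbochner_norm_pi.
have mf := strongly_measurable_norm (bochner_measurable f).
have mg := strongly_measurable_norm (bochner_measurable g).
apply: le_trans (eminkowski _ mf mg p1).
apply: Lnorm_ae_le => //.
- exact/strongly_measurable_norm/bochner_measurable.
- exact: measurable_funD.
apply: nearW => t /=.
by rewrite normr_id ger0_norm ?addr_ge0// ler_normD.
Qed.

Lemma Lbochner_normZ a z : Lbochner_norm (a *: z) = `|a| * Lbochner_norm z.
Proof.
elim/Lbochner_ind: z => f; apply: EFin_inj.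
rewrite [a *: _]Lbochner_piZ EFinM !Lbochner_norm_pi.
have mf := strongly_measurable_norm (bochner_measurable f).
rewrite -[X in (X%:E * _)%E]normr_id -LnormZ_measurable ?bochner_finite//.
by congr Lnorm; apply/funext => t /=; rewrite normrZ.
Qed.

Lemma Lbochner_norm_eq0 z : Lbochner_norm z = 0 -> z = 0.
Proof.
elim/Lbochner_ind: z => f f0.
have : 'N[mu]_p[EFin \o (Num.norm \o f)]%E = 0%E.
  by rewrite -Lbochner_norm_pi f0.
have mf := strongly_measurable_norm (bochner_measurable f).
move/Lnorm_eq0_eq0 => /(_ _ _)/wrap[].
- exact/measurable_EFinP.
- by rewrite (lt_le_trans lte01).
move=> fE.
have -> : (0 : Lbochner) = \pi_Lbochner 0 by rewrite piE.
apply/Lbochner_eqP; apply: filterS fE => t /(_ I) /= [] /eqP.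
by rewrite normr_eq0 => /eqP.
Qed.

HB.instance Definition _ := @Lmodule_isNormed.Build R Lbochner
  Lbochner_norm Lbochner_normD Lbochner_normZ Lbochner_norm_eq0.

End lebesgue_bochner.

Notation L1_space mu V := (Lbochner mu (@lexx _ _ 1%E) V).
Notation Loo_space mu V := (Lbochner mu (leey 1%E) V).

Section pairing.
Local Open Scope quotient_scope.
Context d (T : measurableType d) (R : realType).
Variables (mu : {measure set T -> \bar R}) (X : normedModType R).
Implicit Types (z : Loo_space mu X) (w : L1_space mu (dual_space X)).

Lemma Loo_ae_le (z : Loo_space mu X) : \forall t \ae mu, `|repr z t| <= `|z|.
Proof.
have := Lbochner_norm_pi (repr z); rewrite reprK unlock /Lnorm.
case: ifPn => [mu0 zE|mu0 _].
  apply: filterS (ess_sup_ge mu (abse \o (EFin \o (Num.norm \o repr z)))) => t.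
  by rewrite -zE /= lee_fin normr_id.
exists setT; split => //; apply/eqP.
by rewrite eq_le measure_ge0 andbT leNgt.
Qed.

Lemma pairing_measurable (z : Loo_space mu X) (w : L1_space mu (dual_space X)) :
  measurable_fun setT (fun t => repr w t (repr z t)).
Proof.
apply: strongly_measurable_measurable_fun.
apply: (strongly_measurable_op (op := fun (f : dual_space X) x => f x) _
  (bochner_measurable _) (bochner_measurable _)) => f_ x_ f x cf cx.
have -> : f x = 0 + f x by rewrite add0r.
rewrite (_ : (fun n => _) = (fun n => (f_ n - f) (x_ n) + f (x_ n))); last first.
  by apply/funext => n /=; rewrite subrK.
apply: cvgD; last exact: (cvg_comp _ _ cx (@dual_continuous _ _ f x)).
apply/norm_cvg0P.
apply: (@squeeze_cvgr _ _ _ _ (cst 0) (fun n => `|f_ n - f| * `|x_ n|)).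
- by apply: nearW => n; rewrite normr_ge0; exact: (le_dual_norm (f_ n - f)).
- exact: cvg_cst.
- rewrite -(mul0r `|x|); apply: cvgM; last exact: cvg_norm.
  rewrite -(@normr0 _ (dual_space X)) -(subrr f).
  apply: cvg_norm; apply: cvgB => //; by exact: cvg_cst.
Qed.

Lemma pairing_ae_le (z : Loo_space mu X) (w : L1_space mu (dual_space X)) :
  \forall t \ae mu, `|repr w t (repr z t)| <= `|z| * `|repr w t|.
Proof.
apply: filterS (Loo_ae_le z) => t zt.
apply: (le_trans (le_dual_norm _ _)); rewrite mulrC.
exact: (ler_wpM2r (dual_norm_ge0 _) zt).
Qed.

Lemma L1_integral (V : normedModType R) (w : L1_space mu V) :
  (`|w|%:E = \int[mu]_t (`|repr w t|%:E))%E.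
Proof.
have := Lbochner_norm_pi (repr w); rewrite reprK => ->.
by rewrite Lnorm1; apply: eq_integral => t _ /=; rewrite normr_id.
Qed.

Lemma L1_norm_measurable (V : normedModType R) (w : L1_space mu V) :
  measurable_fun setT (fun t => `|repr w t|).
Proof. exact/strongly_measurable_norm/bochner_measurable. Qed.

Lemma pairing_integral_le (z : Loo_space mu X) (w : L1_space mu (dual_space X)) :
  (\int[mu]_t `|(repr w t (repr z t))%:E| <= (`|z| * `|w|)%:E)%E.
Proof.
rewrite EFinM L1_integral -ge0_integralZl ?lee_fin//; last first.
  exact/measurable_EFinP/L1_norm_measurable.
apply: ae_ge0_le_integral => //.
- by apply: measurableT_comp => //; exact/measurable_EFinP/pairing_measurable.
- apply/measurable_EFinP; apply: measurable_funM => //.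
  exact: L1_norm_measurable.
- by apply: filterS (pairing_ae_le z w) => t ? _; rewrite /= lee_fin.
Qed.

Lemma pairing_integrable (z : Loo_space mu X) (w : L1_space mu (dual_space X)) :
  mu.-integrable setT (fun t => (repr w t (repr z t))%:E).
Proof.
apply/integrableP; split; first exact/measurable_EFinP/pairing_measurable.
by rewrite (le_lt_trans (pairing_integral_le z w)) ?ltry.
Qed.

(* canonical embedding of L_oo(Sigma, X) into L_1(Sigma, X^* )^*:
   z |-> (w |-> \int <w(t), z(t)> dmu(t))  *)
Definition Loo_pairing (z : Loo_space mu X)
    (w : L1_space mu (dual_space X)) : R :=
  (\int[mu]_t repr w t (repr z t))%R.

Lemma Loo_pairing_dual z :
  Loo_pairing z \in @dual_pred R (L1_space mu (dual_space X)).
Proof.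
have lin : scalar (Loo_pairing z).
  move=> a u v; rewrite /Loo_pairing -RintegralZl ?pairing_integrable//.
  rewrite -RintegralD//; last 2 first.
  - have := pairing_integrable z u; move/(integrableZl measurableT a).
    by apply: eq_integrable.
  - exact: (pairing_integrable z v).
  rewrite /Rintegral; congr fine; apply: ae_eq_integral => //.
  - exact/measurable_EFinP/pairing_measurable.
  - apply/measurable_EFinP; apply: measurable_funD; last exact: pairing_measurable.
    by apply: measurable_funM => //; exact: pairing_measurable.
  have uvE : \pi_(L1_space mu (dual_space X)) (a *: repr u + repr v) = a *: u + v.
    by rewrite Lbochner_piD -Lbochner_piZ !reprK.
  by rewrite -uvE; apply: filterS (Lbochner_repr (a *: repr u + repr v)) => t /= -> _.
apply/dual_predP; split => //.
pose L : {linear L1_space mu (dual_space X) -> R} :=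
  HB.pack (Loo_pairing z) (GRing.isLinear.Build R _ R *%R (Loo_pairing z) lin).
apply: (@bounded_linear_continuous _ _ _ L); apply/linear_boundedP.
exists `|z|; split => // r zr w.
rewrite (le_trans (_ : _ <= `|z| * `|w|))//; last by rewrite ler_wpM2r// ltW.
rewrite -lee_fin (le_trans _ (pairing_integral_le z w))//.
rewrite /= EFin_normr_Rintegral ?pairing_integrable// le_abse_integral//.
exact/measurable_EFinP/pairing_measurable.
Qed.

Definition Loo_embed (z : Loo_space mu X) :
    dual_space (L1_space mu (dual_space X)) :=
  Dual (Loo_pairing_dual z).

End pairing.

(* L_p(S', Y) inside L_p(Sigma, V): the classes having a representative that
   is strongly S'-measurable as a function with values in the subspace Y.    *)
Definition Lbochner_sub d (T : measurableType d) (R : realType)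
    (mu : {measure set T -> \bar R}) (p : \bar R) (p1 : (1 <= p)%E)
    (V : normedModType R) (S' : set (set T)) (Y : submodClosed V) :
    set (Lbochner mu p1 V) :=
  [set z | exists2 u : bochner_fun mu V p1, z = (\pi_(Lbochner mu p1 V) u)%qT &
    exists2 g : T -> submod_space Y, strongly_measurable S' g &
      forall t, u t = g t].

Section weak_topologies.
Variables (R : realType) (V : normedModType R).

Definition weak_space : topologicalType :=
  initial_topology
    (fun v : V => (fun phi : dual_space V => phi v) : {ptws dual_space V -> R}).

Definition weakstar_space : topologicalType :=
  initial_topology (fun phi : dual_space V => (phi : V -> R) : {ptws V -> R}).

Definition reflexive_space :=
  forall Phi : dual_space (dual_space V), exists v : V,
    forall phi : dual_space V, Phi phi = phi v.

End weak_topologies.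

Section linfty.
Variables (R : realType) (I : Type).

Definition linfty_pred : {pred I -> R} :=
  mem [set phi : I -> R | (forall i, 0 <= phi i) /\ has_ubound (range phi)].

Record linfty :=
  Linfty { linfty_val :> I -> R ; _ : linfty_val \in linfty_pred }.

HB.instance Definition _ := [isSub for linfty_val].

Definition linfty_norm (phi : linfty) : R := sup (range phi).

Lemma linfty0_subproof : (fun=> 0) \in linfty_pred.
Proof. by rewrite inE; split=> //; exists 0 => _ [i _ <-]. Qed.

Definition linfty0 : linfty := Linfty linfty0_subproof.

Definition linfty_monotone (f : linfty -> {nonneg R}) :=
  forall phi1 phi2 : linfty, (forall i, phi1 i <= phi2 i) ->
    (f phi1)%:num <= (f phi2)%:num.

Definition linfty_coercive (f : linfty -> {nonneg R}) :=
  forall M : R, exists K : R, forall phi : linfty,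
    K <= linfty_norm phi -> M <= (f phi)%:num.

End linfty.

Section centers.
Variables (R : realType) (E : normedModType R) (I : Type) (a : I -> E).

(* The family (|x - a i|)_i as a member of linfty; [insubd] returns the default
   value 0 only when the family [a] is unbounded (see [dist_familyE]), hence
   never for norm bounded or weakly compact sets.  *)
Definition dist_family (x : E) : linfty R I :=
  insubd (linfty0 R I) (fun i => `|x - a i|).

Lemma dist_familyE x : bounded_set (range a) ->
  forall i, dist_family x i = `|x - a i|.
Proof.
move=> /pinfty_ex_gt0[M M0 aM] i; rewrite /dist_family.
have aP : (fun i => `|x - a i|) \in @linfty_pred R I.
  rewrite inE; split=> [j|]; first exact: normr_ge0.
  exists (`|x| + M) => _ [j _ <-]; rewrite (le_trans (ler_normB _ _))// lerD2l.
  by apply: aM; exists j.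
exact: (congr1 (@^~ i) (insubdK (linfty0 R I) aP)).
Qed.

Definition rfun (f : linfty R I -> {nonneg R}) (x : E) : R :=
  (f (dist_family x))%:num.

Definition rad (f : linfty R I -> {nonneg R}) (Z : set E) : R :=
  inf [set rfun f z | z in Z].

Definition Cent (f : linfty R I -> {nonneg R}) (Z : set E) : set E :=
  [set z | Z z /\ rfun f z = rad f Z].

End centers.

(* Main.v *)
From HB Require Import structures.
Require Import Defs.
From mathcomp Require Import all_boot all_order all_algebra.
From mathcomp Require Import all_classical all_reals all_analysis.
From mathcomp Require Import measurable_realfun ess_sup_inf.
From mathcomp Require Import ring lra.

(** Why the theorem holds.

A minimizing sequence for r_f in the subspace Z is norm bounded, because f is
coercive.  If it has a cluster point in Z for the topology in which r_f is lower
semicontinuous, this point is a center ([lsc_cluster_le]).  Everything is thus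
about producing cluster points inside Z.  Limits are taken along one
nonprincipal ultrafilter U on nat: every bounded real sequence converges along
U, and no subsequence is ever extracted.

Cluster points.  Let z_n be Y-valued with |z_n| bounded in L_1 and uniformly
integrable.  All z_n take their values in one closed separable subspace V of Y
([separable_reduction]), which is reflexive and has a separable dual
([reflexive_closed_subspace], [reflexive_dual_separable]).  The ultralimits of
the integrals of phi(z_n) over A, for phi in V^*, form a vector measure with
values in V^**; it has a density, by the Radon-Nikodym theorem for the dual of
a separable space ([vector_density]), and by reflexivity this density is a
function z with values in V ([weak_limit_exists]).  A bounded functional on
L_1(V) is integration against a bounded function with values in V^*, again by
[vector_density] ([functional_density]); such a function is a uniform limit of
countably valued ones, so convergence against constants phi gives convergence
against all functionals ([weak_limit_pairing], [weak_cluster_point]).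

Part (a).  A minimizing sequence in L_1 need not be uniformly integrable, but F
is: a gliding hump contradicts weak compactness otherwise
([weakly_compact_uniformly_integrable]).  So if z has much more mass on the set
{|z| > c} than any a in F can have there, replacing z by 0 on that set does not
increase any distance |z - a|, hence does not increase r_f, as f is monotone.
Cutting each z_n at the first level where this happens gives a minimizing
sequence that is uniformly integrable ([uniform_truncation], [L1_center]).
The sub-sigma-algebra is handled as an image measure under the identity map.

Part (b).  A bounded sequence in L_oo is uniformly integrable, and
[weak_limit_pairing] applies to any integrable function with values in X^*.
As the embedding of L_oo(X) in L_1(X^* )^* is isometric ([Loo_embed_norm]), r_f
is the same on both sides of it ([Loo_center]). *)

Set Implicit Arguments.
Unset Strict Implicit.
Unset Printing Implicit Defensive.

Import Order.TTheory GRing.Theory Num.Theory.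
Import numFieldNormedType.Exports.

Local Open Scope classical_set_scope.
Local Open Scope ring_scope.

(** * The Hahn-Banach theorem *)

Section sublinear_functionals.
Variables (R : realType) (V : lmodType R).
Implicit Types (p q : V -> R) (S : set (V * R)).

(** Homogeneity is an inequality for a > 0; applied to a and to its inverse, it
    gives the equality. *)
Definition sublinear q :=
  (forall x y, q (x + y) <= q x + q y) /\
  (forall a x, 0 < a -> q (a *: x) <= a * q x).

Lemma sublinear0 q : sublinear q -> q 0 = 0.
Proof.
move=> [qD qZ].
have := qD 0 0; rewrite addr0 => q00.
have := qZ 2^-1 0; rewrite scaler0 invr_gt0 ltr0n => /(_ isT) h.
by apply/eqP; rewrite eq_le; apply/andP; split; lra.
Qed.

Lemma sublinear_oppr q x : sublinear q -> - q (- x) <= q x.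
Proof.
by move=> qs; have := qs.1 x (- x); rewrite subrr sublinear0// => ?; lra.
Qed.

(** The largest sublinear functional q' <= q such that q' (- w) <= - c for all
    (w, c) in the cone S.  It serves both to prescribe values on a subspace and
    to lower a functional along a ray. *)
Definition cone_inf q S : V -> R :=
  fun x => inf [set q (x + s.1) - s.2 | s in S].

Lemma cone_inf_sublinear q S : sublinear q ->
  S (0, 0) -> (forall s t, S s -> S t -> S (s.1 + t.1, s.2 + t.2)) ->
  (forall a s, 0 < a -> S s -> S (a *: s.1, a * s.2)) ->
  (forall s, S s -> s.2 <= q s.1) ->
  [/\ sublinear (cone_inf q S), (forall x, cone_inf q S x <= q x) &
      forall s, S s -> cone_inf q S (- s.1) <= - s.2].
Proof.
move=> qs S0 SD SZ Sq.
have hl x : lbound [set q (x + s.1) - s.2 | s in S] (- q (- x)).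
  move=> _ [s Ss <-].
  have := qs.1 (- x) (x + s.1); rewrite addKr => h.
  by have := Sq _ Ss => h'; lra.
have ne x : [set q (x + s.1) - s.2 | s in S] !=set0.
  by exists (q (x + 0) - 0); exists (0, 0).
have ub x s : S s -> cone_inf q S x <= q (x + s.1) - s.2.
  by move=> Ss; apply: ge_inf; [exists (- q (- x))|exists s].
have hi x : has_inf [set q (x + s.1) - s.2 | s in S].
  by split => //; exists (- q (- x)).
split.
- split=> [x y|a x a0].
    rewrite -lerBlDr; apply: lb_le_inf => // _ [s Ss <-].
    rewrite lerBlDr -lerBlDl; apply: lb_le_inf => // _ [t St <-].
    rewrite lerBlDl (le_trans (ub _ _ (SD _ _ Ss St)))//=.
    by rewrite addrACA; have := qs.1 (x + s.1) (y + t.1) => ?; lra.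
  rewrite -ler_pdivrMl//; apply: lb_le_inf => // _ [s Ss <-].
  rewrite ler_pdivrMl// (le_trans (ub _ _ (SZ _ _ a0 Ss)))//=.
  by rewrite -scalerDr mulrBr lerB//; apply: qs.2.
- by move=> x; rewrite (le_trans (ub _ _ S0))//= addr0 subr0.
- by move=> s Ss; rewrite (le_trans (ub _ _ Ss))//= addNr sublinear0// sub0r.
Qed.

(** A minimal sublinear functional is linear: lowering it along the ray
    through y, with [cone_inf], cannot change it, and this forces
    q (- y) = - q y.  Minimal functionals avoid the partially defined ones of
    the usual proof. *)
Lemma linear_below_sublinear p : sublinear p ->
  exists g : V -> R, scalar g /\ forall x, g x <= p x.
Proof.
move=> ps.
pose E := {q : V -> R | sublinear q /\ forall x, q x <= p x}.
pose ord (q r : E) := `[< forall x, sval r x <= sval q x >].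
have [||F Ftot|[q [qs qp]] qmin] := @ZL_preorder E (exist _ p (conj ps (fun=> lexx _))) ord.
- by move=> q; apply/asboolP.
- move=> q r s /asboolP rq /asboolP qs; apply/asboolP => x.
  exact: le_trans (qs x) (rq x).
- have [->|/set0P[q0 Fq0]] := eqVneq F set0.
    by exists (exist _ p (conj ps (fun=> lexx _))).
  pose m x := inf [set sval q x | q in F].
  have lb x : lbound [set sval q x | q in F] (- p (- x)).
    move=> _ [q Fq <-]; apply: le_trans (sublinear_oppr x (svalP q).1).
    by rewrite lerN2; exact: (svalP q).2.
  have ne x : [set sval q x | q in F] !=set0 by exists (sval q0 x); exists q0.
  have ub (q : E) x : F q -> m x <= sval q x.
    by move=> Fq; apply: ge_inf; [exists (- p (- x))|exists q].
  have ms : sublinear m.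
    split=> [x y|a x a0].
      rewrite -lerBlDr; apply: lb_le_inf => // _ [q Fq <-].
      rewrite lerBlDr -lerBlDl; apply: lb_le_inf => // _ [r Fr <-].
      rewrite lerBlDl.
      have [/asboolP rq|/asboolP qr] := Ftot _ _ Fq Fr.
        rewrite (le_trans (ub r _ Fr))//.
        by rewrite (le_trans ((svalP r).1.1 _ _))// lerD2r rq.
      rewrite (le_trans (ub q _ Fq))//.
      by rewrite (le_trans ((svalP q).1.1 _ _))// lerD2l qr.
    rewrite -ler_pdivrMl//; apply: lb_le_inf => // _ [q Fq <-].
    by rewrite ler_pdivrMl// (le_trans (ub q _ Fq))// (svalP q).1.2.
  have mp x : m x <= p x by rewrite (le_trans (ub q0 x Fq0))// (svalP q0).2.
  by exists (exist _ m (conj ms mp)) => q Fq; apply/asboolP => x /=; exact: ub.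
have qN y : q (- y) = - q y.
  (* lower q along the ray through y *)
  pose S := [set s : V * R | exists2 t, 0 <= t & s = (t *: y, t * q y)].
  have [|||s [t t0 ->]|cs cq cS] := @cone_inf_sublinear q S qs.
  - by exists 0; rewrite ?scale0r ?mul0r.
  - move=> _ _ [t t0 ->] [u u0 ->]; exists (t + u); first exact: addr_ge0.
    by rewrite scalerDl mulrDl.
  - move=> a _ a0 [t t0 ->]; exists (a * t); first by rewrite mulr_ge0// ltW.
    by rewrite /= scalerA mulrA.
  - have [->|tn0] := eqVneq t 0; first by rewrite /= scale0r mul0r sublinear0.
    have {}t0 : 0 < t by rewrite lt_neqAle eq_sym tn0.
    rewrite /= -ler_pdivlMl//.
    have := qs.2 t^-1 (t *: y); rewrite invr_gt0 => /(_ t0).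
    by rewrite scalerA mulVf// scale1r.
  have cE : sublinear (cone_inf q S) /\ forall x, cone_inf q S x <= p x.
    by split => // x; exact: le_trans (cq x) (qp x).
  have /qmin/asboolP/= qc : ord (exist _ q (conj qs qp)) (exist _ _ cE).
    exact/asboolP.
  apply/eqP; rewrite eq_le; apply/andP; split.
    have /cS /= : S (1 *: y, 1 * q y) by exists 1.
    by rewrite scale1r mul1r; exact: le_trans (qc _).
  by rewrite lerNl; have := sublinear_oppr y qs.
have qD x y : q (x + y) = q x + q y.
  apply/eqP; rewrite eq_le qs.1/=.
  have := qs.1 (- x) (- y); rewrite -opprD !qN => ?; lra.
have qZ a x : 0 < a -> q (a *: x) = a * q x.
  move=> a0; apply/eqP; rewrite eq_le qs.2//=.
  have := qs.2 a (- x) a0; rewrite scalerN !qN mulrN => ?; lra.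
exists q; split => // a x y; rewrite qD; congr (_ + _).
have [a0|a0|->] := ltrgtP a 0; last by rewrite scale0r mul0r sublinear0.
  by rewrite -[in LHS](opprK a) scaleNr qN qZ ?oppr_gt0// mulNr opprK.
exact: qZ.
Qed.

(** The subspace is the image of a linear map i, and f lives on its domain.
    The cone of the pairs (i x, f x) imposes g (- i x) <= - f x for x and for
    - x, hence g (i x) = f x. *)
Lemma hahn_banach (I : lmodType R) (i : {linear I -> V}) (f : I -> R) p :
  sublinear p -> scalar f -> (forall x, f x <= p (i x)) ->
  exists g : V -> R, [/\ scalar g, forall x, g (i x) = f x &
    forall x, g x <= p x].
Proof.
move=> ps fl fp; pose S := [set s : V * R | exists x, s = (i x, f x)].
have f0 : f 0 = 0 by have := fl (-1) 0 0; rewrite scaler0 addr0 => ?; lra.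
have fD x y : f (x + y) = f x + f y by have := fl 1 x y; rewrite scale1r mul1r.
have fZ a x : f (a *: x) = a * f x by have := fl a x 0; rewrite addr0 f0 addr0.
have [|||_ [x ->]|cs cp cS] := @cone_inf_sublinear p S ps.
- by exists 0; rewrite linear0 f0.
- by move=> _ _ [x ->] [y ->]; exists (x + y); rewrite linearD fD.
- by move=> a _ _ [x ->]; exists (a *: x); rewrite linearZ fZ.
- exact: fp.
have [g [gl gc]] := linear_below_sublinear cs.
pose g' : {linear V -> R} := HB.pack g (GRing.isLinear.Build R V R *%R g gl).
have gi x : - f x >= g (- i x).
  by rewrite (le_trans (gc _))//; apply: (cS (i x, f x)); exists x.
exists g; split => // [x|x]; last exact: le_trans (gc x) (cp x).
apply/eqP; rewrite eq_le; apply/andP; split.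
  have := gi (- x); rewrite linearN opprK => /le_trans; apply.
  by rewrite -scaleN1r fZ mulN1r opprK.
by have := gi x; rewrite -[g]/(g' : V -> R) linearN lerN2.
Qed.

End sublinear_functionals.

Section dual_of_normed_space.
Variables (R : realType) (V : normedModType R).

Lemma bounded_scalar_dual (g : V -> R) (C : R) :
  scalar g -> (forall x, `|g x| <= C * `|x|) -> g \in @dual_pred R V.
Proof.
move=> gl gC; apply/dual_predP; split => //.
pose g' : {linear V -> R} := HB.pack g (GRing.isLinear.Build R V R *%R g gl).
apply: (@bounded_linear_continuous _ _ _ g'); apply/linear_boundedP.
exists C; split; first exact: num_real.
by move=> r Cr x; rewrite (le_trans (gC x))// ler_wpM2r// ltW.
Qed.

Lemma ler_dual (g : dual_space V) x : `|g x| <= `|g| * `|x|.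
Proof. exact: le_dual_norm. Qed.

Lemma dual_normr_le (g : dual_space V) M :
  0 <= M -> (forall x, `|g x| <= M * `|x|) -> `|g| <= M.
Proof. exact: dual_norm_le. Qed.

Lemma norm_sublinear (C : R) : 0 <= C -> sublinear (fun x : V => C * `|x|).
Proof.
move=> C0; split=> [x y|a x a0]; first by rewrite -mulrDr ler_wpM2l// ler_normD.
by rewrite normrZ gtr0_norm// mulrCA.
Qed.

Lemma dual_extension (I : lmodType R) (i : {linear I -> V}) (f : I -> R) (C : R) :
  0 <= C -> scalar f -> (forall x, `|f x| <= C * `|i x|) ->
  exists2 g : dual_space V, (forall x, g (i x) = f x) & `|g| <= C.
Proof.
move=> C0 fl fC.
have [|g [gl gi gC]] := hahn_banach (norm_sublinear C0) fl (i := i).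
  by move=> x; rewrite (le_trans (ler_norm _)).
have gC' x : `|g x| <= C * `|x|.
  rewrite ler_norml gC andbT lerNl.
  pose g' : {linear V -> R} := HB.pack g (GRing.isLinear.Build R V R *%R g gl).
  by rewrite -[g]/(g' : V -> R) -linearN -normrN gC.
by exists (Dual (bounded_scalar_dual gl gC')) => //; exact: dual_norm_le.
Qed.

Lemma line_linear (x : V) : linear (fun t : R^o => (t : R) *: x).
Proof. by move=> a s t; rewrite scalerDl scalerA. Qed.

Definition line (x : V) : {linear R^o -> V} :=
  HB.pack (fun t : R^o => (t : R) *: x)
    (GRing.isLinear.Build R R^o V *:%R _ (line_linear x)).

Lemma norming_functional (x : V) :
  exists2 g : dual_space V, g x = `|x| & `|g| <= 1.
Proof.
pose i := line x.
pose f := fun t : R^o => (t : R) * `|x|.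
have fl : scalar f by move=> a s t; rewrite /f mulrDl mulrA.
have [|g gi g1] := @dual_extension _ i f 1 ler01 fl.
  by move=> t; rewrite /f/= mul1r normrM normrZ normr_id.
by exists g => //; have := gi 1; rewrite /f/= scale1r mul1r.
Qed.

Lemma closed_subspace_dist (W : set V) (x : V) : closed W -> ~ W x ->
  exists2 e, 0 < e & forall w, W w -> e <= `|x - w|.
Proof.
move=> Wc Wx.
have : nbhs x (~` W) by apply: open_nbhs_nbhs; split => //; exact: closed_openC.
move=> /nbhs_ballP[e /= e0 eW]; exists e => // w Ww; rewrite leNgt.
by apply/negP => xw; apply: (eW w) => //; rewrite -ball_normE /ball_/=.
Qed.

(** The functional t x |-> t dist(x, W) is extended below the seminorm
    dist(_, W), which vanishes on W. *)
Lemma separating_functional (W : submodClosed V) (x : V) :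
  closed [set v | v \in W] -> x \notin W ->
  exists2 g : dual_space V, g x != 0 & forall w, w \in W -> g w = 0.
Proof.
move=> Wc xW.
have [e e0 eW] := closed_subspace_dist Wc (negP xW).
pose p v := inf [set `|v - w| | w in [set v | v \in W]].
have hl v : has_inf [set `|v - w| | w in [set v | v \in W]].
  split; first by exists `|v - 0|; exists 0 => //=; exact: rpred0.
  by exists 0 => _ [w _ <-].
have pub v w : w \in W -> p v <= `|v - w|.
  by move=> wW; apply: ge_inf; [exact: (hl v).2|exists w].
have pW v : p v <= `|v| by have := pub v 0 (rpred0 _); rewrite subr0.
have p0 v : 0 <= p v by apply: lb_le_inf; [exact: (hl v).1|move=> _ [w _ <-]].
have ps : sublinear p.
  split=> [v w|a v a0].
    rewrite -lerBlDr; apply: lb_le_inf => [|_ [s sW <-]]; first exact: (hl _).1.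
    rewrite lerBlDr -lerBlDl; apply: lb_le_inf => [|_ [t tW <-]].
      exact: (hl _).1.
    rewrite lerBlDl (le_trans (pub _ (s + t) _)) ?rpredD//.
    by rewrite opprD addrACA ler_normD.
  rewrite -ler_pdivrMl//; apply: lb_le_inf => [|_ [s sW <-]]; first exact: (hl _).1.
  rewrite ler_pdivrMl// (le_trans (pub _ (a *: s) _)) ?rpredZ//.
  by rewrite -scalerBr normrZ gtr0_norm.
pose i := line x.
pose f := fun t : R^o => (t : R) * p x.
have fl : scalar f by move=> a s t; rewrite /f mulrDl mulrA.
have fp t : f t <= p (i t).
  rewrite /f/=; have [t0|t0] := lerP t 0.
    by rewrite (le_trans _ (p0 _))// mulr_le0_ge0.
  rewrite -ler_pdivlMl//.
  have := ps.2 t^-1 (t *: x); rewrite invr_gt0 => /(_ t0).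
  by rewrite scalerA mulVf ?scale1r// gt_eqF.
have [g [gl gi gp]] := hahn_banach ps fl fp.
pose g' : {linear V -> R} := HB.pack g (GRing.isLinear.Build R V R *%R g gl).
have gN v : g (- v) = - g v by rewrite -[g]/(g' : V -> R) linearN.
have gC' v : `|g v| <= 1 * `|v|.
  rewrite mul1r ler_norml (le_trans (gp v))// andbT lerNl -gN -normrN.
  by rewrite (le_trans (gp _)).
exists (Dual (bounded_scalar_dual gl gC')) => [|w wW] /=.
  have := gi 1; rewrite /i/f/= scale1r mul1r => ->.
  rewrite gt_eqF// (lt_le_trans e0)//; apply: lb_le_inf; first exact: (hl _).1.
  by move=> _ [w wW <-]; exact: eW.
have gw v : v \in W -> g v <= 0.
  by move=> vW; rewrite (le_trans (gp _))// (le_trans (pub _ _ vW))// subrr normr0.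
apply/eqP; rewrite eq_le gw//= -oppr_le0 -gN gw// -scaleN1r rpredZ//.
Qed.

End dual_of_normed_space.

Section dual_restriction.
Variables (R : realType) (V X : normedModType R) (i : {linear V -> X}).
Hypothesis i_norm : forall v, `|i v| = `|v|.

Lemma dual_restrict_subproof (g : dual_space X) :
  (fun v => g (i v)) \in @dual_pred R V.
Proof.
apply: (@bounded_scalar_dual _ _ _ `|g|) => [a x y|x]; first by rewrite !linearP.
by rewrite -i_norm ler_dual.
Qed.
Definition dual_restrict (g : dual_space X) : dual_space V :=
  Dual (dual_restrict_subproof g).

Lemma dual_restrict_norm_le (g : dual_space X) : `|dual_restrict g| <= `|g|.
Proof. by apply: dual_normr_le => // v; rewrite -(i_norm v); exact: (ler_dual g (i v)). Qed.

End dual_restriction.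

(** * Reflexivity and separability *)

Section reflexivity.
Variables (R : realType) (V : normedModType R).

Lemma val_submod_linear (W : submodClosed V) :
  linear (val : submod_space W -> V).
Proof. by move=> a x y; rewrite linearP. Qed.

Definition submod_incl (W : submodClosed V) : {linear submod_space W -> V} :=
  HB.pack (val : submod_space W -> V)
    (GRing.isLinear.Build R _ V *:%R _ (@val_submod_linear W)).

Lemma submod_incl_norm (W : submodClosed V) (w : submod_space W) :
  `|submod_incl W w| = `|w|.
Proof. by []. Qed.

Lemma dual_restrict_surj (W : submodClosed V) (f : dual_space (submod_space W)) :
  exists g : dual_space V, dual_restrict (@submod_incl_norm W) g = f.
Proof.
have [|g gf _] := @dual_extension R V _ (submod_incl W) f `|f| (normr_ge0 _) (dual_funP f).1.
  by move=> x; exact: ler_dual.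
by exists g; apply/val_inj/funext => x /=; exact: gf.
Qed.

(** A functional on W^* acts on V^* through restriction, so it is the
    evaluation at some v in V.  This v lies in W, as otherwise some functional
    vanishing on W would not vanish at v. *)
Lemma reflexive_closed_subspace (W : submodClosed V) :
  closed [set v | v \in W] -> reflexive_space V ->
  reflexive_space (submod_space W).
Proof.
move=> Wc Vr Phi.
have Psip : (fun g => Phi (dual_restrict (@submod_incl_norm W) g)) \in @dual_pred R (dual_space V).
  apply: (@bounded_scalar_dual _ _ _ `|Phi|) => [a f g|g].
    by rewrite -linearP; congr (Phi _); exact/val_inj/funext.
  rewrite (le_trans (ler_dual _ _))// ler_wpM2l//.
  exact: dual_restrict_norm_le.
have [v vE] := Vr (Dual Psip).
have vW : v \in W.
  apply/negPn/negP => vW; have [g gv gW] := separating_functional Wc vW.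
  move/negP: gv; apply; rewrite -vE /=.
  have -> : dual_restrict (@submod_incl_norm W) g = 0 by apply/val_inj/funext => -[w wW] /=; exact: gW.
  by rewrite linear0.
exists (SubmodSpace vW) => f; have [g <-] := dual_restrict_surj f.
exact: (vE g).
Qed.

Definition dense_seq (U : normedModType R) (v : nat -> U) :=
  forall x e, 0 < e -> exists n, `|x - v n| < e.

(** Rational combinations are indexed by lists of coefficients, a countable
    type; this is what makes the closed linear span of a sequence separable. *)
Fixpoint qcomb (U : normedModType R) (v : nat -> U) (s : seq rat) (n : nat) : U :=
  if s is q :: s' then ratr q *: v n + qcomb v s' n.+1 else 0.

Definition qcombs (U : normedModType R) (v : nat -> U) (n : nat) : U :=
  if unpickle n is Some s then qcomb v s 0 else 0.

Lemma qcombsE (U : normedModType R) (v : nat -> U) s :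
  qcombs v (pickle s) = qcomb v s 0.
Proof. by rewrite /qcombs pickleK. Qed.

(** The coefficients of a times the combination s plus the combination t. *)
Fixpoint qadd (a : rat) (s t : seq rat) : seq rat :=
  match s, t with
  | [::], t => t
  | s, [::] => [seq a * x | x <- s]
  | x :: s', y :: t' => (a * x + y) :: qadd a s' t'
  end.

Lemma qcombZ (U : normedModType R) (v : nat -> U) a s n :
  qcomb v [seq a * x | x <- s] n = ratr a *: qcomb v s n.
Proof.
elim: s n => [|x s ih] n /=; first by rewrite scaler0.
by rewrite ih scalerDr scalerA rmorphM.
Qed.

Lemma qcomb_add (U : normedModType R) (v : nat -> U) a s t n :
  qcomb v (qadd a s t) n = ratr a *: qcomb v s n + qcomb v t n.
Proof.
elim: s t n => [|x s ih] [|y t] n //=.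
- by rewrite scaler0 addr0.
- by rewrite scaler0 add0r.
- by rewrite addr0 qcombZ scalerDr scalerA rmorphM.
rewrite ih rmorphD rmorphM /= scalerDr scalerDl scalerA.
by rewrite addrACA.
Qed.

Lemma qcomb_unit (U : normedModType R) (v : nat -> U) k n :
  qcomb v (rcons (nseq k 0) 1) n = v (n + k)%N.
Proof.
elim: k n => [|k ih] n /=; first by rewrite rmorph1 scale1r addr0 addn0.
by rewrite rmorph0 scale0r add0r ih addSnnS.
Qed.

Definition closed_qspan_pred (U : normedModType R) (v : nat -> U) : {pred U} :=
  mem [set x | forall e, 0 < e -> exists n, `|x - qcombs v n| < e].

Lemma closed_qspanP (U : normedModType R) (v : nat -> U) x :
  (x \in closed_qspan_pred v) <->
  forall e, 0 < e -> exists n, `|x - qcombs v n| < e.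
Proof. by split; rewrite inE. Qed.

Lemma ratr_approx (a e : R) : 0 < e -> exists q : rat, `|a - ratr q| < e.
Proof.
move=> e0.
have [|q] := @rat_in_itvoo R (a - e) (a + e); first by lra.
rewrite in_itv /= => /andP[q1 q2]; exists q.
by rewrite ltr_norml; apply/andP; split; lra.
Qed.

Lemma closed_qspan_submod (U : normedModType R) (v : nat -> U) :
  submod_closed (closed_qspan_pred v).
Proof.
split.
  apply/closed_qspanP => e e0; exists (pickle ([::] : seq rat)).
  by rewrite qcombsE /= subrr normr0.
move=> a x y /closed_qspanP hx /closed_qspanP hy; apply/closed_qspanP => e e0.
have apos : 0 < 3 * (`|a| + 1) by rewrite mulr_gt0// ltr_wpDl.
have [n xn] := hx (e / (3 * (`|a| + 1))) (divr_gt0 e0 apos).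
have [m ym] : exists m, `|y - qcombs v m| < e / 3 by apply: hy; lra.
have bpos : 0 < 3 * (`|qcombs v n| + 1) by rewrite mulr_gt0// ltr_wpDl.
have [q aq] := ratr_approx a (divr_gt0 e0 bpos).
have [s sE] : exists s, qcombs v n = qcomb v s 0.
  by rewrite /qcombs; case: unpickle => [s|]; [exists s|exists [::]].
have [t tE] : exists s, qcombs v m = qcomb v s 0.
  by rewrite /qcombs; case: unpickle => [t|]; [exists t|exists [::]].
exists (pickle (qadd q s t)); rewrite qcombsE qcomb_add -sE -tE.
have -> : a *: x + y - (ratr q *: qcombs v n + qcombs v m) =
   a *: (x - qcombs v n) + (a - ratr q) *: qcombs v n + (y - qcombs v m).
  rewrite scalerBr scalerBl opprD !addrA; congr (_ + _).
  by rewrite subrK [LHS]addrAC.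
have h1 : `|a *: (x - qcombs v n)| <= e / 3.
  rewrite normrZ (@le_trans _ _ ((`|a| + 1) * `|x - qcombs v n|))//.
    by rewrite ler_wpM2r// lerDl.
  rewrite (le_trans (ler_wpM2l _ (ltW xn)))// ?addr_ge0//.
  rewrite le_eqVlt; apply/orP; left; apply/eqP; field.
  by rewrite gt_eqF// ltr_wpDl.
have h2 : `|(a - ratr q) *: qcombs v n| <= e / 3.
  rewrite normrZ (@le_trans _ _ (`|a - ratr q| * (`|qcombs v n| + 1)))//.
    by rewrite ler_wpM2l// lerDl.
  rewrite (le_trans (ler_wpM2r _ (ltW aq)))// ?addr_ge0//.
  rewrite le_eqVlt; apply/orP; left; apply/eqP; field.
  by rewrite gt_eqF// ltr_wpDl.
rewrite (le_lt_trans (ler_normD _ _))// (le_lt_trans (lerD (ler_normD _ _) (lexx _)))//.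
lra.
Qed.

HB.instance Definition _ (U : normedModType R) (v : nat -> U) :=
  GRing.isSubmodClosed.Build R U (closed_qspan_pred v) (closed_qspan_submod v).

Lemma closed_qspan_mem (U : normedModType R) (v : nat -> U) n :
  v n \in closed_qspan_pred v.
Proof.
apply/closed_qspanP => e e0; exists (pickle (rcons (nseq n 0) (1 : rat))).
by rewrite qcombsE qcomb_unit add0n subrr normr0.
Qed.

Lemma qcombs_mem (U : normedModType R) (v : nat -> U) n :
  qcombs v n \in closed_qspan_pred v.
Proof. by apply/closed_qspanP => e e0; exists n; rewrite subrr normr0. Qed.

Lemma closed_qspan_closed (U : normedModType R) (v : nat -> U) :
  closed [set x | x \in closed_qspan_pred v].
Proof.
move=> x xc; apply/closed_qspanP => e e0.
have e2 : 0 < e / 2 by lra.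
have [y [/= /closed_qspanP yv]] := xc _ (nbhsx_ballx x _ e2).
rewrite -ball_normE /ball_ /= => xy; have [n yn] := yv _ e2; exists n.
rewrite -(subrK y x) -addrA (le_lt_trans (ler_normD _ _))//; lra.
Qed.

Lemma closed_qspan_dense (U : normedModType R) (v : nat -> U) :
  exists w : nat -> submod_space (closed_qspan_pred v),
    forall x e, 0 < e -> exists n, `|x - w n| < e.
Proof.
exists (fun n => SubmodSpace (qcombs_mem v n)) => -[x xv] e e0.
have [n xn] := (closed_qspanP v x).1 xv e e0.
by exists n.
Qed.

(** If x n is in the unit ball with |w n (x n)| >= |w n| / 2, a functional g
    that vanishes on all x n satisfies |g - w n| >= |g| / 4 for all n, hence is
    zero.  So the closed span of the x n is the whole space. *)
Lemma dual_separable (w : nat -> dual_space V) :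
  dense_seq w -> exists v : nat -> V, dense_seq v.
Proof.
move=> wd.
have ex n : exists x : V, `|x| <= 1 /\ `|w n| / 2 <= `|w n x|.
  have [w0|w0] := eqVneq `|w n| 0.
    by exists 0; rewrite w0 mul0r normr0.
  have wpos : 0 < `|w n| by rewrite lt_neqAle eq_sym w0/=.
  apply: contrapT => h.
  have : `|w n| <= `|w n| / 2.
    apply: dual_normr_le; first lra.
    move=> x; have [->|x0] := eqVneq x 0; first by rewrite linear0 !normr0 mulr0.
    have xpos : 0 < `|x| by rewrite normr_gt0.
    rewrite leNgt; apply/negP => hx; apply: h; exists (`|x|^-1 *: x); split.
      by rewrite normrZ normfV normr_id mulVf// gt_eqF.
    rewrite linearZ /= normrM normfV normr_id [leRHS]mulrC ler_pdivlMr//.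
    exact: ltW.
  by lra.
have [x x12] := choice ex.
have x1 n : `|x n| <= 1 by have [] := x12 n.
have x2 n : `|w n| / 2 <= `|w n (x n)| by have [] := x12 n.
exists (qcombs x) => y e e0.
suff : y \in closed_qspan_pred x by move=> /closed_qspanP; apply.
apply/negPn/negP => yx.
have [g gy gx] := separating_functional (@closed_qspan_closed _ x) yx.
have g0 : 0 < `|g|.
  by rewrite normr_gt0; apply: contra_neq gy => ->.
have [n gn] : exists n, `|g - w n| < `|g| / 4 by apply: wd; lra.
have h1 : `|w n (x n)| <= `|g - w n|.
  have -> : w n (x n) = - (g - w n) (x n).
    by rewrite /= !fctE gx ?closed_qspan_mem// sub0r opprK.
  rewrite normrN (le_trans (ler_dual _ _))//.
  by rewrite -[leRHS]mulr1 ler_wpM2l.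
have h2 : `|g| <= `|g - w n| + `|w n|.
  by rewrite -[X in `|X| <= _](subrK (w n)) ler_normD.
have := x2 n; lra.
Qed.

End reflexivity.

Section bidual.
Variables (R : realType) (V : normedModType R).

Lemma bidual_eval_subproof (x : V) :
  (fun g : dual_space V => g x) \in @dual_pred R (dual_space V).
Proof.
apply: (@bounded_scalar_dual _ _ _ `|x|) => [//|g].
by rewrite mulrC; exact: ler_dual.
Qed.
Definition bidual_eval (x : V) : dual_space (dual_space V) :=
  Dual (bidual_eval_subproof x).

(** The dual of V^* is V, which is separable, and a space with a separable
    dual is separable. *)
Lemma reflexive_dual_separable (v : nat -> V) :
  reflexive_space V -> dense_seq v ->
  exists w : nat -> dual_space V, dense_seq w.
Proof.
move=> Vr vd; apply: (@dual_separable R (dual_space V) (fun n => bidual_eval (v n))).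
move=> Phi e e0; have [x xE] := Vr Phi; have [n xn] := vd x e e0; exists n.
rewrite (le_lt_trans _ xn)//; apply: dual_normr_le => // g.
rewrite /= !fctE /= xE -linearB mulrC; exact: ler_dual.
Qed.

End bidual.

(** * Ultralimits, integrals and densities *)

Section ultralimits.
Variables (R : realType) (U : set_system nat).
Hypothesis UU : UltraFilter U.

(** In a weak topology a sequence in a compact set need not have a convergent
    subsequence, but it converges along every ultrafilter. *)
Lemma compact_ultra_cvg (S : topologicalType) (K : set S) (u : nat -> S) :
  compact K -> (forall n, K (u n)) ->
  exists l : S, K l /\ u n @[n --> U] --> l.
Proof.
move=> Kc Ku; have UP : ProperFilter U := @ultra_proper _ _ UU.
have UK : U (u @^-1` K) by apply: (filterE (F := U)) => n; exact: Ku.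
have [l [Kl cl]] := Kc (u @ U) _ UK.
exists l; split => // A lA.
have [//|UA] := in_ultra_setVsetC (u @^-1` A) UU.
by have [x [Ax]] := cl (~` A) A UA lA; [].
Qed.

Lemma bounded_ultra_cvg (u : nat -> R) (M : R) :
  (forall n, `|u n| <= M) -> exists l : R, u n @[n --> U] --> l.
Proof.
move=> uM.
have [|l [_ ul]] := compact_ultra_cvg (@segment_compact R (- M) M) (u := u).
  by move=> n /=; rewrite in_itv/= -ler_norml.
by exists l.
Qed.

End ultralimits.

Section finite_measure_integrals.
Context d (T : measurableType d) (R : realType).
Variable mu : {finite_measure set T -> \bar R}.
Implicit Types (f g : T -> R) (A B : set T).

Definition summable f := mu.-integrable setT (EFin \o f).

Lemma summable_measurable f : summable f -> measurable_fun setT f.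
Proof. by move=> /measurable_int/measurable_EFinP. Qed.

Lemma summableS f A : measurable A -> summable f -> mu.-integrable A (EFin \o f).
Proof. by move=> mA; exact: integrableS. Qed.

Lemma summable_le f g : measurable_fun setT f -> summable g ->
  (forall t, `|f t| <= g t) -> summable f.
Proof.
move=> mf ig fg; apply: le_integrable ig => //; first exact/measurable_EFinP.
by move=> t _ /=; rewrite lee_fin (le_trans (fg t))// ler_norm.
Qed.

Lemma summable_cst c : summable (cst c).
Proof. exact: finite_measure_integrable_cst. Qed.

Lemma summable_norm f : summable f -> summable (fun t => `|f t|).
Proof. exact: integrable_norm. Qed.

Lemma summableD f g : summable f -> summable g -> summable (fun t => f t + g t).
Proof. by move=> sf sg; exact: (integrableD measurableT sf sg). Qed.

Lemma summableZ c f : summable f -> summable (fun t => c * f t).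
Proof. by move=> sf; exact: (integrableZl measurableT c sf). Qed.

Lemma summableB f g : summable f -> summable g -> summable (fun t => f t - g t).
Proof. by move=> sf sg; exact: (integrableB measurableT sf sg). Qed.

Lemma int_ge0 f A : (forall t, 0 <= f t) -> 0 <= \int[mu]_(t in A) f t.
Proof. by move=> f0; exact: Rintegral_ge0. Qed.

Lemma int_le f g A : measurable A -> summable f -> summable g ->
  (forall t, A t -> f t <= g t) -> \int[mu]_(t in A) f t <= \int[mu]_(t in A) g t.
Proof. by move=> mA sf sg fg; apply: le_Rintegral => //; exact: summableS. Qed.

Lemma int_norm_le f g A : measurable A -> summable f -> summable g ->
  (forall t, A t -> `|f t| <= g t) ->
  `|\int[mu]_(t in A) f t| <= \int[mu]_(t in A) g t.
Proof.
move=> mA sf sg fg; rewrite (le_trans (le_normr_Rintegral mA (summableS mA sf)))//.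
by apply: int_le => //; exact: summable_norm.
Qed.

Lemma intD f g A : measurable A -> summable f -> summable g ->
  \int[mu]_(t in A) (f t + g t) = \int[mu]_(t in A) f t + \int[mu]_(t in A) g t.
Proof. by move=> mA sf sg; rewrite RintegralD//; exact: summableS. Qed.

Lemma intB f g A : measurable A -> summable f -> summable g ->
  \int[mu]_(t in A) (f t - g t) = \int[mu]_(t in A) f t - \int[mu]_(t in A) g t.
Proof. by move=> mA sf sg; rewrite RintegralB//; exact: summableS. Qed.

Lemma intZ c f A : measurable A -> summable f ->
  \int[mu]_(t in A) (c * f t) = c * \int[mu]_(t in A) f t.
Proof. by move=> mA sf; rewrite RintegralZl//; exact: summableS. Qed.

Lemma int_setU f A B : measurable A -> measurable B -> A `&` B = set0 ->
  summable f ->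
  \int[mu]_(t in A `|` B) f t = \int[mu]_(t in A) f t + \int[mu]_(t in B) f t.
Proof.
move=> mA mB AB sf; rewrite Rintegral_setU//.
  by apply: summableS => //; exact: measurableU.
exact/eqP.
Qed.

Lemma int_split f A B : measurable A -> measurable B -> summable f ->
  \int[mu]_(t in A) f t =
  \int[mu]_(t in A `&` B) f t + \int[mu]_(t in A `&` ~` B) f t.
Proof.
move=> mA mB sf; rewrite -int_setU//; first by rewrite -setIUr setUv setIT.
- exact: measurableI.
- by apply: measurableI => //; exact: measurableC.
- by rewrite setIACA setICr setI0.
Qed.

Lemma int_subset f A B : measurable A -> measurable B -> A `<=` B ->
  (forall t, 0 <= f t) -> summable f ->
  \int[mu]_(t in A) f t <= \int[mu]_(t in B) f t.
Proof.
move=> mA mB AB f0 sf; rewrite (int_split mB mA)//.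
by rewrite setIC (setIidl AB) lerDl int_ge0.
Qed.

Lemma int_cst c A : measurable A -> \int[mu]_(t in A) c = c * fine (mu A).
Proof. by move=> mA; exact: Rintegral_cst. Qed.

Lemma eq_int_ae f g A : measurable A -> measurable_fun setT f ->
  measurable_fun setT g -> (\forall t \ae mu, f t = g t) ->
  \int[mu]_(t in A) f t = \int[mu]_(t in A) g t.
Proof.
move=> mA mf mg fg; congr fine; apply: ae_eq_integral => //.
- by apply/measurable_EFinP; exact: measurable_funTS.
- by apply/measurable_EFinP; exact: measurable_funTS.
- by apply: filterS fg => t + _; move=> ->.
Qed.

Lemma EFin_int f A : measurable A -> summable f ->
  (\int[mu]_(t in A) f t)%:E = (\int[mu]_(t in A) (f t)%:E)%E.
Proof.
move=> mA sf; rewrite fineK//.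
exact/integrable_fin_num/(summableS mA sf).
Qed.

Lemma ae_le_of_int f g : summable f -> summable g ->
  (forall A, measurable A -> \int[mu]_(t in A) f t <= \int[mu]_(t in A) g t) ->
  \forall t \ae mu, f t <= g t.
Proof.
move=> sf sg fg; pose B := [set t | g t < f t].
have mB : measurable B.
  have -> : B = ~` (setT `&` [set t | f t <= g t]).
    by apply/seteqP; split=> t; rewrite setTI /B/= ltNge => /negP.
  apply: measurableC; apply: measurable_fun_le => //; exact: summable_measurable.
have : ae_eq mu B (EFin \o f) (EFin \o g).
  apply: integral_ae_eq => //.
  - exact: summableS.
  - apply: measurable_funTS; exact: measurable_int sg.
  move=> E EB mE; rewrite -[LHS]EFin_int// -[RHS]EFin_int//; congr EFin.
  apply/eqP; rewrite eq_le fg//= int_le// => t /EB; exact: ltW.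
apply: filterS => t /= h; rewrite leNgt; apply/negP => tB.
by have [] := h tB => ftg; move: tB; rewrite ftg ltxx.
Qed.

Lemma ae_norm_le_of_int f g : summable f -> summable g ->
  (forall A, measurable A -> `|\int[mu]_(t in A) f t| <= \int[mu]_(t in A) g t) ->
  \forall t \ae mu, `|f t| <= g t.
Proof.
move=> sf sg fg.
have h1 : \forall t \ae mu, f t <= g t.
  by apply: ae_le_of_int => // A mA; rewrite (le_trans (ler_norm _))// fg.
have h2 : \forall t \ae mu, -1 * f t <= g t.
  apply: ae_le_of_int => //; first exact: summableZ.
  move=> A mA; rewrite intZ// mulN1r (le_trans _ (fg _ mA))//.
  by rewrite -normrN ler_norm.
by apply: filterS2 h1 h2 => t ft; rewrite mulN1r lerNl ler_norml ft => ->.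
Qed.

Lemma vanishing_measure (D : nat -> set T) :
  (forall n, measurable (D n)) -> nonincreasing_seq D -> \bigcap_n D n = set0 ->
  forall e, 0 < e -> exists N, forall n, (N <= n)%N -> (mu (D n) < e%:E)%E.
Proof.
move=> mD nD D0 e e0.
have := @nonincreasing_cvg_mu _ _ _ mu D; rewrite D0 measure0.
move=> /(_ _ mD measurable0 nD)/wrap[]; first by rewrite ltey_eq fin_num_measure.
move=> /fine_cvgP[_ /cvgrPdist_lt/(_ _ e0)[N _ NP]].
exists N => n Nn; have := NP n Nn; rewrite /= sub0r normrN => h.
rewrite -(@fineK _ (mu (D n))) ?fin_num_measure// lte_fin.
by rewrite (le_lt_trans (ler_norm _)).
Qed.

Definition abs_continuous (m : set T -> R) := forall e, 0 < e ->
  exists2 r, 0 < r & forall A, measurable A -> (mu A < r%:E)%E -> `|m A| <= e.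

(** Absolute continuity turns finite additivity into countable additivity:
    the tails of a countable disjoint union decrease to the empty set.  Then the
    Radon-Nikodym theorem for charges applies. *)
Lemma density_of_additive (m : set T -> R) :
  (forall A B, measurable A -> measurable B -> A `&` B = set0 ->
     m (A `|` B) = m A + m B) ->
  abs_continuous m ->
  exists2 h, summable h & forall A, measurable A -> m A = \int[mu]_(t in A) h t.
Proof.
move=> madd mac.
have m0 : m set0 = 0.
  by have := madd set0 set0 measurable0 measurable0 (setI0 _); rewrite setU0 => ?; lra.
pose nu A := (m A)%:E.
have nu0 : nu set0 = 0%E by rewrite /nu m0.
have nufin A : measurable A -> nu A \is a fin_num by [].
have nus : semi_sigma_additive nu.
  move=> F mF tF mUF.
  pose G n := \bigcup_(i in `I_n) F i.
  have mG n : measurable (G n) by apply: bigcup_measurable.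
  have GS n : G n.+1 = G n `|` F n.
    apply/seteqP; split=> [t [i /= + Fit]|t [[i /= iltn Fit]|Fnt]].
    - rewrite ltnS leq_eqVlt => /orP[/eqP <-|iltn]; first by right.
      by left; exists i.
    - by exists i => //=; rewrite ltnS ltnW.
    - by exists n => /=.
  have mGE n : (\sum_(0 <= i < n) nu (F i))%E = (m (G n))%:E.
    elim: n => [|n ih].
      by rewrite big_geq// [G _](_ : _ = set0) ?m0//; apply/seteqP; split=> // t [].
    rewrite big_nat_recr//= ih GS madd//; apply/seteqP; split=> // t [[i /= iltn Fit] Fnt].
    have iE : i = n by apply: tF => //; exists t.
    by rewrite iE ltnn in iltn.
  pose W n := \bigcup_i F i `\` G n.
  have mW n : measurable (W n) by exact: measurableD.
  have mWE n : m (\bigcup_i F i) = m (G n) + m (W n).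
    rewrite -madd//; last by rewrite /W setDE setICA setICr setI0.
    by congr m; rewrite /W setDE setUIr setUv setIT setUidr//; apply: bigcup_subset.
  have nW : nonincreasing_seq W.
    move=> i j ij; apply/subsetPset => t [Ft Gt]; split => // -[k /= ki Fkt].
    by apply: Gt; exists k => //=; exact: leq_trans ki ij.
  have W0 : \bigcap_n W n = set0.
    apply/seteqP; split=> // t Wt.
    by have [[i _ Fit] _] := Wt 0%N I; have [_] := Wt i.+1 I; apply; exists i => /=.
  rewrite (_ : (fun n => _) = EFin \o (m \o G)); last exact/funext.
  apply: cvg_EFin; first exact: nearW.
  apply/cvgrPdist_le => e e0.
  have [r r0 rm] := mac e e0; have [N NW] := vanishing_measure mW nW W0 r0.
  exists N => // n /= Nn; rewrite (mWE n) /= addrAC subrr add0r.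
  by apply: rm => //; exact: NW.
pose nuC : {charge set T -> \bar R} := HB.pack nu
  (isCharge.Build _ _ _ nu nu0 nufin nus).
have numu : nuC `<< mu.
  apply/null_content_dominatesP => A mA muA0; congr EFin.
  apply/normr0_eq0/eqP; rewrite eq_le normr_ge0 andbT.
  apply/ler_addgt0Pl => e e0; rewrite addr0.
  by have [r r0 rm] := mac e e0; apply: rm => //; rewrite muA0 lte_fin.
pose h t := fine (Radon_Nikodym nuC mu t).
have hE : EFin \o h = Radon_Nikodym nuC mu.
  by apply/funext => t /=; rewrite fineK// Radon_Nikodym_fin_num.
exists h; first by rewrite /summable hE; exact: Radon_Nikodym_integrable.
move=> A mA; apply: EFin_inj.
rewrite EFin_int//; last by rewrite /summable hE; exact: Radon_Nikodym_integrable.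
transitivity (nuC A) => //; rewrite (Radon_Nikodym_integral numu mA).
by apply: eq_integral => t _; rewrite -hE.
Qed.

End finite_measure_integrals.

(** * Densities of vector measures *)

Lemma real_cvg_unique (R : realType) (F : set_system nat) {FF : ProperFilter F}
  (u : nat -> R) (l l' : R) : u @ F --> l -> u @ F --> l' -> l = l'.
Proof.
move=> /(cvg_lim (@norm_hausdorff _ _)) <-.
by move=> /(cvg_lim (@norm_hausdorff _ _)) <-.
Qed.

Section vector_densities.
Context d (T : measurableType d) (R : realType).
Variable mu : {finite_measure set T -> \bar R}.
Local Notation summable := (@summable _ T R mu).

Lemma int_small f : summable f -> (forall t, 0 <= f t) -> forall e, 0 < e ->
  exists2 r, 0 < r & forall A, measurable A -> (mu A < r%:E)%E ->
    \int[mu]_(t in A) f t <= e.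
Proof.
move=> sf f0 e e0; have [r [r0 rP]] := integral_normr_continuous sf e0.
exists r => // A mA /(rP _ mA) /ltW; congr (_ <= _).
by apply: eq_Rintegral => t _; rewrite ger0_norm.
Qed.

Lemma dense_seq_cvg (V : normedModType R) (v : nat -> V) : dense_seq v ->
  exists k : V -> nat -> nat, forall x, v (k x n) @[n --> \oo] --> x.
Proof.
move=> vd.
have ex (p : V * nat) : exists k, `|p.1 - v k| < p.2.+1%:R^-1.
  by apply: vd; rewrite invr_gt0.
have [k kP] := choice ex.
exists (fun x n => k (x, n)) => x; apply/cvgrPdist_lt => e e0.
near=> n; rewrite (lt_trans (kP (x, n)))//=; near: n.
exact: near_infty_natSinv_lt (PosNum e0).
Unshelve. all: by end_near. Qed.

(** The Radon-Nikodym theorem for the dual of a separable space.  Each x has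
    a scalar density h x.  For almost every t, the values h (v k) t at the dense
    sequence are Lipschitz and linear up to the error
    |v j - q v k - v l| rho t, for all j, k, l and all rational q: only countably
    many null sets are discarded.  For such t they extend to a functional of
    norm at most rho t. *)
Lemma vector_density (V : normedModType R) (v : nat -> V) (vd : dense_seq v)
    (m : V -> set T -> R) (rho : T -> R) :
  summable rho -> (forall t, 0 <= rho t) ->
  (forall x A B, measurable A -> measurable B -> A `&` B = set0 ->
     m x (A `|` B) = m x A + m x B) ->
  (forall a x y A, measurable A -> m (a *: x + y) A = a * m x A + m y A) ->
  (forall x A, measurable A -> `|m x A| <= `|x| * \int[mu]_(t in A) rho t) ->
  exists g : T -> dual_space V,
    [/\ forall x, measurable_fun setT (fun t => g t x),
        forall t, `|g t| <= rho t &
        forall x A, measurable A -> m x A = \int[mu]_(t in A) g t x].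
Proof.
move=> sr r0 madd mlin mle.
have hx x : exists h, summable h /\
    forall A, measurable A -> m x A = \int[mu]_(t in A) h t.
  have [|e e0|h sh hE] := @density_of_additive _ T R mu (m x); last by exists h.
    exact: madd.
  have c0 : 0 < `|x| + 1 by rewrite ltr_wpDl.
  have [r rpos rP] := int_small sr r0 (divr_gt0 e0 c0).
  exists r => // A mA /(rP _ mA) h; rewrite (le_trans (mle _ _ mA))//.
  rewrite (@le_trans _ _ ((`|x| + 1) * \int[mu]_(t in A) rho t))//.
    by rewrite ler_wpM2r ?int_ge0// lerDl.
  by move: h; rewrite ler_pdivlMr// mulrC.
have [h hP] := choice hx.
have sh x : summable (h x) by have [] := hP x.
have hE x A : measurable A -> m x A = \int[mu]_(t in A) h x t.
  by have [_] := hP x; exact.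
have key x y z a : \forall t \ae mu,
    `|h x t - a * h y t - h z t| <= `|x - a *: y - z| * rho t.
  have saxy : summable (fun t => h x t - a * h y t).
    by apply: summableB => //; exact: summableZ.
  apply: ae_norm_le_of_int; [exact: summableB|exact: summableZ|move=> A mA].
  rewrite intZ// intB// intB// ?intZ//; last exact: summableZ.
  rewrite -!hE// (le_trans _ (mle _ _ mA))//.
  have -> : x - a *: y - z = (-1) *: z + ((- a) *: y + x).
    by rewrite scaleN1r scaleNr; rewrite addrC; congr (_ + _); rewrite addrC.
  rewrite !mlin// le_eqVlt; apply/orP; left; apply/eqP; congr `|_|; ring.
have : \forall t \ae mu, forall n : nat,
    if (unpickle n : option (nat * nat * nat * rat)) is Some (j, k, l, q)
    then `|h (v j) t - ratr q * h (v k) t - h (v l) t| <=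
         `|v j - ratr q *: v k - v l| * rho t else true.
  apply: ae_foralln => n; case: (unpickle n) => [[[[j k] l] q]|].
    exact: key.
  exact: nearW.
move=> [N [mN muN0 Nsub]].
have good t : ~ N t -> forall j k l (q : rat),
    `|h (v j) t - ratr q * h (v k) t - h (v l) t| <=
    `|v j - ratr q *: v k - v l| * rho t.
  move=> Nt j k l q.
  have : ~ ~ (forall n : nat,
    if (unpickle n : option (nat * nat * nat * rat)) is Some (j, k, l, q)
    then `|h (v j) t - ratr q * h (v k) t - h (v l) t| <=
         `|v j - ratr q *: v k - v l| * rho t else true).
    by move=> h'; apply: Nt; apply: Nsub.
  by move=> /contrapT/(_ (pickle (j, k, l, q))); rewrite pickleK.
have good0 t : ~ N t -> forall j l,
    `|h (v j) t - h (v l) t| <= `|v j - v l| * rho t.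
  move=> Nt j l; have := good t Nt j 0%N l 0.
  by rewrite rmorph0 mul0r scale0r !subr0.
(* Lipschitz extension from the dense sequence, by the formula of McShane *)
pose L t x := inf [set h (v k) t + `|x - v k| * rho t | k in setT].
have Lh t : ~ N t -> forall x k, `|L t x - h (v k) t| <= `|x - v k| * rho t.
  move=> Nt x k.
  have lb : lbound [set h (v k) t + `|x - v k| * rho t | k in setT]
      (h (v k) t - `|x - v k| * rho t).
    move=> _ [j _ <-]; have := good0 t Nt k j.
    rewrite ler_norml => /andP[_]; rewrite lerBlDr lerBlDl => h1.
    have h2 : `|v k - v j| <= `|x - v k| + `|x - v j|.
      by rewrite (distrC x); exact: ler_distD.
    by have := ler_wpM2r (r0 t) h2; rewrite mulrDl => ?; lra.
  rewrite ler_norml; apply/andP; split.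
    rewrite lerNl opprB lerBlDl -lerBlDr; apply: lb_le_inf => //.
    by exists (h (v 0%N) t + `|x - v 0%N| * rho t); exists 0%N.
  rewrite lerBlDl; apply: ge_inf; last by exists k.
  by exists (h (v k) t - `|x - v k| * rho t).
have [k kP] := dense_seq_cvg vd.
have hcvg t x (l : R) : (forall k, `|l - h (v k) t| <= `|x - v k| * rho t) ->
    h (v (k x n)) t @[n --> \oo] --> l.
  move=> lh.
  have : (`|x - v (k x n)| * rho t) @[n --> \oo] --> 0.
    rewrite -[X in _ --> X](mul0r (rho t)) -(normr0 V) -(subrr x).
    apply: cvgMl; apply: cvg_norm; apply: cvgB; [exact: cvg_cst|exact: kP].
  move=> /cvgrPdist_le c; apply/cvgrPdist_le => e e0.
  apply: filterS (c e e0) => n /=; rewrite sub0r normrN => hn.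
  by rewrite (le_trans (lh _))// (le_trans (ler_norm _)).
have Lcvg t x : ~ N t -> h (v (k x n)) t @[n --> \oo] --> L t x.
  by move=> Nt; apply: hcvg => j; exact: Lh.
have Llin t : ~ N t -> scalar (L t).
  move=> Nt a x y.
  have qex n : exists q : rat, `|a - ratr q| < n.+1%:R^-1.
    by apply: ratr_approx; rewrite invr_gt0.
  have [q qP] := choice qex.
  have qa : (ratr (q n) : R) @[n --> \oo] --> a.
    apply/cvgrPdist_lt => e e0; near=> n; rewrite (lt_trans (qP n))//; near: n.
    exact: near_infty_natSinv_lt (PosNum e0).
  have c1 : (h (v (k (a *: x + y) n)) t - ratr (q n) * h (v (k x n)) t
      - h (v (k y n)) t) @[n --> \oo] --> L t (a *: x + y) - a * L t x - L t y.
    by apply: cvgB; [apply: cvgB; [exact: Lcvg|apply: cvgM => //; exact: Lcvg]|exact: Lcvg].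
  have c2 : (`|v (k (a *: x + y) n) - (ratr (q n) : R) *: v (k x n) - v (k y n)| * rho t)
      @[n --> \oo] --> 0.
    rewrite -[X in _ --> X](mul0r (rho t)) -(normr0 V).
    have -> : (0 : V) = a *: x + y - a *: x - y by rewrite addrAC addrK subrr.
    apply: cvgMl; apply: cvg_norm; apply: cvgB => //; apply: cvgB => //.
    exact: cvgZ.
  have c3 : (h (v (k (a *: x + y) n)) t - ratr (q n) * h (v (k x n)) t
      - h (v (k y n)) t) @[n --> \oo] --> 0.
    apply/cvgrPdist_le => e e0; move/cvgrPdist_le : c2 => /(_ e e0).
    apply: filterS => n /=; rewrite !sub0r !normrN => hn.
    by rewrite (le_trans (good _ Nt _ _ _ _))// (le_trans (ler_norm _)).
  have E : L t (a *: x + y) - a * L t x - L t y = 0 by exact: real_cvg_unique c1 c3.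
  by apply/eqP; rewrite -subr_eq0 opprD addrA E.
have hv t : ~ N t -> forall j, `|h (v j) t| <= `|v j| * rho t.
  move=> Nt j; have := good t Nt 0%N j 0%N 1.
  by rewrite rmorph1 mul1r scale1r addrAC subrr sub0r normrN addrAC subrr sub0r normrN.
have Lb t : ~ N t -> forall x, `|L t x| <= rho t * `|x|.
  move=> Nt x.
  have c1 : `|h (v (k x n)) t| @[n --> \oo] --> `|L t x|.
    by apply: cvg_norm; exact: Lcvg.
  have c2 : (`|v (k x n)| * rho t) @[n --> \oo] --> `|x| * rho t.
    by apply: cvgMl; apply: cvg_norm; exact: kP.
  rewrite mulrC; apply: (ler_cvg_to c1 c2); apply: nearW => n; exact: hv.
have gex t : exists g : dual_space V, [/\ N t -> g = 0,
    ~ N t -> forall x, g x = L t x & `|g| <= rho t].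
  have [Nt|Nt] := pselect (N t); first by exists 0; split => //; rewrite normr0.
  exists (Dual (bounded_scalar_dual (Llin t Nt) (Lb t Nt))); split => //.
  by apply: dual_normr_le => // x; exact: Lb.
have [g gP] := choice gex.
have mg x : measurable_fun setT (fun t => g t x).
  apply: (@measurable_realfun.measurable_fun_cvg _ _ _ _
    (fun n t => \1_(~` N) t * h (v (k x n)) t)) => [n|t _].
    apply: measurable_funM; last exact: summable_measurable.
    by apply: measurable_indic; exact: measurableC.
  have [g1 g2 _] := gP t; have [Nt|Nt] := pselect (N t).
    rewrite g1// [X in X @ _](_ : _ = cst 0); first exact: cvg_cst.
    by apply/funext => n; rewrite indicE memNset ?mul0r//= => /(_ Nt).
  rewrite g2// [X in X @ _](_ : _ = fun n => h (v (k x n)) t); first exact: Lcvg.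
  by apply/funext => n; rewrite indicE mem_set ?mul1r.
exists g; split => // [t|x A mA]; first by have [] := gP t.
rewrite hE//; apply: eq_int_ae => //; first exact: summable_measurable.
have nN : \forall t \ae mu, ~ N t by exists N; split => // t /= /contrapT.
have hx' : \forall t \ae mu, forall j, `|h x t - h (v j) t| <= `|x - v j| * rho t.
  apply: ae_foralln => j; apply: filterS (key x x (v j) 0) => t.
  by rewrite mul0r scale0r !subr0.
apply: filterS2 nN hx' => t Nt hxt; have [_ g2 _] := gP t; rewrite g2//.
exact: (real_cvg_unique (hcvg t x _ hxt) (Lcvg t x Nt)).
Unshelve. all: by end_near. Qed.

End vector_densities.

(** * Strong measurability *)

Section strong_measurability_tools.
Context d (T : measurableType d) (R : realType).
Local Notation strongly := (strongly_measurable (@measurable d T)).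

Lemma strongly_measurable_range (V : normedModType R) (f : T -> V) :
  strongly f -> exists x : nat -> V,
    forall t e, 0 < e -> exists k, `|f t - x k| < e.
Proof.
move=> [s ss sf].
have : countable (\bigcup_n range (s n)).
  apply: bigcup_countable => // n _; apply: finite_set_countable.
  by have [] := ss n.
move=> /pcard_surjP[x xs]; exists x => t e e0.
have /cvgrPdist_lt/(_ e e0)[n _ /(_ n (leqnn n)) /= fsn] := sf t.
have [|k _ xk] := xs (s n t); first by exists n => //; exists t.
by exists k; rewrite xk.
Qed.

Lemma simple_if (V : normedModType R) A (f g : T -> V) : measurable A ->
  simple_function (@measurable d T) f -> simple_function (@measurable d T) g ->
  simple_function (@measurable d T) (fun t => if t \in A then f t else g t).
Proof.
move=> mA [ff mf] [fg mg]; split.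
  apply: (sub_finite_set (B := range f `|` range g)); last by rewrite finite_setU.
  by move=> _ [t _ <-]; case: ifP => _; [left|right]; exists t.
move=> v.
rewrite (_ : _ @^-1` _ = (A `&` f @^-1` [set v]) `|` (~` A `&` g @^-1` [set v])).
  by apply: measurableU; apply: measurableI => //; exact: measurableC.
apply/seteqP; split=> t /=.
  case: ifPn => [|/negP] tA h; [left|right]; split=> //; first exact: set_mem.
  by move=> At; apply: tA; exact: mem_set.
by move=> [[At <-]|[At <-]]; [rewrite mem_set|rewrite memNset].
Qed.

Lemma strongly_measurable_if (V : normedModType R) A (f g : T -> V) :
  measurable A -> strongly f -> strongly g ->
  strongly (fun t => if t \in A then f t else g t).
Proof.
move=> mA [s ss sf] [r rs rg].
exists (fun n t => if t \in A then s n t else r n t) => [n|t].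
  exact: simple_if.
by case: ifP => _; [exact: sf|exact: rg].
Qed.

Lemma strongly_measurable_restrict (V : normedModType R) A (f : T -> V) :
  measurable A -> strongly f ->
  strongly (fun t => if t \in A then f t else 0).
Proof. by move=> mA sf; apply: strongly_measurable_if => //; exact: strongly_measurable_cst. Qed.

Lemma strongly_measurableB (V : normedModType R) (f g : T -> V) :
  strongly f -> strongly g -> strongly (fun t => f t - g t).
Proof.
move=> sf sg; apply: (strongly_measurable_op (op := fun x y : V => x - y)) => //.
by move=> *; exact: cvgB.
Qed.

Lemma strongly_measurableL (V W : normedModType R) (f : T -> V) (L : V -> W) :
  continuous L -> strongly f -> strongly (fun t => L (f t)).
Proof.
move=> cL sf; apply: (strongly_measurable_op (op := fun x _ : V => L x) _ sf sf).
by move=> u1 u2 v1 v2 c _; apply: (cvg_comp _ _ c); exact: cL.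
Qed.

Lemma strongly_measurable_dist (V : normedModType R) (f : T -> V) c :
  strongly f -> measurable_fun setT (fun t => `|f t - c|).
Proof.
move=> sf; apply: (strongly_measurable_norm (f := fun t => f t - c)).
by apply: strongly_measurableB => //; exact: strongly_measurable_cst.
Qed.

Lemma measurable_lt_set (f : T -> R) e : measurable_fun setT f ->
  measurable [set t | f t < e].
Proof.
move=> mf; have -> : [set t | f t < e] = ~` (setT `&` [set t | e <= f t]).
  by apply/seteqP; split=> t; rewrite setTI /= ltNge => /negP.
by apply: measurableC; apply: measurable_fun_le.
Qed.

Lemma in_set_bool (p : pred T) t : (t \in [set x | p x]) = p t.
Proof. by apply/idP/idP => [/set_mem|pt]; [|exact: mem_set]. Qed.

(** The approximation s n t is a point of x 0, ..., x n nearest to f t. *)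
Lemma dense_dist_strongly_measurable (V : normedModType R) (x : nat -> V)
    (f : T -> V) :
  (forall t e, 0 < e -> exists k, `|f t - x k| < e) ->
  (forall k, measurable_fun setT (fun t => `|f t - x k|)) ->
  strongly f.
Proof.
move=> xd mx.
pose s := fix s n t := if n is n'.+1 then
  (if t \in [set t | `|f t - x n| < `|f t - s n' t|] then x n else s n' t)
  else x 0%N.
have sP n : simple_function (@measurable d T) (s n) /\
    measurable_fun setT (fun t => `|f t - s n t|).
  elim: n => [|n [ih1 ih2]]; first by split; [exact: simple_cst|exact: mx].
  split.
    apply: (simple_if (f := fun=> x n.+1)) => //; last exact: simple_cst.
    have -> : [set t | `|f t - x n.+1| < `|f t - s n t|] =
        ~` (setT `&` [set t | `|f t - s n t| <= `|f t - x n.+1|]).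
      by apply/seteqP; split=> t; rewrite setTI /= ltNge => /negP.
    by apply: measurableC; apply: measurable_fun_le.
  rewrite (_ : (fun t => _) =
    ((fun t => `|f t - x n.+1|) \min (fun t => `|f t - s n t|))).
    exact: measurable_minr.
  apply/funext => t /=; rewrite /Order.min.
  by rewrite (in_set_bool (fun t => `|f t - x n.+1| < `|f t - s n t|)); case: ifP.
have smono t n k : (k <= n)%N -> `|f t - s n t| <= `|f t - x k|.
  elim: n => [|n ih]; first by rewrite leqn0 => /eqP ->.
  have sS : `|f t - s n.+1 t| <= `|f t - x n.+1| /\ `|f t - s n.+1 t| <= `|f t - s n t|.
    rewrite /= (in_set_bool (fun t => `|f t - x n.+1| < `|f t - s n t|)).
    by case: ifPn => [/ltW//|]; rewrite -leNgt.
  rewrite leq_eqVlt => /orP[/eqP ->|]; first exact: sS.1.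
  by rewrite ltnS => /ih; exact: le_trans sS.2.
exists s => [n|t]; first exact: (sP n).1.
apply/cvgrPdist_lt => e e0; have [k kP] := xd t e e0.
by exists k => // n /= kn; exact: le_lt_trans (smono _ _ _ kn) kP.
Qed.

(** The dual norm is a supremum over the dense sequence, which is countable. *)
Lemma dual_norm_measurable (V : normedModType R) (v : nat -> V)
    (f : T -> dual_space V) : dense_seq v ->
  (forall k, measurable_fun setT (fun t => f t (v k))) ->
  measurable_fun setT (fun t => `|f t|).
Proof.
move=> vd mf.
pose h k t := `|v k|^-1 * `|f t (v k)|.
have hf k t : h k t <= `|f t|.
  rewrite /h; have [->|v0] := eqVneq (v k) 0; first by rewrite normr0 invr0 mul0r.
  by rewrite ler_pdivrMl ?normr_gt0// mulrC ler_dual.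
have hub t : has_ubound (range (h^~ t)).
  by exists `|f t| => _ [k _ <-].
rewrite (_ : (fun t => _) = (fun t => sups (h^~ t) 0%N)).
  apply: measurable_fun_sups => [t _|k]; first exact: hub.
  apply: measurable_funM => //; apply: measurableT_comp => //.
apply/funext => t; have -> : sups (h^~ t) 0%N = sup (range (h^~ t)).
  by congr sup; apply/seteqP; split=> _ [k _ <-]; exists k.
have sup_ge0 : 0 <= sup (range (h^~ t)).
  rewrite (@le_trans _ _ (h 0%N t))//; first by rewrite mulr_ge0// invr_ge0.
  by apply: ub_le_sup => //; exists 0%N.
apply/eqP; rewrite eq_le; apply/andP; split; last first.
  by apply: ge_sup; [exists (h 0%N t); exists 0%N|move=> _ [k _ <-]].
apply: dual_normr_le => // x.
have [k kP] := dense_seq_cvg vd.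
have c1 : `|f t (v (k x n))| @[n --> \oo] --> `|f t x|.
  by apply: cvg_norm; apply: (cvg_comp _ _ (kP x)); exact: dual_continuous.
have c2 : sup (range (h^~ t)) * `|v (k x n)| @[n --> \oo] --> sup (range (h^~ t)) * `|x|.
  by apply: cvgMr; apply: cvg_norm; exact: kP.
apply: (ler_cvg_to c1 c2); apply: nearW => n.
have [->|v0] := eqVneq (v (k x n)) 0; first by rewrite linear0 !normr0 mulr0.
rewrite -ler_pdivrMr ?normr_gt0// mulrC.
by apply: ub_le_sup => //; exists (k x n).
Qed.

Lemma dual_strongly_measurable (V : normedModType R) (v : nat -> V)
    (w : nat -> dual_space V) (f : T -> dual_space V) :
  dense_seq v -> dense_seq w ->
  (forall x, measurable_fun setT (fun t => f t x)) -> strongly f.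
Proof.
move=> vd wd mf; apply: (dense_dist_strongly_measurable (x := w)) => [t e|k].
  exact: wd.
apply: (dual_norm_measurable (f := fun t => f t - w k) vd) => j.
by apply: measurable_funB => //; exact: mf.
Qed.

Lemma bidual_norm (V : normedModType R) (x : V) : `|bidual_eval x| = `|x|.
Proof.
apply/eqP; rewrite eq_le; apply/andP; split.
  by apply: dual_normr_le => // g; rewrite mulrC; exact: (ler_dual g x).
have [g gx g1] := norming_functional x.
rewrite -[leLHS]normr_id -gx (le_trans (ler_dual (bidual_eval x) g))//.
by rewrite -[leRHS]mulr1 ler_wpM2l.
Qed.

(** The theorem of Pettis.  The norm is computed in the bidual, as a countable
    supremum over the dense sequence of V^*. *)
Lemma weakly_strongly_measurable (V : normedModType R) (v : nat -> V)
    (w : nat -> dual_space V) (f : T -> V) :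
  dense_seq v -> dense_seq w ->
  (forall g : dual_space V, measurable_fun setT (fun t => g (f t))) -> strongly f.
Proof.
move=> vd wd mf; apply: (dense_dist_strongly_measurable (x := v)) => [t e|k].
  exact: vd.
rewrite (_ : (fun t => _) = (fun t => `|bidual_eval (f t - v k)|)).
  apply: (dual_norm_measurable (f := fun t => bidual_eval (f t - v k)) wd) => j /=.
  under eq_fun do rewrite linearB.
  by apply: measurable_funB => //; exact: mf.
by apply/funext => t; rewrite bidual_norm.
Qed.

Lemma dual_pairing_measurable (V : normedModType R) (g : T -> dual_space V)
    (f : T -> V) : strongly g -> strongly f ->
  measurable_fun setT (fun t => g t (f t)).
Proof.
move=> sg sf; apply: strongly_measurable_measurable_fun.
apply: (strongly_measurable_op (op := fun (f : dual_space V) x => f x) _ sg sf).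
move=> f_ x_ h x cf cx.
have -> : h x = 0 + h x by rewrite add0r.
rewrite (_ : (fun n => _) = (fun n => (f_ n - h) (x_ n) + h (x_ n))); last first.
  by apply/funext => n /=; rewrite subrK.
apply: cvgD; last exact: (cvg_comp _ _ cx (@dual_continuous _ _ h x)).
apply/norm_cvg0P.
apply: (@squeeze_cvgr _ _ _ _ (cst 0) (fun n => `|f_ n - h| * `|x_ n|)).
- by apply: nearW => n; rewrite normr_ge0; exact: (ler_dual (f_ n - h)).
- exact: cvg_cst.
- rewrite -(mul0r `|x|); apply: cvgM; last exact: cvg_norm.
  rewrite -(@normr0 _ (dual_space V)) -(subrr h).
  by apply: cvg_norm; apply: cvgB => //; exact: cvg_cst.
Qed.

Definition vanishing (D : nat -> set T) :=
  [/\ forall n, measurable (D n), nonincreasing_seq D & \bigcap_n D n = set0].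

(** An induction principle that replaces the approximation by simple
    functions: P is only asked to be stable under prescribing a constant value
    on a measurable set.  The constants come from a countable set that is dense
    in the range of f, and D K is the set where the first K of them are all at
    distance at least e from f. *)
Lemma approx_principle (V : normedModType R) (f : T -> V) (P : (T -> V) -> Prop) :
  strongly f -> P (cst 0) ->
  (forall A c q, measurable A -> P q -> P (fun t => if t \in A then c else q t)) ->
  forall e, 0 < e -> exists D q, [/\ vanishing D, forall K, P (q K),
    forall K t, ~ D K t -> `|f t - q K t| <= e & forall K t, D K t -> q K t = 0].
Proof.
move=> sf P0 Pif e e0; have [x xd] := strongly_measurable_range sf.
pose A k := [set t | `|f t - x k| < e].
have mA k : measurable (A k).
  by apply: measurable_lt_set; exact: strongly_measurable_dist.
pose D K := \bigcap_(k in `I_K) ~` A k.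
pose q := fix q K t := if K is K'.+1 then (if t \in A K' then x K' else q K' t) else 0.
have mD K : measurable (D K).
  by apply: bigcap_measurableType => k _; exact: measurableC.
exists D, q; split.
- split => //.
    by move=> i j ij; apply/subsetPset => t Dt k /= ki; apply: Dt => /=; exact: leq_trans ki ij.
  apply/seteqP; split=> // t Dt; have [k kP] := xd t e e0.
  by apply: (Dt k.+1 I k) => /=.
- by elim=> [//|K ih]; exact: Pif.
- elim=> [t h|K ih t h].
    by exfalso; apply: h => k.
  rewrite /=; case: ifPn => [/set_mem/ltW//|tA]; apply: ih => Dt; apply: h.
  move=> k /=; rewrite ltnS leq_eqVlt => /orP[/eqP ->|]; last exact: Dt.
  by move=> At; move/negP: tA; apply; exact: mem_set.
- elim=> [//|K ih t Dt] /=; rewrite memNset; last exact: (Dt K (ltnSn K)).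
  by apply: ih => k /= kK; apply: Dt => /=; exact: ltnW.
Qed.

End strong_measurability_tools.

(** * Weak limits of Bochner integrable functions *)

Section weak_limits.
Context d (T : measurableType d) (R : realType).
Variable mu : {finite_measure set T -> \bar R}.
Local Notation strongly := (strongly_measurable (@measurable d T)).
Local Notation summable := (@summable _ T R mu).

Definition bochner_integrable (V : normedModType R) (f : T -> V) :=
  strongly f /\ summable (fun t => `|f t|).
Local Notation bint := bochner_integrable.

Lemma vanishing_small (D : nat -> set T) (f : T -> R) e : vanishing D ->
  summable f -> (forall t, 0 <= f t) -> 0 < e ->
  exists K, forall n, (K <= n)%N -> \int[mu]_(t in D n) f t <= e.
Proof.
move=> [mD nD D0] sf f0 e0; have [r r0 rP] := int_small sf f0 e0.
have [K KP] := vanishing_measure mu mD nD D0 r0.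
by exists K => n Kn; apply: rP => //; exact: KP.
Qed.

Lemma pairing_summable (V : normedModType R) (g : T -> dual_space V) (f : T -> V) :
  strongly g -> strongly f -> summable (fun t => `|g t| * `|f t|) ->
  summable (fun t => g t (f t)).
Proof.
move=> sg sf sgf; apply: summable_le sgf _; first exact: dual_pairing_measurable.
by move=> t; exact: ler_dual.
Qed.

Lemma summable_bounded_mul (h f : T -> R) C : measurable_fun setT h ->
  summable f -> (forall t, 0 <= f t) -> (forall t, 0 <= h t <= C) ->
  summable (fun t => h t * f t).
Proof.
move=> mh sf f0 hC; apply: (summable_le (g := fun t => C * f t)).
- by apply: measurable_funM => //; exact: summable_measurable sf.
- exact: summableZ.
- move=> t; have /andP[h0 hc] := hC t.
  by rewrite ger0_norm ?mulr_ge0// ler_wpM2r.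
Qed.

Lemma pairing_bounded (V : normedModType R) (g : T -> dual_space V) (f : T -> V) C :
  strongly g -> (forall t, `|g t| <= C) -> bint f ->
  summable (fun t => `|g t| * `|f t|).
Proof.
move=> sg gC [sf nf]; apply: (summable_bounded_mul (C := C)) => //.
  exact: strongly_measurable_norm.
by move=> t; rewrite normr_ge0 gC.
Qed.

Lemma functional_summable (V : normedModType R) (phi : dual_space V) (f : T -> V) :
  bint f -> summable (fun t => phi (f t)).
Proof.
move=> If; apply: (pairing_summable (g := fun=> phi)).
- exact: strongly_measurable_cst.
- exact: If.1.
- by apply: (pairing_bounded (C := `|phi|)) => //; exact: strongly_measurable_cst.
Qed.

Section pairing.
Variables (V : normedModType R) (U : set_system nat).
Context {UF : ProperFilter U}.
Variables (z_ : nat -> T -> V) (z : T -> V) (M : R).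
Hypotheses (Iz_ : forall n, bint (z_ n)) (Iz : bint z).
Hypothesis z_M : forall n, \int[mu]_t `|z_ n t| <= M.
Hypothesis zM : \int[mu]_t `|z t| <= M.
Hypothesis weak : forall (phi : dual_space V) A, measurable A ->
  (\int[mu]_(t in A) phi (z_ n t)) @[n --> U] --> \int[mu]_(t in A) phi (z t).

(** By [approx_principle], g is e-close off D K to a function q for which the
    convergence follows from that for constant functionals.  The error off D K
    is at most e times the bound M of the L_1 norms, and the error on D K is
    small uniformly in n by the last hypothesis. *)
Lemma weak_limit_pairing (g : T -> dual_space V) :
  strongly g ->
  (forall n, summable (fun t => `|g t| * `|z_ n t|)) ->
  summable (fun t => `|g t| * `|z t|) ->
  (forall D e, vanishing D -> 0 < e -> exists K,
    (forall n, \int[mu]_(t in D K) (`|g t| * `|z_ n t|) <= e) /\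
    \int[mu]_(t in D K) (`|g t| * `|z t|) <= e) ->
  (\int[mu]_t g t (z_ n t)) @[n --> U] --> \int[mu]_t g t (z t).
Proof.
move=> sg gz_ gz unif.
pose P (q : T -> dual_space V) := [/\ strongly q, exists C, forall t, `|q t| <= C &
  forall A, measurable A ->
    (\int[mu]_(t in A) q t (z_ n t)) @[n --> U] --> \int[mu]_(t in A) q t (z t)].
have P0 : P (cst 0).
  split; first exact: strongly_measurable_cst.
    by exists 0 => t; rewrite normr0.
  by move=> A mA; exact: weak.
have Pif A c q : measurable A -> P q -> P (fun t => if t \in A then c else q t).
  move=> mA [sq [C qC] qw].
  have sq' : strongly (fun t => if t \in A then c else q t).
    apply: (strongly_measurable_if (f := fun=> c)) => //.
    exact: strongly_measurable_cst.
  have qC' t : `|if t \in A then c else q t| <= `|c| + C.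
    have C0 : 0 <= C by rewrite (le_trans _ (qC t)).
    by case: ifP => _; [rewrite lerDl|rewrite (le_trans (qC t))// lerDr].
  split => //; first by exists (`|c| + C).
  move=> B mB.
  have E y : bint y ->
      \int[mu]_(t in B) (if t \in A then c else q t) (y t) =
      \int[mu]_(t in B `&` A) c (y t) + \int[mu]_(t in B `&` ~` A) q t (y t).
    move=> Iy; rewrite (int_split mB mA); last first.
      by apply: (pairing_summable (g := fun t => if t \in A then c else q t)) => //;
        [exact: Iy.1|exact: (pairing_bounded sq' qC')].
    congr (_ + _); apply: eq_Rintegral => t; rewrite inE => -[_ At].
      by rewrite mem_set.
    by rewrite memNset.
  rewrite (E z Iz); under eq_cvg do rewrite E//.
  apply: cvgD; [apply: weak|apply: qw]; apply: measurableI => //.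
  exact: measurableC.
apply/cvgrPdist_le => e e0.
have M0 : 0 <= M by rewrite (le_trans _ zM)// int_ge0.
have M1 : 0 < 8 * (M + 1) by lra.
have e1 : 0 < e / (8 * (M + 1)) by rewrite divr_gt0.
have [D [q [vD Pq qD q0]]] := approx_principle sg P0 Pif e1.
have e8 : 0 < e / 8 by lra.
have [K [K1 K2]] := unif D _ vD e8.
have [sq [C qC] qw] := Pq K.
have mD : measurable (D K) by have [] := vD.
have approx y : bint y -> \int[mu]_t `|y t| <= M ->
    summable (fun t => `|g t| * `|y t|) ->
    \int[mu]_(t in D K) (`|g t| * `|y t|) <= e / 8 ->
    `|\int[mu]_t g t (y t) - \int[mu]_t q K t (y t)| <= e / 4.
  move=> Iy yM gy yD.
  have sgq : strongly (fun t => g t - q K t) by exact: strongly_measurableB.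
  have sy := Iy.1.
  have sH : summable (fun t => `|g t - q K t| * `|y t|).
    apply: (summable_le (g := fun t => `|g t| * `|y t| + C * `|y t|)).
    - by apply: measurable_funM; exact: strongly_measurable_norm.
    - by apply: summableD => //; apply: summableZ; exact: Iy.2.
    - move=> t; rewrite ger0_norm ?mulr_ge0// -mulrDl ler_wpM2r//.
      by rewrite (le_trans (ler_normB _ _))// lerD2l.
  rewrite -intB//; last 2 first.
  - exact: pairing_summable.
  - apply: pairing_summable => //; exact: (pairing_bounded sq qC).
  apply: le_trans.
    apply: (int_norm_le (g := fun t => `|g t - q K t| * `|y t|)) => //.
      apply: summableB; first exact: pairing_summable.
      by apply: pairing_summable => //; exact: (pairing_bounded sq qC).
    by move=> t _; exact: (ler_dual (g t - q K t)).
  rewrite (int_split measurableT mD)// !setTI.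
  have h1 : \int[mu]_(t in D K) (`|g t - q K t| * `|y t|) <= e / 8.
    apply: le_trans yD; apply: int_le => // t Dt.
    by rewrite q0// subr0.
  have h2 : \int[mu]_(t in ~` D K) (`|g t - q K t| * `|y t|) <= e / 8.
    apply: (@le_trans _ _ (\int[mu]_(t in ~` D K) (e / (8 * (M + 1)) * `|y t|))).
      apply: int_le => //; first exact: measurableC.
        by apply: summableZ; exact: Iy.2.
      by move=> t Dt; rewrite ler_wpM2r// qD.
    rewrite intZ//; [|exact: measurableC|exact: Iy.2].
    rewrite (@le_trans _ _ (e / (8 * (M + 1)) * M))//.
      rewrite ler_wpM2l//; first exact: ltW.
      apply: le_trans yM; apply: int_subset => //; first exact: measurableC.
      exact: Iy.2.
    rewrite mulrAC ler_pdivrMr//; have := mulr_ge0 (ltW e0) M0 => ?.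
    have -> : e / 8 * (8 * (M + 1)) = e * M + e by field.
    by rewrite lerDl ltW.
  by lra.
have := qw setT measurableT; move=> /cvgrPdist_le/(_ (e / 2)).
have e2 : 0 < e / 2 by lra.
move=> /(_ e2); apply: filterS => n /= hn.
have a1 := approx z Iz zM gz K2.
have a2 := approx (z_ n) (Iz_ n) (z_M n) (gz_ n) (K1 n).
move: a1 a2 hn; rewrite !ler_norml => /andP[? ?] /andP[? ?] /andP[? ?].
by apply/andP; split; lra.
Qed.

End pairing.

(** The ultralimits of the integrals of phi (z_ n) define a measure with
    values in V^**.  Its density at t is a bounded functional on V^*, which by
    reflexivity is the evaluation at a point z t. *)
Lemma weak_limit_exists (V : normedModType R) (v : nat -> V) (U : set_system nat)
    (UU : UltraFilter U) (z_ : nat -> T -> V) (M : R) (rho : T -> R) :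
  reflexive_space V -> dense_seq v ->
  (forall n, bint (z_ n)) -> (forall n, \int[mu]_t `|z_ n t| <= M) ->
  summable rho -> (forall t, 0 <= rho t) ->
  (forall (phi : dual_space V) A (l : R), measurable A ->
     (\int[mu]_(t in A) phi (z_ n t)) @[n --> U] --> l ->
     `|l| <= `|phi| * \int[mu]_(t in A) rho t) ->
  exists z : T -> V, [/\ strongly z, forall t, `|z t| <= rho t &
    forall (phi : dual_space V) A, measurable A ->
      (\int[mu]_(t in A) phi (z_ n t)) @[n --> U] --> \int[mu]_(t in A) phi (z t)].
Proof.
move=> Vr vd Iz_ z_M srho rho0 zrho.
have UF : ProperFilter U := @ultra_proper _ _ UU.
have [w wd] := reflexive_dual_separable Vr vd.
have mex (p : dual_space V * set T) : exists l : R, measurable p.2 ->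
    (\int[mu]_(t in p.2) p.1 (z_ n t)) @[n --> U] --> l.
  case: p => phi A /=; have [mA|] := pselect (measurable A); last by exists 0.
  have [|l lP] := bounded_ultra_cvg UU (u := fun n => \int[mu]_(t in A) phi (z_ n t))
      (M := `|phi| * M); last by exists l.
  move=> n; have Izn := Iz_ n.
  apply: (@le_trans _ _ (\int[mu]_(t in A) (`|phi| * `|z_ n t|))).
    apply: int_norm_le => //; first exact: functional_summable.
      by apply: summableZ; exact: Izn.2.
    by move=> t _; exact: ler_dual.
  rewrite intZ//; last exact: Izn.2.
  rewrite ler_wpM2l// (le_trans _ (z_M n))//; apply: int_subset => //.
  exact: Izn.2.
have [m0 m0P] := choice mex; pose m phi A := m0 (phi, A).
have mP (phi : dual_space V) (A : set T) : measurable A ->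
    (\int[mu]_(t in A) phi (z_ n t)) @[n --> U] --> m phi A.
  exact: (m0P (phi, A)).
have [|||G [mG Grho GE]] := @vector_density _ T R mu _ w wd m rho srho rho0.
- move=> phi A B mA mB AB.
  apply: (@real_cvg_unique _ U _ (fun n => \int[mu]_(t in A `|` B) phi (z_ n t))).
    by apply: mP; exact: measurableU.
  have E n : \int[mu]_(t in A `|` B) phi (z_ n t) =
      \int[mu]_(t in A) phi (z_ n t) + \int[mu]_(t in B) phi (z_ n t).
    by rewrite int_setU//; exact: functional_summable.
  under eq_cvg do rewrite E.
  by apply: cvgD; exact: mP.
- move=> a phi psi A mA.
  apply: (@real_cvg_unique _ U _ (fun n => \int[mu]_(t in A) (a *: phi + psi) (z_ n t))).
    exact: mP.
  rewrite (_ : (fun n => _) = fun n => a * (\int[mu]_(t in A) phi (z_ n t)) +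
      \int[mu]_(t in A) psi (z_ n t)).
    by apply: cvgD; [apply: cvgMr|]; exact: mP.
  apply/funext => n; rewrite -intZ//; last exact: functional_summable.
  rewrite -intD//; first by apply: summableZ; exact: functional_summable.
  exact: functional_summable.
- by move=> phi A mA; apply: zrho => //; exact: mP.
have [z zG] : exists z : T -> V, forall t phi, G t phi = phi (z t).
  by have [z zP] := choice (fun t => Vr (G t)); exists z => t; exact: zP.
exists z; split.
- apply: (weakly_strongly_measurable vd wd) => phi.
  by under eq_fun do rewrite -zG; exact: mG.
- move=> t; rewrite -bidual_norm (_ : bidual_eval (z t) = G t)//.
  by apply/val_inj/funext => phi /=; rewrite zG.
- move=> phi A mA; rewrite (_ : \int[mu]_(t in A) phi (z t) = m phi A); last first.
    by rewrite GE//; apply: eq_Rintegral => t _; rewrite zG.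
  exact: mP.
Qed.

(** The dual of L_1(V).  The density is that of the V^*-valued measure
    A |-> (x |-> L (1_A x)); the formula is then true for countably valued
    functions and extends by continuity. *)
Lemma functional_density (V : normedModType R) (v : nat -> V)
    (w : nat -> dual_space V) (L : (T -> V) -> R) (C : R) :
  dense_seq v -> dense_seq w ->
  (forall a f1 f2, bint f1 -> bint f2 ->
     L (fun t => a *: f1 t + f2 t) = a * L f1 + L f2) ->
  0 <= C -> (forall f, bint f -> `|L f| <= C * \int[mu]_t `|f t|) ->
  exists g : T -> dual_space V, [/\ strongly g, forall t, `|g t| <= C &
    forall f, bint f -> L f = \int[mu]_t g t (f t)].
Proof.
move=> vd wd Llin C0 LC.
have bintE (f : T -> V) A : measurable A -> bint f ->
    bint (fun t => if t \in A then f t else 0).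
  move=> mA [sf nf]; split; first exact: strongly_measurable_restrict.
  apply: summable_le nf _ => [|t].
    exact/strongly_measurable_norm/strongly_measurable_restrict.
  by rewrite normr_id; case: ifP => // _; rewrite normr0.
have bint_cst x : bint (fun _ : T => x : V).
  split; first exact: strongly_measurable_cst.
  exact: (summable_cst mu `|x|).
have bintD a (f1 f2 : T -> V) : bint f1 -> bint f2 ->
    bint (fun t => a *: f1 t + f2 t).
  move=> [s1 n1] [s2 n2].
  have s12 : strongly (fun t => a *: f1 t + f2 t).
    apply: (strongly_measurable_op (op := fun x y : V => a *: x + y) _ s1 s2).
    by move=> *; apply: cvgD => //; exact: cvgZr.
  split => //; apply: (summable_le (g := fun t => `|a| * `|f1 t| + `|f2 t|)).
  - exact: strongly_measurable_norm.
  - by apply: summableD => //; exact: summableZ.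
  - by move=> t; rewrite normr_id (le_trans (ler_normD _ _))// normrZ.
pose m x (A : set T) := L (fun t => if t \in A then x else 0).
have [|||||G [mG GC GE]] := @vector_density _ T R mu _ v vd m (cst C).
- exact: summable_cst.
- by [].
- move=> x A B mA mB AB; rewrite /m.
  rewrite (_ : (fun t => _) = (fun t => 1 *: (if t \in A then x else 0) +
      (if t \in B then x else 0))).
    rewrite Llin ?mul1r//; [exact: (bintE (fun=> x))|exact: (bintE (fun=> x))].
  apply/funext => t; rewrite in_setU scale1r.
  have [tA|tA] := boolP (t \in A); have [tB|tB] := boolP (t \in B);
    rewrite /= ?addr0 ?add0r//.
  have : (A `&` B) t by split; exact: set_mem.
  by rewrite AB.
- move=> a x y A mA; rewrite /m -Llin; last 2 first.
  - exact: (bintE (fun=> x)).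
  - exact: (bintE (fun=> y)).
  congr L; apply/funext => t; case: ifP => _ //.
  by rewrite scaler0 addr0.
- move=> x A mA; rewrite (le_trans (LC _ (bintE _ _ mA (bint_cst x))))//.
  rewrite (int_split measurableT mA); last exact: (bintE _ _ mA (bint_cst x)).2.
  rewrite !setTI (@eq_Rintegral _ _ _ _ A (cst `|x|)); last first.
    by move=> t tA /=; rewrite tA.
  rewrite (@eq_Rintegral _ _ _ _ (~` A) (cst 0)); last first.
    by move=> t; rewrite in_setC => /negbTE tA /=; rewrite tA normr0.
  rewrite /cst !int_cst//; last exact: measurableC.
  by rewrite mul0r addr0 mulrCA.
have sG := dual_strongly_measurable vd wd mG.
exists G; split => // f If; have [sf nf] := If.
pose P (q : T -> V) := [/\ strongly q, exists C, forall t, `|q t| <= C &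
  forall A, measurable A ->
    L (fun t => if t \in A then q t else 0) = \int[mu]_(t in A) G t (q t)].
have bbint (q : T -> V) c : strongly q -> (forall t, `|q t| <= c) -> bint q.
  move=> sq qc; split => //; apply: summable_le (summable_cst mu c) _.
    exact: strongly_measurable_norm.
  by move=> t; rewrite normr_id.
have sumG (q : T -> V) : bint q -> summable (fun t => G t (q t)).
  move=> Iq; apply: pairing_summable => //; first exact: Iq.1.
  exact: (pairing_bounded sG GC).
have P0 : P (cst 0).
  split; first exact: strongly_measurable_cst.
    by exists 0 => t; rewrite normr0.
  by move=> A mA; exact: GE.
have Pif A c q : measurable A -> P q -> P (fun t => if t \in A then c else q t).
  move=> mA [sq [D qD] qE].
  have sq' : strongly (fun t => if t \in A then c else q t).
    apply: (strongly_measurable_if (f := fun=> c)) => //.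
    exact: strongly_measurable_cst.
  have qD' t : `|if t \in A then c else q t| <= `|c| + D.
    have D0 : 0 <= D by rewrite (le_trans _ (qD t)).
    by case: ifP => _; [rewrite lerDl|rewrite (le_trans (qD t))// lerDr].
  split => //; first by exists (`|c| + D).
  move=> B mB.
  have mBA : measurable (B `&` A) by exact: measurableI.
  have mBcA : measurable (B `&` ~` A) by apply: measurableI => //; exact: measurableC.
  rewrite (int_split mB mA); last exact: (sumG _ (bbint _ _ sq' qD')).
  rewrite (@eq_Rintegral _ _ _ _ (B `&` A) (fun t => G t c)); last first.
    by move=> t; rewrite in_setI => /andP[_ tA]; rewrite tA.
  rewrite (@eq_Rintegral _ _ _ _ (B `&` ~` A) (fun t => G t (q t))); last first.
    by move=> t; rewrite in_setI in_setC => /andP[_ /negbTE tA]; rewrite tA.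
  rewrite -GE// -qE// /m -[X in _ = X + _]mul1r -Llin; last 2 first.
  - exact: (bintE (fun=> c)).
  - by apply: bintE => //; exact: bbint sq qD.
  congr L; apply/funext => t; rewrite !in_setI in_setC scale1r.
  by case: (t \in B); case: (t \in A); rewrite /= ?addr0 ?add0r.
apply/eqP; rewrite -subr_eq0 -normr_le0; apply/ler_addgt0Pl => e e0; rewrite addr0.
pose mT := fine (mu setT).
have mT0 : 0 <= mT by exact: fine_ge0.
have K0 : 0 < 4 * (C + 1) * (mT + 1) by rewrite !mulr_gt0//; lra.
have [D [q [vD Pq qD q0]]] := approx_principle sf P0 Pif (divr_gt0 e0 K0).
have C4 : 0 < 4 * (C + 1) by lra.
have [K KP] := vanishing_small vD nf (fun=> normr_ge0 _) (divr_gt0 e0 C4).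
have [sq [c qc] qE] := Pq K.
have Iq : bint (q K) by exact: bbint sq qc.
have mD : measurable (D K) by have [] := vD.
pose h t := (-1) *: q K t + f t.
have Ih : bint h by exact: bintD.
have Lq : L (q K) = \int[mu]_t G t (q K t).
  by rewrite -qE//; congr L; apply/funext => t; rewrite mem_set.
have hE : L f - \int[mu]_t G t (f t) = L h - \int[mu]_t G t (h t).
  rewrite /h Llin// Lq mulN1r.
  have -> : \int[mu]_t G t (-1 *: q K t + f t) =
      \int[mu]_t G t (f t) - \int[mu]_t G t (q K t).
    rewrite -intB//; [|exact: sumG|exact: sumG].
    by apply: eq_Rintegral => t _; rewrite scaleN1r linearD linearN addrC.
  by ring.
have hs : \int[mu]_t `|h t| <= e / (2 * (C + 1)).
  rewrite (int_split measurableT mD) ?setTI; last exact: Ih.2.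
  have h1 : \int[mu]_(t in D K) `|h t| <= e / (4 * (C + 1)).
    apply: le_trans (KP K (leqnn K)); apply: int_le => //; first exact: Ih.2.
    by move=> t Dt; rewrite /h q0// scaler0 add0r.
  have h2 : \int[mu]_(t in ~` D K) `|h t| <= e / (4 * (C + 1)).
    apply: (@le_trans _ _ (\int[mu]_(t in ~` D K) (e / (4 * (C + 1) * (mT + 1))))).
      apply: int_le; [exact: measurableC|exact: Ih.2|exact: summable_cst|].
      by move=> t Dt; rewrite /h scaleN1r addrC qD.
    rewrite int_cst; last exact: measurableC.
    apply: (@le_trans _ _ (e / (4 * (C + 1) * (mT + 1)) * mT)).
      have mcD : measurable (~` D K) by exact: measurableC.
      apply: ler_wpM2l; first by rewrite ltW// divr_gt0.
      rewrite /mT fine_le ?fin_num_measure//.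
      by apply: le_measure => //; rewrite inE.
    rewrite mulrAC ler_pdivrMr//.
    have -> : e / (4 * (C + 1)) * (4 * (C + 1) * (mT + 1)) = e * mT + e.
      by field; rewrite gt_eqF//; lra.
    by rewrite lerDl ltW.
  have -> : e / (2 * (C + 1)) = e / (4 * (C + 1)) + e / (4 * (C + 1)).
    by field; rewrite gt_eqF//; lra.
  exact: lerD.
have b1 := LC h Ih.
have b2 : `|\int[mu]_t G t (h t)| <= C * \int[mu]_t `|h t|.
  rewrite -intZ//; last exact: Ih.2.
  apply: int_norm_le => //; first exact: sumG.
    by apply: summableZ; exact: Ih.2.
  by move=> t _; rewrite (le_trans (ler_dual _ _))// ler_wpM2r.
rewrite hE (le_trans (ler_normB _ _))// (le_trans (lerD b1 b2))//.
rewrite -mulrDr (@le_trans _ _ ((C + 1) * (e / (2 * (C + 1)) + e / (2 * (C + 1)))))//.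
  apply: ler_pM => //; first by rewrite addr_ge0// int_ge0.
    by rewrite lerDl.
  exact: lerD.
rewrite le_eqVlt; apply/orP; left; apply/eqP; field; rewrite gt_eqF//; lra.
Qed.

Definition uniformly_integrable (V : normedModType R) (z_ : nat -> T -> V) :=
  forall e, 0 < e -> exists2 r, 0 < r & forall n A, measurable A ->
    (mu A < r%:E)%E -> \int[mu]_(t in A) `|z_ n t| <= e.

(** The function rho, which dominates the weak limit of the z_ n, is the
    density of the ultralimit of the measures with densities |z_ n|. *)
Lemma uniformly_integrable_density (V : normedModType R) (z_ : nat -> T -> V)
    (U : set_system nat) (UU : UltraFilter U) (M : R) :
  (forall n, bint (z_ n)) -> (forall n, \int[mu]_t `|z_ n t| <= M) ->
  uniformly_integrable z_ ->
  exists rho, [/\ summable rho, forall t, 0 <= rho t &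
    forall A (l : R), measurable A ->
      (\int[mu]_(t in A) `|z_ n t|) @[n --> U] --> l ->
      l <= \int[mu]_(t in A) rho t].
Proof.
move=> Iz_ z_M ui.
have UF : ProperFilter U := @ultra_proper _ _ UU.
have lex (A : set T) : exists l : R, measurable A ->
    (\int[mu]_(t in A) `|z_ n t|) @[n --> U] --> l.
  have [mA|] := pselect (measurable A); last by exists 0.
  have [|l lP] := bounded_ultra_cvg UU (u := fun n => \int[mu]_(t in A) `|z_ n t|)
      (M := M); last by exists l.
  move=> n; rewrite ger0_norm ?int_ge0// (le_trans _ (z_M n))//.
  by apply: int_subset => //; exact: (Iz_ n).2.
have [m mP] := choice lex.
have [||h sh hE] := @density_of_additive _ T R mu m.
- move=> A B mA mB AB.
  apply: (@real_cvg_unique _ U _ (fun n => \int[mu]_(t in A `|` B) `|z_ n t|)).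
    by apply: mP; exact: measurableU.
  have E n : \int[mu]_(t in A `|` B) `|z_ n t| =
      \int[mu]_(t in A) `|z_ n t| + \int[mu]_(t in B) `|z_ n t|.
    by rewrite int_setU//; exact: (Iz_ _).2.
  under eq_cvg do rewrite E.
  by apply: cvgD; exact: mP.
- move=> e e0; have [r r0 rP] := ui e e0; exists r => // A mA Ar.
  have c1 : `|\int[mu]_(t in A) `|z_ n t| | @[n --> U] --> `|m A|.
    by apply: cvg_norm; exact: mP.
  apply: (ler_cvg_to c1 (cvg_cst e)); apply: nearW => n.
  by rewrite ger0_norm ?int_ge0// rP.
exists (fun t => `|h t|); split => //; first exact: summable_norm.
move=> A l mA lP; rewrite (real_cvg_unique lP (mP A mA)) hE//.
by apply: int_le => //; [exact: summable_norm|move=> t _; exact: ler_norm].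
Qed.

(** The functionals L act on functions rather than on classes because they
    are restrictions of functionals on a larger space, with values in a space
    containing V and a larger sigma-algebra. *)
Lemma weak_cluster_point (V : normedModType R) (v : nat -> V) (z_ : nat -> T -> V)
    (U : set_system nat) (UU : UltraFilter U) (M : R) :
  reflexive_space V -> dense_seq v ->
  (forall n, bint (z_ n)) -> (forall n, \int[mu]_t `|z_ n t| <= M) ->
  uniformly_integrable z_ ->
  exists2 z : T -> V, bint z & forall (L : (T -> V) -> R) (C : R),
    (forall a f1 f2, bint f1 -> bint f2 ->
     L (fun t => a *: f1 t + f2 t) = a * L f1 + L f2) ->
    0 <= C -> (forall f, bint f -> `|L f| <= C * \int[mu]_t `|f t|) ->
    (L (z_ n)) @[n --> U] --> L z.
Proof.
move=> Vr vd Iz_ z_M ui.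
have UF : ProperFilter U := @ultra_proper _ _ UU.
have [w wd] := reflexive_dual_separable Vr vd.
have [rho [srho rho0 rhoP]] := uniformly_integrable_density UU Iz_ z_M ui.
have [|z [sz zrho zw]] := weak_limit_exists UU Vr vd Iz_ z_M srho rho0.
  move=> phi A l mA lP.
  have [|k kP] := bounded_ultra_cvg UU (u := fun n => \int[mu]_(t in A) `|z_ n t|)
      (M := M).
    move=> n; rewrite ger0_norm ?int_ge0// (le_trans _ (z_M n))//.
    by apply: int_subset => //; exact: (Iz_ n).2.
  rewrite (@le_trans _ _ (`|phi| * k))//; last by rewrite ler_wpM2l// rhoP.
  have c1 : `|\int[mu]_(t in A) phi (z_ n t)| @[n --> U] --> `|l| by exact: cvg_norm.
  have c2 : (`|phi| * \int[mu]_(t in A) `|z_ n t|) @[n --> U] --> `|phi| * k.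
    exact: cvgMr.
  apply: (ler_cvg_to c1 c2); apply: nearW => n; have Izn := Iz_ n.
  rewrite -intZ//; last exact: Izn.2.
  apply: int_norm_le => //; first exact: functional_summable.
    by apply: summableZ; exact: Izn.2.
  by move=> t _; exact: ler_dual.
have Iz : bint z.
  split => //; apply: summable_le srho _ => [|t]; last by rewrite normr_id.
  exact: strongly_measurable_norm.
exists z => // L C Llin C0 LC.
have [g [sg gC gE]] := functional_density vd wd Llin C0 LC.
rewrite gE//; under eq_cvg do rewrite gE//.
apply: (@weak_limit_pairing _ U _ z_ z (Num.max M (\int[mu]_t `|z t|))) => //.
- by move=> n; rewrite le_max z_M.
- by rewrite le_max lexx orbT.
- by move=> n; exact: (pairing_bounded sg gC).
- exact: (pairing_bounded sg gC).
move=> D e vD e0; have C1 : 0 < C + 1 by lra.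
have [r r0 rP] := ui _ (divr_gt0 e0 C1).
have [mD nD D0] := vD.
have [K1 K1P] := vanishing_measure mu mD nD D0 r0.
have [K2 K2P] := vanishing_small vD Iz.2 (fun=> normr_ge0 _) (divr_gt0 e0 C1).
have key K (y : T -> V) : bint y -> \int[mu]_(t in D K) `|y t| <= e / (C + 1) ->
    \int[mu]_(t in D K) (`|g t| * `|y t|) <= e.
  move=> Iy yK; apply: (@le_trans _ _ (\int[mu]_(t in D K) ((C + 1) * `|y t|))).
    apply: int_le => //; first exact: (pairing_bounded sg gC).
      by apply: summableZ; exact: Iy.2.
    by move=> t _; rewrite ler_wpM2r// (le_trans (gC t))// lerDl.
  rewrite intZ//; last exact: Iy.2.
  by rewrite mulrC -ler_pdivlMr.
exists (maxn K1 K2); split=> [n|]; apply: key => //.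
  by apply: rP => //; apply: K1P; exact: leq_maxl.
by apply: K2P; exact: leq_maxr.
Qed.

End weak_limits.

(** * Weak topologies and classes in L_1 *)

Section weak_convergence.
Variables (R : realType) (V : normedModType R) (U : set_system nat).
Context {UF : ProperFilter U}.

Lemma weak_space_cvg (u : nat -> V) (l : V) :
  (u n @[n --> U] --> (l : weak_space V)) <->
  forall phi : dual_space V, phi (u n) @[n --> U] --> phi l.
Proof.
pose f := (fun v : V => (fun phi : dual_space V => phi v) : {ptws dual_space V -> R}).
split=> [ul phi|h A].
  have c : f (u n) @[n --> U] --> (f l : {ptws dual_space V -> R}).
    by apply: (cvg_comp _ _ ul); exact: initial_continuous.
  have /(@pointwise_cvgP _ _ _ _ _)/(_ phi) := c.
  exact.
rewrite nbhsE => -[B [[C oC <-] Cl] CA].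
have c : f (u n) @[n --> U] --> (f l : {ptws dual_space V -> R}).
  by apply/pointwise_cvgP => phi; exact: h.
have : nbhs (f l : {ptws dual_space V -> R}) C by apply: open_nbhs_nbhs.
move=> /c UC; rewrite /nbhs/=; apply: (@filterS _ U _ (fun n => C (f (u n)))) UC => n.
exact: CA.
Qed.

Lemma weakstar_space_cvg (u : nat -> dual_space V) (l : dual_space V) :
  (forall x : V, u n x @[n --> U] --> l x) ->
  u n @[n --> U] --> (l : weakstar_space V).
Proof.
pose f := (fun phi : dual_space V => (phi : V -> R) : {ptws V -> R}).
move=> h A; rewrite nbhsE => -[B [[C oC <-] Cl] CA].
have c : f (u n) @[n --> U] --> (f l : {ptws V -> R}).
  by apply/pointwise_cvgP => x; exact: h.
have : nbhs (f l : {ptws V -> R}) C by apply: open_nbhs_nbhs.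
move=> /c UC; rewrite /nbhs/=; apply: (@filterS _ U _ (fun n => C (f (u n)))) UC => n.
exact: CA.
Qed.

End weak_convergence.

Section L1_classes.
Local Open Scope quotient_scope.
Context d (T : measurableType d) (R : realType).
Variable mu : {finite_measure set T -> \bar R}.
Variable X : normedModType R.
Local Notation E := (L1_space mu X).
Local Notation bint := (bochner_integrable mu).
Implicit Types (f g : T -> X) (z u : E).

Lemma bochner_integrableP f :
  (f \in @bochner_pred _ T R mu 1 X) <-> bint f.
Proof.
split=> [/bochner_predP[sf nf]|[sf nf]].
  split => //; apply/integrableP; split.
    exact/measurable_EFinP/strongly_measurable_norm.
  by move: nf; rewrite Lnorm1.
apply/bochner_predP; split => //; rewrite Lnorm1.
by move/integrableP : nf => [].
Qed.

Lemma L1_integrable z : bint (repr z).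
Proof. by apply/bochner_integrableP; exact: valP. Qed.

(** The default value 0 is used only when f is not integrable. *)
Definition L1_class f : E :=
  \pi_E (insubd (0 : bochner_fun mu X (@lexx _ _ 1%E)) f).

Lemma L1_class_repr f : bint f -> \forall t \ae mu, repr (L1_class f) t = f t.
Proof.
move=> /bochner_integrableP fP.
apply: filterS (Lbochner_repr (insubd (0 : bochner_fun mu X (@lexx _ _ 1%E)) f)) => t ->.
by rewrite -[in RHS](insubdK (0 : bochner_fun mu X (@lexx _ _ 1%E)) fP).
Qed.

Lemma L1_class_ae f g : bint f -> bint g ->
  (\forall t \ae mu, f t = g t) -> L1_class f = L1_class g.
Proof.
move=> /bochner_integrableP fP /bochner_integrableP gP fg.
apply/Lbochner_eqP; apply: filterS fg => t ftgt.
have -> : insubd (0 : bochner_fun mu X (@lexx _ _ 1%E)) f t = f t.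
  by rewrite -[in RHS](insubdK (0 : bochner_fun mu X (@lexx _ _ 1%E)) fP).
by rewrite ftgt -[in LHS](insubdK (0 : bochner_fun mu X (@lexx _ _ 1%E)) gP).
Qed.

Lemma L1_classK z : L1_class (repr z) = z.
Proof.
rewrite -[RHS]reprK; apply/Lbochner_eqP; apply: nearW => t.
have zP : (repr z : T -> X) \in @bochner_pred _ T R mu 1 X by exact: valP.
by rewrite -[in RHS](insubdK (0 : bochner_fun mu X (@lexx _ _ 1%E)) zP).
Qed.

Lemma L1_normE z : `|z| = \int[mu]_t `|repr z t|.
Proof.
apply: EFin_inj; rewrite L1_integral EFin_int//.
exact: (L1_integrable z).2.
Qed.

Lemma bint_measurable f : bint f -> measurable_fun setT (fun t => `|f t|).
Proof. by move=> [sf _]; exact: strongly_measurable_norm. Qed.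

Lemma L1_class_int f A : measurable A -> bint f ->
  \int[mu]_(t in A) `|repr (L1_class f) t| = \int[mu]_(t in A) `|f t|.
Proof.
move=> mA If; apply: eq_int_ae => //.
- by apply: bint_measurable; exact: L1_integrable.
- exact: bint_measurable.
- by apply: filterS (L1_class_repr If) => t ->.
Qed.

Lemma bintZD a f g : bint f -> bint g -> bint (fun t => a *: f t + g t).
Proof.
move=> /bochner_integrableP fP /bochner_integrableP gP.
by apply/bochner_integrableP; exact: (bochner_submod_closed mu (@lexx _ _ 1%E) X).2.
Qed.

Lemma L1_lin_repr a z u :
  \forall t \ae mu, repr (a *: z + u) t = a *: repr z t + repr u t.
Proof.
have E' : \pi_E (a *: repr z + repr u) = a *: z + u.
  by rewrite Lbochner_piD -Lbochner_piZ !reprK.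
by rewrite -E'; exact: Lbochner_repr (a *: repr z + repr u).
Qed.

Lemma L1_class_lin a f g : bint f -> bint g ->
  L1_class (fun t => a *: f t + g t) = a *: L1_class f + L1_class g.
Proof.
move=> If Ig; rewrite -[RHS]L1_classK; apply: L1_class_ae; [exact: bintZD|exact: L1_integrable|].
apply: filterS3 (L1_lin_repr a (L1_class f) (L1_class g)) (L1_class_repr If) (L1_class_repr Ig).
by move=> t -> -> ->.
Qed.

Lemma bint_restrict f A : measurable A -> bint f ->
  bint (fun t => if t \in A then f t else 0).
Proof.
move=> mA [sf nf].
have s : strongly_measurable (@measurable d T) (fun t => if t \in A then f t else 0).
  exact: strongly_measurable_restrict.
split => //; apply: summable_le nf _ => [|t]; first exact: strongly_measurable_norm.
by rewrite normr_id; case: ifP => // _; rewrite normr0.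
Qed.

Definition L1_restrict (A : set T) z : E :=
  L1_class (fun t => if t \in A then repr z t else 0).

Lemma L1_restrict_repr A z : measurable A ->
  \forall t \ae mu, repr (L1_restrict A z) t = if t \in A then repr z t else 0.
Proof. by move=> mA; apply: L1_class_repr; apply: bint_restrict => //; exact: L1_integrable. Qed.

Lemma L1_restrict_lin A a z u : measurable A ->
  L1_restrict A (a *: z + u) = a *: L1_restrict A z + L1_restrict A u.
Proof.
move=> mA; rewrite /L1_restrict -L1_class_lin; last 2 first.
- by apply: bint_restrict => //; exact: L1_integrable.
- by apply: bint_restrict => //; exact: L1_integrable.
apply: L1_class_ae; first by apply: bint_restrict => //; exact: L1_integrable.
  by apply: bintZD; apply: bint_restrict => //; exact: L1_integrable.
apply: filterS (L1_lin_repr a z u) => t h.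
by case: ifP => _; rewrite ?h// scaler0 addr0.
Qed.

Lemma L1_restrict_comp A B z : measurable A -> measurable B ->
  L1_restrict A (L1_restrict B z) = L1_restrict (A `&` B) z.
Proof.
move=> mA mB; apply: L1_class_ae.
- by apply: bint_restrict => //; exact: L1_integrable.
- by apply: bint_restrict; [exact: measurableI|exact: L1_integrable].
apply: filterS (L1_restrict_repr z mB) => t ->.
by rewrite in_setI; case: (t \in A).
Qed.

Lemma L1_restrict0 z : L1_restrict set0 z = 0.
Proof.
rewrite /L1_restrict -[RHS](L1_classK 0); apply: L1_class_ae.
- by apply: bint_restrict => //; exact: L1_integrable.
- exact: L1_integrable.
have -> : (0 : E) = \pi_E 0 by rewrite piE.
by apply: filterS (Lbochner_repr (0 : bochner_fun mu X (@lexx _ _ 1%E))) => t ->; rewrite in_set0.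
Qed.

Lemma L1_restrict_split A z : measurable A ->
  z = L1_restrict A z + L1_restrict (~` A) z.
Proof.
move=> mA; rewrite -[X in _ = X + _]scale1r -L1_class_lin; last 2 first.
- by apply: bint_restrict => //; exact: L1_integrable.
- by apply: bint_restrict; [exact: measurableC|exact: L1_integrable].
rewrite -[LHS]L1_classK; congr L1_class; apply/funext => t.
by rewrite in_setC; case: (t \in A); rewrite scale1r ?addr0 ?add0r.
Qed.

Lemma int_restrict_norm (f : T -> X) A B : measurable A -> measurable B -> bint f ->
  \int[mu]_(t in A) `|if t \in B then f t else 0| = \int[mu]_(t in A `&` B) `|f t|.
Proof.
move=> mA mB If; rewrite (int_split mA mB); last exact: (bint_restrict mB If).2.
rewrite [X in X + _](@eq_Rintegral _ _ _ _ (A `&` B) (fun t => `|f t|)); last first.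
  by move=> t; rewrite in_setI => /andP[_ ->].
rewrite [X in _ + X](@eq_Rintegral _ _ _ _ (A `&` ~` B) (cst 0)); last first.
  by move=> t; rewrite in_setI in_setC => /andP[_ /negbTE ->]; rewrite normr0.
rewrite /cst int_cst ?mul0r ?addr0//.
by apply: measurableI => //; exact: measurableC.
Qed.

Lemma L1_restrict_int A B z : measurable A -> measurable B ->
  \int[mu]_(t in A) `|repr (L1_restrict B z) t| = \int[mu]_(t in A `&` B) `|repr z t|.
Proof.
move=> mA mB; rewrite L1_class_int//; last exact: (bint_restrict mB (L1_integrable z)).
by rewrite int_restrict_norm//; exact: L1_integrable.
Qed.

Lemma L1_restrict_norm B z : measurable B ->
  `|L1_restrict B z| = \int[mu]_(t in B) `|repr z t|.
Proof. by move=> mB; rewrite L1_normE L1_restrict_int// setTI. Qed.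

Local Notation J A z := (\int[mu]_(t in A) `|repr z t|).

(** The functional F n.+1 coincides with F n off B n, and with a norming
    functional of the restriction of a n to B n, up to a sign, on B n.  The sign
    is such that the two contributions to F n.+1 (a n) do not cancel.  The next
    steps only change the functional on the sets B k with k > n, where a n has
    little mass.  All F n are bounded by the mass on the union of the B k, so
    that their ultralimit Phi exists. *)
Lemma gliding_hump (U : set_system nat) (UU : UltraFilter U) (Uoo : \oo `<=` U)
    (B : nat -> set T) (a : nat -> E) (e : R) :
  (forall n, measurable (B n)) ->
  (forall n, e < J (B n) (a n)) ->
  (forall n, J (\bigcup_(k in [set k | (n < k)%N]) B k) (a n) <= e / 4) ->
  exists Phi : dual_space E, (forall u, `|Phi u| <= J (\bigcup_k B k) u) /\
    forall n, e / 2 <= `|Phi (a n)|.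
Proof.
move=> mB eB tailB.
have UF : ProperFilter U := @ultra_proper _ _ UU.
have I0 A z : 0 <= J A z by exact: int_ge0.
have mC n : measurable (~` B n) by exact: measurableC.
pose D := \bigcup_k B k.
have mD : measurable D by exact: bigcupT_measurable.
have exPsi n : exists g : dual_space E,
    g (L1_restrict (B n) (a n)) = `|L1_restrict (B n) (a n)| /\ `|g| <= 1.
  by have [g g1 g2] := norming_functional (L1_restrict (B n) (a n)); exists g.
have [Psi PsiP] := choice exPsi.
pose F := fix F n : E -> R := if n is n'.+1 then fun u =>
  F n' (L1_restrict (~` B n') u) +
  (if 0 <= F n' (L1_restrict (~` B n') (a n')) then 1 else -1) *
    Psi n' (L1_restrict (B n') u) else fun=> 0.
have Flin n : scalar (F n).
  elim: n => [|n ih] b x y; first by rewrite /= mulr0 addr0.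
  rewrite /= !L1_restrict_lin// ih linearP/=.
  set s := (if _ then 1 else -1); rewrite -/s; ring.
have FI n u : `|F n u| <= J D u.
  elim: n u => [|n ih] u; first by rewrite /= normr0.
  rewrite /= (le_trans (ler_normD _ _))//.
  have h1 := ih (L1_restrict (~` B n) u); rewrite L1_restrict_int// in h1.
  have h2 : `|(if 0 <= F n (L1_restrict (~` B n) (a n)) then 1 else -1) *
      Psi n (L1_restrict (B n) u)| <= J (D `&` B n) u.
    rewrite normrM (_ : `|if _ then _ else _| = 1) ?mul1r; last first.
      by case: ifP => _; rewrite ?normrN normr1.
    rewrite (le_trans (ler_dual _ _))//.
    rewrite (@le_trans _ _ (1 * `|L1_restrict (B n) u|))//.
      by rewrite ler_wpM2r//; exact: (PsiP n).2.
    rewrite mul1r L1_restrict_norm// setIC setIidl//.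
    exact: bigcup_sup.
  rewrite (int_split mD (mB n)); last exact: (L1_integrable u).2.
  by rewrite addrC lerD.
have F1 n : e < `|F n.+1 (a n)|.
  rewrite (lt_le_trans (eB n))// -L1_restrict_norm// -(PsiP n).1 /=.
  have := (PsiP n).1; move: (Psi n _) => x xE.
  have x0 : 0 <= x by rewrite xE.
  case: ifPn => [y0|]; first by rewrite mul1r ger0_norm ?addr_ge0// lerDr.
  rewrite -ltNge => y0; rewrite mulN1r ltr0_norm; first by rewrite opprB lerBrDr; lra.
  by lra.
have tail n m : (n < m)%N -> e / 2 <= `|F m (a n)|.
  move=> nm; pose D' := \bigcup_(k in [set k | (n < k)%N]) B k.
  have mD' : measurable D' by apply: bigcup_measurable.
  have mcD' : measurable (~` D') by exact: measurableC.
  have E1 u : F m (L1_restrict (~` D') u) = F n.+1 (L1_restrict (~` D') u).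
    elim: m nm => [//|m ih]; rewrite ltnS leq_eqVlt => /orP[/eqP ->//|nm].
    rewrite -ih// /= !L1_restrict_comp//.
    have BD' : B m `<=` D' by exact: bigcup_sup.
    rewrite (_ : ~` B m `&` ~` D' = ~` D'); last first.
      by rewrite setIidr//; exact: subsetC.
    rewrite (_ : B m `&` ~` D' = set0); last first.
      by rewrite -subsets_disjoint.
    by rewrite L1_restrict0 linear0 mulr0 addr0.
  have E2 k : F k (a n) = F k (L1_restrict D' (a n)) + F k (L1_restrict (~` D') (a n)).
    by rewrite [in LHS](L1_restrict_split (a n) mD') -[L1_restrict D' _]scale1r Flin mul1r scale1r.
  have b k : `|F k (L1_restrict D' (a n))| <= e / 4.
    rewrite (le_trans (FI _ _))// L1_restrict_int// (le_trans _ (tailB n))//.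
    apply: int_subset => //; [exact: measurableI|exact: (L1_integrable _).2].
  have := F1 n; rewrite (E2 n.+1) (E2 m) E1.
  move: (b m) (b n.+1); set x := F m _; set y := F n.+1 _; set w := F n.+1 _.
  rewrite !ler_norml => /andP[? ?] /andP[? ?]; rewrite ltr_normr => h.
  by rewrite ler_normr; case/orP: h => h; apply/orP; [left|right]; lra.
have lex u : exists l : R, F n u @[n --> U] --> l.
  by apply: (bounded_ultra_cvg UU (M := J D u)) => n; exact: FI.
have [Phi PhiP] := choice lex.
have Phib u : `|Phi u| <= J D u.
  have c1 : `|F n u| @[n --> U] --> `|Phi u| by apply: cvg_norm; exact: PhiP.
  by apply: (ler_cvg_to c1 (cvg_cst _)); apply: nearW => n; exact: FI.
have Philin : scalar Phi.
  move=> b x y; apply: (@real_cvg_unique _ U _ (fun n => F n (b *: x + y))).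
    exact: PhiP.
  under eq_cvg do rewrite Flin.
  by apply: cvgD; [apply: cvgMr|]; exact: PhiP.
have PhiC u : `|Phi u| <= 1 * `|u|.
  rewrite (le_trans (Phib u))// mul1r L1_normE int_subset//.
  exact: (L1_integrable u).2.
exists (Dual (bounded_scalar_dual Philin PhiC)); split => // n /=.
have c1 : `|F m (a n)| @[m --> U] --> `|Phi (a n)| by apply: cvg_norm; exact: PhiP.
apply: (ler_cvg_to (cvg_cst _) c1); apply: Uoo.
by exists n.+1 => // m /= nm; exact: tail.
Qed.

End L1_classes.

(** * Uniform integrability of weakly compact sets *)

Lemma nonprincipal_ultrafilter :
  exists U : set_system nat, UltraFilter U /\ \oo `<=` U.
Proof. exact: ultraFilterLemma. Qed.

Section weakly_compact_sets.
Context d (T : measurableType d) (R : realType).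
Variable mu : {finite_measure set T -> \bar R}.
Variable X : normedModType R.
Local Notation E := (L1_space mu X).
Local Notation bint := (bochner_integrable mu).
Local Notation J A z := (\int[mu]_(t in A) `|repr z t|).

Lemma measure_bigcup_halving (B : nat -> set T) (r : R) :
  0 <= r -> (forall n, measurable (B n)) ->
  (forall n, (mu (B n) <= (r / (2 ^ n.+1)%:R)%:E)%E) ->
  (mu (\bigcup_n B n) <= r%:E)%E.
Proof.
move=> r0 mB Br.
apply: (le_trans (measure_sigma_subadditive mu mB (bigcupT_measurable _ mB) (@subset_refl _ _))).
apply: le_trans (epsilon_trick0 xpredT r0).
by apply: lee_nneseries => n *; [exact: measure_ge0|exact: Br].
Qed.

(** Otherwise there are a n in F with mass more than e on sets B n of measure
    tending to 0.  Let a_ be a weak cluster point of the a n in F; it is fixed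
    before the hump is built.  Start the hump at a rank N such that a_ has mass
    at most e / 4 on the union of the B n with n >= N.  Then [gliding_hump]
    gives a functional that is at least e / 2 in absolute value at all a n with
    n >= N, but at most e / 4 at a_. *)
Lemma weakly_compact_uniformly_integrable (F : set E) :
  @compact (weak_space E) F -> forall e, 0 < e -> exists2 r, 0 < r &
    forall a A, F a -> measurable A -> (mu A < r%:E)%E -> J A a <= e.
Proof.
move=> Fc e e0; apply: contrapT => nUI.
have bad (r : R) : exists p : E * set T, 0 < r ->
    [/\ F p.1, measurable p.2, (mu p.2 < r%:E)%E & e < J p.2 p.1].
  have [r0|/negP r0] := boolP (0 < r); last by exists (0, set0).
  apply: contrapT => np; apply: nUI; exists r => // a A Fa mA Ar.
  rewrite leNgt; apply/negP => eA; apply: np; exists (a, A) => _.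
  by split.
have [p pP] := choice bad.
have small (z : E) : exists r, 0 < r /\
    forall A, measurable A -> (mu A < r%:E)%E -> J A z <= e / 4.
  have e4 : 0 < e / 4 by lra.
  have [r r0 rP] := int_small (L1_integrable z).2 (fun=> normr_ge0 _) e4.
  by exists r.
have [s sP] := choice small.
(* dl n.+1 is chosen after a n, so small that a n has mass at most e / 4 on any
   set of measure at most 2 dl n.+1, such as the union of the B k with k > n *)
pose dl := fix dl n : R := if n is n'.+1 then
  Num.min (dl n' / 2) (s (p (dl n')).1 / 4) else 1.
have dl0 n : 0 < dl n.
  elim: n => [//|n ih] /=; rewrite lt_min; apply/andP; split; first by lra.
  by have [? _] := sP (p (dl n)).1; lra.
pose a n := (p (dl n)).1; pose B n := (p (dl n)).2.
have Fa n : F (a n) by have [] := pP _ (dl0 n).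
have mB n : measurable (B n) by have [] := pP _ (dl0 n).
have Bdl n : (mu (B n) < (dl n)%:E)%E by have [] := pP _ (dl0 n).
have eB n : e < J (B n) (a n) by have [] := pP _ (dl0 n).
have dlS n : dl n.+1 <= dl n / 2 by rewrite /= ge_min lexx.
have dls n : 2 * dl n.+1 < s (a n).
  have [s0 _] := sP (a n).
  have : dl n.+1 <= s (a n) / 4 by rewrite /= ge_min lexx orbT.
  lra.
have dlk n k : dl (n + k)%N <= (2 * dl n) / (2 ^ k.+1)%:R.
  elim: k => [|k ih]; first by rewrite addn0 expn1; lra.
  rewrite addnS (le_trans (dlS _))// expnS natrM invfM mulrA mulrAC.
  by rewrite ler_pM2r ?invr_gt0.
have mtail n : (mu (\bigcup_k B (n + k)%N) <= (2 * dl n)%:E)%E.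
  apply: measure_bigcup_halving => [|//|k]; first by rewrite mulr_ge0// ltW.
  by rewrite (le_trans (ltW (Bdl _)))// lee_fin dlk.
have [U [UU Uoo]] := nonprincipal_ultrafilter.
have UF : ProperFilter U := @ultra_proper _ _ UU.
have [a_ [Fa_ aa_]] := compact_ultra_cvg UU Fc Fa.
have [s_0 s_P] := sP a_.
have dlN n : dl n <= (n.+1%:R)^-1.
  have := dlk 0%N n; rewrite add0n /= mulr1 expnS natrM invfM mulrA mulfV// mul1r => h.
  rewrite (le_trans h)// lef_pV2 ?posrE ?ltr0n ?expn_gt0// ler_nat.
  exact: ltn_expl.
have [N NP] : exists N, 2 * dl N < s a_.
  pose N := Num.bound (2 / s a_).
  have : 2 / s a_ < N%:R by apply: archi_boundP; rewrite divr_ge0// ltW.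
  rewrite ltr_pdivrMr// => h; exists N.
  have h2 : dl N * N.+1%:R <= 1 by rewrite -ler_pdivlMr// mul1r.
  have h3 : (0 : R) < N.+1%:R by [].
  rewrite -(ltr_pM2r h3); apply: (@le_lt_trans _ _ 2); first by lra.
  rewrite (lt_le_trans h)// mulrC ler_wpM2l//; first exact: ltW.
  by rewrite ler_nat.
have [|||Phi [Phi1 Phi2]] := @gliding_hump _ T R mu X U UU Uoo
    (fun k => B (N + k)%N) (fun k => a (N + k)%N) e.
- by move=> n; exact: mB.
- by move=> n; exact: eB.
- move=> n; have [_] := sP (a (N + n)%N); apply.
    by apply: bigcup_measurable => k _; exact: mB.
  apply: (@le_lt_trans _ _ (mu (\bigcup_k B ((N + n).+1 + k)%N))).
    apply: le_measure; rewrite ?inE//.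
    + by apply: bigcup_measurable => k _; exact: mB.
    + by apply: bigcupT_measurable => k; exact: mB.
    move=> t [k /= nk Bt]; exists (k - n.+1)%N => //.
    by rewrite -addnS -addnA subnKC.
  by rewrite (le_lt_trans (mtail _))// lte_fin dls.
have c1 : `|Phi (a n)| @[n --> U] --> `|Phi a_|.
  by apply: cvg_norm; exact: (weak_space_cvg a a_).1 aa_ Phi.
have h1 : e / 2 <= `|Phi a_|.
  apply: (ler_cvg_to (cvg_cst _) c1); apply: Uoo; exists N => // n /= Nn.
  by have := Phi2 (n - N)%N; rewrite subnKC.
have h2 : `|Phi a_| <= e / 4.
  rewrite (le_trans (Phi1 _))//; apply: s_P.
    by apply: bigcupT_measurable => k; exact: mB.
  by rewrite (le_lt_trans (mtail _))// lte_fin.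
lra.
Qed.

Lemma L1_class_distE (f : T -> X) (a : E) : bint f ->
  `|L1_class mu f - a| = \int[mu]_t `|f t - repr a t|.
Proof.
move=> If; have Ia := L1_integrable a.
rewrite -[in LHS](L1_classK a) -[L1_class mu f - _]addrC -scaleN1r -L1_class_lin//.
rewrite L1_normE L1_class_int//; last exact: bintZD.
by apply: eq_Rintegral => t _; rewrite scaleN1r addrC.
Qed.

(** On B, the integral of |f - a| is at least that of |f| minus that of |a|,
    while that of |0 - a| is the integral of |a|. *)
Lemma L1_truncation_closer (f : T -> X) (a : E) (B : set T) :
  bint f -> measurable B ->
  2 * J B a <= \int[mu]_(t in B) `|f t| ->
  `|L1_class mu (fun t => if t \in ~` B then f t else 0) - a| <= `|L1_class mu f - a|.
Proof.
move=> If mB Ba; have mC : measurable (~` B) by exact: measurableC.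
have Ia := L1_integrable a.
have Ih := bint_restrict mC If.
have dist (g : T -> X) : bint g -> summable mu (fun t => `|g t - repr a t|).
  move=> Ig; apply: (summable_le (g := fun t => `|g t| + `|repr a t|)).
  - apply: (strongly_measurable_norm (f := fun t => g t - repr a t)).
    by apply: strongly_measurableB; [exact: Ig.1|exact: Ia.1].
  - by apply: summableD; [exact: Ig.2|exact: Ia.2].
  - by move=> t; rewrite normr_id ler_normB.
rewrite !L1_class_distE// (int_split measurableT mB (dist _ Ih)).
rewrite (int_split measurableT mB (dist _ If)) !setTI; apply: lerD.
  rewrite (@eq_Rintegral _ _ _ _ B (fun t => `|repr a t|)); last first.
    by move=> t tB; rewrite in_setC tB sub0r normrN.
  have : \int[mu]_(t in B) `|f t| - J B a <= \int[mu]_(t in B) `|f t - repr a t|.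
    rewrite -intB//; [|exact: If.2|exact: Ia.2].
    apply: int_le => //; first by apply: summableB; [exact: If.2|exact: Ia.2].
      exact: dist.
    by move=> t _; rewrite lerB_dist.
  lra.
by apply: int_le => //; [exact: dist|exact: dist|move=> t Bt; rewrite mem_set].
Qed.

End weakly_compact_sets.

Section centers_of_cluster_points.
Variables (R : realType) (E : normedModType R) (I : Type) (a : I -> E).
Variables (f : linfty R I -> {nonneg R}) (Z : set E).

Lemma rfun_ge0 x : 0 <= rfun a f x.
Proof. by rewrite /rfun. Qed.

Lemma rad_le z : Z z -> Defs.rad a f Z <= rfun a f z.
Proof. by move=> Zz; apply: ge_inf; [exists 0 => _ [y _ <-]; exact: rfun_ge0|exists z]. Qed.

Lemma minimizing_sequence : Z !=set0 -> exists z_ : nat -> E,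
  forall n, Z (z_ n) /\ rfun a f (z_ n) < Defs.rad a f Z + n.+1%:R^-1.
Proof.
move=> [z0 Zz0].
suff ex n : exists z, Z z /\ rfun a f z < Defs.rad a f Z + n.+1%:R^-1.
  by have [z zP] := choice ex; exists z.
have [||_ [z Zz <-] zn] := @inf_adherent R [set rfun a f z | z in Z] n.+1%:R^-1.
- by rewrite invr_gt0.
- split; first by exists (rfun a f z0); exists z0.
  by exists 0 => _ [y _ <-]; exact: rfun_ge0.
by exists z.
Qed.

Lemma lsc_cluster_le (W : topologicalType) (G : W -> R) (U : set_system nat)
    (UF : ProperFilter U) (Uoo : \oo `<=` U) (w_ : nat -> W) (w : W) (r : R) :
  lower_semicontinuous (fun y => (G y)%:E) -> w_ n @[n --> U] --> w ->
  (forall n, G (w_ n) <= r + n.+1%:R^-1) -> G w <= r.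
Proof.
move=> lsc ww wr; rewrite leNgt; apply/negP => rw.
pose e := (G w - r) / 2; have e0 : 0 < e by rewrite /e; lra.
have [|V Vw VP] := lsc w (r + e); first by rewrite lte_fin /e; lra.
have U1 := ww _ Vw.
have U2 : U [set n | n.+1%:R^-1 < e].
  by apply: Uoo; exact: near_infty_natSinv_lt (PosNum e0).
have [n [/= n1 n2]] := @filter_ex _ U UF _ (@filterI _ U _ _ _ U1 U2).
have := VP _ n1; rewrite lte_fin => /lt_le_trans/(_ (wr n)).
by rewrite ltrD2l ltNge (ltW n2).
Qed.

(** The distances to an unbounded family are replaced by the default value 0,
    so r_f is constant. *)
Lemma unbounded_family_center : ~ bounded_set (range a) -> Z !=set0 ->
  Cent a f Z !=set0.
Proof.
move=> nb [z Zz].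
have d0 x : dist_family a x = linfty0 R I.
  rewrite /dist_family /insubd insubN//; apply/negP; rewrite inE => -[_ [M MP]].
  apply: nb; exists (M + `|x|); split; first exact: num_real.
  move=> r Mr _ [i _ <-] /=; rewrite (le_trans _ (ltW Mr))//.
  have : `|x - a i| <= M by apply: MP; exists i.
  by have := lerB_dist (a i) x; rewrite distrC; lra.
have c x : rfun a f x = (f (linfty0 R I))%:num by rewrite /rfun d0.
exists z; split => //; rewrite /Defs.rad c.
rewrite (_ : [set _ | _ in _] = [set (f (linfty0 R I))%:num]) ?inf1//.
by apply/seteqP; split=> [_ [y _ <-]//|_ ->]; exists z.
Qed.

Lemma rfun_le x y (fm : linfty_monotone f) : bounded_set (range a) ->
  (forall i, `|x - a i| <= `|y - a i|) -> rfun a f x <= rfun a f y.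
Proof. by move=> ab xy; apply: fm => i; rewrite !dist_familyE. Qed.

Lemma coercive_bounded (i0 : I) (fc : linfty_coercive f) (r : R) :
  bounded_set (range a) ->
  exists2 M, 0 < M & forall x, rfun a f x <= r -> `|x| <= M.
Proof.
move=> ab; have [K KP] := fc (r + 1).
exists (`|K| + `|a i0| + 1) => [|x xr]; first by rewrite ltr_wpDl.
have : linfty_norm (dist_family a x) < K.
  rewrite ltNge; apply/negP => /KP; move: xr; rewrite /rfun; lra.
have : `|x - a i0| <= linfty_norm (dist_family a x).
  rewrite -dist_familyE//; apply: ub_le_sup; last by exists i0.
  by have := valP (dist_family a x); rewrite inE => -[].
have : `|x| <= `|x - a i0| + `|a i0|.
  by rewrite -[X in `|X| <= _](subrK (a i0)) ler_normD.
have := ler_norm K; lra.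
Qed.

End centers_of_cluster_points.

(** * Image measures and separable reduction *)

Section pushforward_measures.
Context d d' (T : measurableType d) (T' : measurableType d') (R : realType).
Variable mu : {finite_measure set T -> \bar R}.
Variable phi : {mfun T >-> T'}.

Lemma measurable_push A : measurable A -> measurable (phi @^-1` A).
Proof. by move=> mA; rewrite -[X in measurable X]setTI; exact: measurable_funP. Qed.

Let push_fun : set T' -> \bar R := pushforward mu phi.

Let push0 : push_fun set0 = 0%E.
Proof. exact: (measure0 (pushforward mu phi)). Qed.

Let push_ge0 A : (0 <= push_fun A)%E.
Proof. exact: (measure_ge0 (pushforward mu phi)). Qed.

Let push_sigma_additive : semi_sigma_additive push_fun.
Proof.
exact: (@measure_semi_sigma_additive _ _ _
  (measure_function_pushforward__canonical__measure_function_Measure mu (measurable_funPT phi))).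
Qed.

Let push_finite : fin_num_fun push_fun.
Proof. by move=> A mA; apply: fin_num_measure; exact: measurable_push. Qed.

HB.instance Definition _ := isMeasure.Build _ _ _ push_fun
  push0 push_ge0 push_sigma_additive.
HB.instance Definition _ := Measure_isFinite.Build _ _ _ push_fun push_finite.

(** The image measure.  A sub-sigma-algebra S' of that of T is the case where
    T' is T with S' as sigma-algebra, and phi is the identity. *)
Definition push : {finite_measure set T' -> \bar R} := push_fun.

Lemma summable_push (f : T' -> R) : measurable_fun setT f ->
  summable mu (f \o phi) -> summable push f.
Proof.
move=> mf sf; apply: integrable_pushforward => //.
exact/measurable_EFinP.
Qed.

Lemma summable_pull (f : T' -> R) : summable push f -> summable mu (f \o phi).
Proof.
move=> sf; have mf := summable_measurable sf.
apply/integrableP; split; first by apply/measurable_EFinP; exact: measurableT_comp.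
move/integrableP : sf => [_]; rewrite ge0_integral_pushforward//.
by apply: measurableT_comp => //; exact/measurable_EFinP.
Qed.

Lemma int_push (f : T' -> R) A : measurable A -> summable push f ->
  \int[push]_(t in A) f t = \int[mu]_(t in phi @^-1` A) f (phi t).
Proof.
move=> mA sf; rewrite /Rintegral integral_pushforward//.
- exact: measurable_int sf.
- by apply: summableS; [exact: measurable_push|exact: summable_pull].
Qed.

Lemma strongly_measurable_comp (V : normedModType R) (h : T' -> V) :
  strongly_measurable (@measurable _ T') h ->
  strongly_measurable (@measurable _ T) (h \o phi).
Proof.
move=> [s ss sh]; exists (fun n => s n \o phi) => [n|t]; last exact: sh.
have [fs ms] := ss n; split.
  by apply: sub_finite_set fs => _ [t _ <-]; exists (phi t).
by move=> v; rewrite comp_preimage; exact/measurable_push.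
Qed.

Lemma bint_pull (V : normedModType R) (h : T' -> V) :
  bochner_integrable push h -> bochner_integrable mu (h \o phi).
Proof.
by move=> [sh nh]; split; [exact: strongly_measurable_comp|exact: (summable_pull nh)].
Qed.

Lemma bint_push (V : normedModType R) (h : T' -> V) :
  strongly_measurable (@measurable _ T') h ->
  bochner_integrable mu (h \o phi) -> bochner_integrable push h.
Proof.
by move=> sh [_ nh]; split => //; apply: summable_push => //; exact: strongly_measurable_norm.
Qed.

End pushforward_measures.

Section separable_reduction.
Context d (T : measurableType d) (R : realType) (V : normedModType R).

(** Each h n has a countable set of approximating values, and W is the closed
    span of all of them. *)
Lemma separable_reduction (h : nat -> T -> V) :
  (forall n, strongly_measurable (@measurable _ T) (h n)) ->
  exists W : submodClosed V, closed [set v | v \in W] /\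
  exists w : nat -> submod_space W, dense_seq w /\
  exists k : nat -> T -> submod_space W,
    forall n, strongly_measurable (@measurable _ T) (k n) /\
      forall t, val (k n t) = h n t.
Proof.
move=> sh.
have [x xP] := choice (fun n => strongly_measurable_range (sh n)).
pose y n := if unpickle n is Some (i, j) then x i j else 0.
have hy n t : h n t \in closed_qspan_pred y.
  have hc : closure [set v | v \in closed_qspan_pred y] (h n t).
    move=> B /nbhs_ballP[e /= e0 eB]; have [k kP] := xP n t e e0.
    exists (x n k); split.
      have -> : x n k = y (pickle (n, k)) by rewrite /y pickleK.
      exact: closed_qspan_mem.
    by apply: eB; rewrite -ball_normE.
  exact: (closed_qspan_closed hc).
exists (closed_qspan_pred y : submodClosed V); split; first exact: closed_qspan_closed.
have [w wd] := closed_qspan_dense y; exists w; split => //.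
exists (fun n t => SubmodSpace (hy n t)) => n; split => //.
apply: (dense_dist_strongly_measurable (x := w)) => [t e|k]; first exact: wd.
exact: (strongly_measurable_dist (val (w k)) (sh n)).
Qed.

End separable_reduction.

Section truncation.
Context d d' (T : measurableType d) (T' : measurableType d') (R : realType).
Variable mu : {finite_measure set T -> \bar R}.
Variable phi : {mfun T >-> T'}.
Variables (X V : normedModType R) (iota : {linear V -> X}).
Hypothesis iota_norm : forall v, `|iota v| = `|v|.
Local Notation nu := (push mu phi).
Local Notation strongly := (strongly_measurable (@measurable _ T')).
Local Notation E := (L1_space mu X).

Lemma isometry_continuous : continuous iota.
Proof.
apply: bounded_linear_continuous; apply/linear_boundedP.
exists 1; split; first exact: num_real.
by move=> r r1 x; rewrite iota_norm ler_peMl// ltW.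
Qed.

Definition L1_incl (h : T' -> V) : E := L1_class mu (fun t => iota (h (phi t))).

Lemma bint_incl (h : T' -> V) : bochner_integrable nu h ->
  bochner_integrable mu (fun t => iota (h (phi t))).
Proof.
move=> /bint_pull[sh nh]; split.
  exact: (strongly_measurableL isometry_continuous sh).
by rewrite /summable; under eq_fun do rewrite iota_norm.
Qed.

Lemma L1_incl_int (h : T' -> V) A : measurable A -> bochner_integrable nu h ->
  \int[mu]_(t in phi @^-1` A) `|iota (h (phi t))| = \int[nu]_(t in A) `|h t|.
Proof.
move=> mA Ih; rewrite (int_push mA Ih.2).
by apply: eq_Rintegral => t _; rewrite iota_norm.
Qed.

Lemma L1_incl_norm (h : T' -> V) : bochner_integrable nu h ->
  `|L1_incl h| = \int[nu]_t `|h t|.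
Proof.
move=> Ih; rewrite L1_normE L1_class_int//; last exact: bint_incl.
by rewrite -L1_incl_int// preimage_setT.
Qed.

Lemma L1_incl_lin a (h k : T' -> V) : bochner_integrable nu h ->
  bochner_integrable nu k ->
  L1_incl (fun t => a *: h t + k t) = a *: L1_incl h + L1_incl k.
Proof.
move=> Ih Ik; rewrite -L1_class_lin; [|exact: bint_incl|exact: bint_incl].
by congr L1_class; apply/funext => t; rewrite linearP.
Qed.

Variable F : set E.
Hypothesis uiF : forall e, 0 < e -> exists2 r, 0 < r &
  forall a A, F a -> measurable A -> (mu A < r%:E)%E ->
    \int[mu]_(t in A) `|repr a t| <= e.
Variable M : R.
Hypothesis M0 : 0 < M.

(** If the mass of h above some level c j exceeds twice the bound 1 / (j + 1)
    for the mass of the elements of F on a set so small, then h is replaced by 0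
    above the first such level; otherwise h is kept.  In both cases the mass of
    h' above every level c j is at most 2 / (j + 1), with levels that do not
    depend on h.  Distances to F must not increase at all, not even by a small
    amount: f is monotone but not continuous. *)
Lemma uniform_truncation : exists c : nat -> R, forall h : T' -> V,
  bochner_integrable nu h -> \int[nu]_t `|h t| <= M ->
  exists h' : T' -> V, [/\ bochner_integrable nu h',
    \int[nu]_t `|h' t| <= M,
    forall a, F a -> `|L1_incl h' - a| <= `|L1_incl h - a| &
    forall j A, measurable A -> \int[nu]_(t in A) `|h' t| <=
      c j * fine (nu A) + 2 * j.+1%:R^-1].
Proof.
have ex j : exists r, 0 < r /\ forall a A, F a -> measurable A ->
    (mu A < r%:E)%E -> \int[mu]_(t in A) `|repr a t| <= j.+1%:R^-1.
  have [|r r0 rP] := @uiF j.+1%:R^-1; first by rewrite invr_gt0.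
  by exists r.
have [r rP] := choice ex.
have r0 j : 0 < r j by have [] := rP j.
(* a sum rather than 2 M / r j, to make c nondecreasing; the factor 2 makes the
   inequality of Markov strict *)
pose c j := \sum_(i < j.+1) (2 * M / r i).
have cpos i : 0 < 2 * M / r i by rewrite divr_gt0// mulr_gt0.
have cr j : 2 * M / r j <= c j.
  by rewrite /c big_ord_recr/= lerDr sumr_ge0// => i _; rewrite ltW.
have c0 j : 0 < c j by exact: lt_le_trans (cpos j) (cr j).
have cS j : c j <= c j.+1 by rewrite /c [leRHS]big_ord_recr/= lerDl ltW.
have cmono : {homo c : i j / (i <= j)%N >-> i <= j}.
  by apply: homo_leq => // y x z; exact: le_trans.
exists c => h Ih hM.
pose B j := [set t | c j < `|h t|].
have mB j : measurable (B j).
  have -> : B j = ~` (setT `&` [set t | `|h t| <= c j]).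
    by apply/seteqP; split=> t; rewrite setTI /B/= ltNge => /negP.
  apply: measurableC; apply: measurable_fun_le => //.
  exact: strongly_measurable_norm Ih.1.
have nuB j : (nu (B j) < (r j)%:E)%E.
  have h1 : c j * fine (nu (B j)) <= M.
    rewrite -int_cst// (le_trans _ hM)//.
    apply: (@le_trans _ _ (\int[nu]_(t in B j) `|h t|)).
      by apply: int_le => //; [exact: summable_cst|exact: Ih.2|move=> t /ltW].
    by apply: int_subset => //; exact: Ih.2.
  rewrite -(@fineK _ (nu (B j))) ?fin_num_measure// lte_fin.
  have fB : 0 <= fine (nu (B j)) by exact: fine_ge0.
  have h2 : 2 * M / r j * fine (nu (B j)) <= M.
    by rewrite (le_trans _ h1)// ler_wpM2r.
  move: h2; rewrite mulrAC ler_pdivrMr// => h2.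
  have : M * (2 * fine (nu (B j))) <= M * r j by rewrite mulrCA mulrA.
  rewrite ler_pM2l// => h3; have := r0 j; lra.
have bound (h' : T' -> V) : bochner_integrable nu h' ->
    (forall t, `|h' t| <= `|h t|) ->
    (forall j, \int[nu]_(t in B j) `|h' t| <= 2 * j.+1%:R^-1) ->
    forall j A, measurable A -> \int[nu]_(t in A) `|h' t| <=
      c j * fine (nu A) + 2 * j.+1%:R^-1.
  move=> Ih' hh hB j A mA; rewrite (int_split mA (mB j)); last exact: Ih'.2.
  rewrite addrC; apply: lerD; last first.
    rewrite (le_trans _ (hB j))//; apply: int_subset => //; first exact: measurableI.
    exact: Ih'.2.
  have mAB : measurable (A `&` ~` B j) by apply: measurableI => //; exact: measurableC.
  apply: (@le_trans _ _ (\int[nu]_(t in A `&` ~` B j) c j)).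
    apply: int_le => //; [exact: Ih'.2|exact: summable_cst|].
    by move=> t [_ /negP]; rewrite /B/= -leNgt; exact: le_trans.
  rewrite int_cst// ler_wpM2l//; first exact: ltW.
  by rewrite fine_le ?fin_num_measure//; apply: le_measure; rewrite ?inE.
have [hB|/existsNP hB] := pselect (forall j, \int[nu]_(t in B j) `|h t| <= 2 * j.+1%:R^-1).
  by exists h; split => //; exact: bound.
have {}hB : exists j, ~~ (\int[nu]_(t in B j) `|h t| <= 2 * j.+1%:R^-1).
  by have [j /negP] := hB; exists j.
pose k := ex_minn hB.
have [kB kmin] : ~~ (\int[nu]_(t in B k) `|h t| <= 2 * k.+1%:R^-1) /\
    forall j, (j < k)%N -> \int[nu]_(t in B j) `|h t| <= 2 * j.+1%:R^-1.
  rewrite /k; case: ex_minnP => m mP mmin; split => // j jm.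
  by apply/negPn/negP => /mmin; rewrite leqNgt jm.
have mC : measurable (~` B k) by exact: measurableC.
have Ih' := bint_restrict mC Ih.
have hh t : `|if t \in ~` B k then h t else 0| <= `|h t|.
  by case: ifP => // _; rewrite normr0.
exists (fun t => if t \in ~` B k then h t else 0); split => //.
- by rewrite (le_trans _ hM)//; apply: int_le => //; [exact: Ih'.2|exact: Ih.2].
- move=> a Fa.
  have -> : L1_incl (fun t => if t \in ~` B k then h t else 0) =
      L1_class mu (fun t => if t \in ~` (phi @^-1` B k) then iota (h (phi t)) else 0).
    congr L1_class; apply/funext => t.
    have -> : (t \in ~` (phi @^-1` B k)) = (phi t \in ~` B k).
      by apply/idP/idP => /set_mem tB; exact/mem_set.
    by case: ifP => _ //; rewrite linear0.
  apply: L1_truncation_closer; [exact: bint_incl|exact: measurable_push|].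
  rewrite L1_incl_int//; move: kB; rewrite -ltNge => /ltW; apply: le_trans.
  rewrite ler_wpM2l//; have [_] := rP k; apply => //; first exact: measurable_push.
  exact: nuB.
apply: bound => // j; have [jk|kj] := ltnP j k.
  rewrite (le_trans _ (kmin j jk))//.
  by apply: int_le => //; [exact: Ih'.2|exact: Ih.2].
rewrite (@eq_Rintegral _ _ _ _ (B j) (cst 0)); last first.
  move=> t /set_mem tB; rewrite memNset ?normr0// => /(_ _); apply.
  by rewrite /B/=; exact: le_lt_trans (cmono _ _ kj) tB.
by rewrite /cst int_cst// mul0r mulr_ge0// invr_ge0.
Qed.

End truncation.

(** * Centers in L_1 *)

Section centers_in_L1.
Context d d' (T : measurableType d) (T' : measurableType d') (R : realType).
Variable mu : {finite_measure set T -> \bar R}.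
Variable phi : {mfun T >-> T'}.
Variables (X V : normedModType R) (iota : {linear V -> X}).
Hypothesis iota_norm : forall v, `|iota v| = `|v|.
Hypothesis Vreflexive : reflexive_space V.
Local Notation nu := (push mu phi).
Local Notation E := (L1_space mu X).
Local Notation Z := [set z : E | exists2 h : T' -> V, bochner_integrable nu h &
  z = L1_incl mu phi iota h].

Lemma affine_bound_uniformly_integrable (W : normedModType R) (k : nat -> T' -> W)
    (c : nat -> R) :
  (forall n j A, measurable A ->
    \int[nu]_(t in A) `|k n t| <= c j * fine (nu A) + 2 * j.+1%:R^-1) ->
  uniformly_integrable nu k.
Proof.
move=> kc e e0.
have [j j0] : exists j, 2 * j.+1%:R^-1 <= e / 2.
  have e4 : 0 < e / 4 by lra.
  have [j _ /(_ j (leqnn j)) /= jP] := near_infty_natSinv_lt (PosNum e4).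
  exists j; rewrite (@le_trans _ _ (2 * (e / 4)))//; last by lra.
  by rewrite ler_wpM2l// ltW.
have c1 : 0 < 2 * (`|c j| + 1) by rewrite mulr_gt0// ltr_wpDl.
exists (e / (2 * (`|c j| + 1))); first by rewrite divr_gt0.
move=> n A mA Ar; rewrite (le_trans (kc n j A mA))//.
have fA : fine (nu A) < e / (2 * (`|c j| + 1)).
  by rewrite -lte_fin fineK ?fin_num_measure.
have f0 : 0 <= fine (nu A) by exact: fine_ge0.
have h1 : c j * fine (nu A) <= (`|c j| + 1) * fine (nu A).
  by rewrite ler_wpM2r// (le_trans (ler_norm _))// lerDl.
have h2 : (`|c j| + 1) * fine (nu A) <= e / 2.
  move: fA; rewrite ltr_pdivlMr// => fA; rewrite ler_pdivlMr//.
  by rewrite (_ : _ * 2 = fine (nu A) * (2 * (`|c j| + 1))) ?ltW//; ring.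
by rewrite [leRHS]splitr; apply: lerD => //; exact: le_trans h1 h2.
Qed.

(** The truncations of a minimizing sequence form a uniformly integrable
    minimizing sequence, which has a weak cluster point in the subspace. *)
Theorem L1_center (F : set E) (f : linfty R F -> {nonneg R}) :
  F !=set0 -> @compact (weak_space E) F ->
  linfty_monotone f -> linfty_coercive f ->
  lower_semicontinuous (fun z : weak_space E => (rfun (@set_val _ F) f z)%:E) ->
  Cent (@set_val _ F) f Z !=set0.
Proof.
move=> [a0 Fa0] Fc fm fc flsc.
have Z0 : Z !=set0.
  exists (L1_incl mu phi iota (cst 0)); exists (cst 0) => //; split.
    exact: strongly_measurable_cst.
  exact: (summable_cst nu `|0 : V|).
have [ab|/unbounded_family_center] := pselect (bounded_set (range (@set_val _ F))); last exact.
have [z_ zP] := minimizing_sequence (@set_val _ F) f Z0.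
have [M M0 MP] := coercive_bounded (exist _ a0 (mem_set Fa0)) fc
  (Defs.rad (@set_val _ F) f Z + 1) ab.
have zM n : `|z_ n| <= M.
  apply: MP; rewrite (le_trans (ltW (zP n).2))// lerD2l invf_le1 ?ltr0n//.
  by rewrite ler1n.
have hex n : exists h : T' -> V, bochner_integrable nu h /\ z_ n = L1_incl mu phi iota h.
  by have [[h Ih zh] _] := zP n; exists h.
have [h hP] := choice hex.
have hM n : \int[nu]_t `|h n t| <= M.
  by have [Ih zh] := hP n; rewrite -(L1_incl_norm iota_norm Ih) -zh.
have [c cP] := uniform_truncation phi iota_norm
  (weakly_compact_uniformly_integrable Fc) M0.
have [h' h'P] := choice (fun n => cP (h n) (hP n).1 (hM n)).
have sh' n : strongly_measurable (@measurable _ T') (h' n).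
  by have [[]] := h'P n.
have [W [Wc [w [wd [k kP]]]]] := separable_reduction sh'.
have Wr := reflexive_closed_subspace Wc Vreflexive.
pose i0 : {linear submod_space W -> X} := iota \o submod_incl W.
have i0_norm v : `|i0 v| = `|v| by rewrite /i0/= iota_norm.
have kn n t : `|k n t| = `|h' n t| by rewrite -(kP n).2.
have Ik n : bochner_integrable nu (k n).
  have [[_ nh] _ _ _] := h'P n; split; first exact: (kP n).1.
  by rewrite /summable; under eq_fun do rewrite kn.
have kM n : \int[nu]_t `|k n t| <= M.
  have [_ hM' _ _] := h'P n; apply: le_trans hM'.
  by under eq_Rintegral do rewrite kn.
have kui : uniformly_integrable nu k.
  apply: (affine_bound_uniformly_integrable (c := c)) => n j A mA.
  have [_ _ _ hc] := h'P n; apply: le_trans (hc j A mA).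
  by under eq_Rintegral do rewrite kn.
have [U [UU Uoo]] := nonprincipal_ultrafilter.
have UF : ProperFilter U := @ultra_proper _ _ UU.
have [z Iz zw] := weak_cluster_point UU Wr wd Ik kM kui.
have kh n : L1_incl mu phi i0 (k n) = L1_incl mu phi iota (h' n).
  by congr L1_class; apply/funext => t; rewrite /i0/= (kP n).2.
have wcvg : L1_incl mu phi i0 (k n) @[n --> U] -->
    (L1_incl mu phi i0 z : weak_space E).
  apply/weak_space_cvg => Phi.
  apply: (zw (fun g => Phi (L1_incl mu phi i0 g)) `|Phi|) => //.
  - by move=> a f1 f2 I1 I2; rewrite L1_incl_lin// linearP.
  - by move=> g Ig; rewrite -(L1_incl_norm i0_norm Ig) ler_dual.
have Zz : Z (L1_incl mu phi i0 z).
  exists (fun t => val (z t)); last by [].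
  have [sz nz] := Iz; split => //.
  apply: (strongly_measurableL (L := submod_incl W) _ sz).
  by apply: isometry_continuous.
exists (L1_incl mu phi i0 z); split => //; apply/eqP; rewrite eq_le rad_le// andbT.
apply: (lsc_cluster_le UF Uoo flsc wcvg) => n.
rewrite kh (le_trans _ (ltW (zP n).2))//; apply: rfun_le => // a.
have [_ _ hF _] := h'P n; have [_ ->] := hP n; apply: hF.
exact: set_valP.
Qed.

End centers_in_L1.

(** * Centers in L_oo *)

Section bounded_functions.
Local Open Scope quotient_scope.
Context d (T : measurableType d) (R : realType).
Variable mu : {finite_measure set T -> \bar R}.
Variable X : normedModType R.
Local Notation E := (Loo_space mu X).
Local Notation strongly := (strongly_measurable (@measurable d T)).
Implicit Types (z a : E) (w : L1_space mu (dual_space X)).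

Lemma Lnorm_oo_le (f : T -> R) (M : R) : 0 <= M ->
  (\forall t \ae mu, `|f t| <= M) -> ('N[mu]_+oo[EFin \o f] <= M%:E)%E.
Proof.
move=> M0 fM; rewrite unlock /Lnorm; case: ifPn => [mu0|_]; last by rewrite lee_fin.
by apply/ess_supP; apply: filterS fM => t; rewrite /= lee_fin.
Qed.

Lemma bounded_bochner_pred (f : T -> X) (M : R) : strongly f ->
  (forall t, `|f t| <= M) -> f \in @bochner_pred _ T R mu +oo X.
Proof.
move=> sf fM; apply/bochner_predP; split => //.
apply: (@le_lt_trans _ _ (Num.max M 0)%:E); last exact: ltry.
apply: Lnorm_oo_le; first by rewrite le_max lexx orbT.
by apply: nearW => t /=; rewrite normr_id le_max fM.
Qed.

Lemma Loo_norm_le z (M : R) : 0 <= M ->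
  (\forall t \ae mu, `|repr z t| <= M) -> `|z| <= M.
Proof.
move=> M0 zM; rewrite -lee_fin -[z in `|z|]reprK Lbochner_norm_pi.
by apply: Lnorm_oo_le => //; apply: filterS zM => t /=; rewrite normr_id.
Qed.

Lemma Loo_sub_repr z a : \forall t \ae mu, repr (z - a) t = repr z t - repr a t.
Proof.
have E' : \pi_E ((-1) *: repr a + repr z) = (-1) *: a + z.
  by rewrite Lbochner_piD -Lbochner_piZ !reprK.
rewrite addrC -scaleN1r -E'; apply: filterS (Lbochner_repr ((-1) *: repr a + repr z)) => t -> /=.
by rewrite !fctE /= scaleN1r addrC.
Qed.

Lemma Loo_embedB z a : Loo_embed (z - a) = Loo_embed z - Loo_embed a.
Proof.
apply/val_inj/funext => w /=; rewrite !fctE /= /Loo_pairing.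
rewrite -intB//; [|exact: pairing_integrable|exact: pairing_integrable].
apply: eq_int_ae => //; first exact: pairing_measurable.
  by apply: measurable_funB; exact: pairing_measurable.
by apply: filterS (Loo_sub_repr z a) => t ->; rewrite linearB.
Qed.

Lemma Loo_embed_norm_le z : `|Loo_embed z| <= `|z|.
Proof.
apply: dual_normr_le => // w; rewrite /= /Loo_pairing -lee_fin.
rewrite (le_trans _ (pairing_integral_le z w))//.
rewrite /= EFin_normr_Rintegral ?pairing_integrable// le_abse_integral//.
exact/measurable_EFinP/pairing_measurable.
Qed.

Lemma Loo_pairing_class z (g : T -> dual_space X) : bochner_integrable mu g ->
  Loo_pairing z (L1_class mu g) = \int[mu]_t g t (repr z t).
Proof.
move=> Ig; apply: eq_int_ae => //; first exact: pairing_measurable.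
  by apply: dual_pairing_measurable; [exact: Ig.1|exact: bochner_measurable].
by apply: filterS (L1_class_repr Ig) => t ->.
Qed.

Lemma Loo_integrable z : bochner_integrable mu (repr z).
Proof.
have sz : strongly (repr z) by exact: bochner_measurable.
have mz := strongly_measurable_norm sz.
split => //; apply/integrableP; split; first exact/measurable_EFinP.
apply: (@le_lt_trans _ _ (\int[mu]_t (cst `|z|%:E t))%E).
  apply: ae_ge0_le_integral => //.
  - by apply: measurableT_comp => //; exact/measurable_EFinP.
  - by move=> t _; rewrite lee_fin.
  - by apply: filterS (Loo_ae_le z) => t zt _; rewrite /= lee_fin normr_id.
rewrite integral_cst// -[X in (X < _)%E]fineK ?ltry//.
by rewrite fin_numM// fin_num_measure.
Qed.

(** Test z against the indicator function of the set where it is e-close to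
    x, times a norming functional of x. *)
Lemma Loo_embed_ball z (x : X) (e : R) : 0 < e ->
  mu [set t | `|repr z t - x| < e] != 0%E -> `|x| <= `|Loo_embed z| + e.
Proof.
move=> e0; set B := [set t | _] => muB.
have mB : measurable B.
  apply: measurable_lt_set; apply: strongly_measurable_dist.
  exact: bochner_measurable.
have [g gx g1] := norming_functional x.
pose h t : dual_space X := if t \in B then g else 0.
have Ig : bochner_integrable mu (fun _ : T => g).
  split; first exact: strongly_measurable_cst.
  exact: (summable_cst mu `|g|).
have Ih : bochner_integrable mu h by exact: (bint_restrict mB Ig).
pose m := fine (mu B).
have m0 : 0 < m.
  by rewrite /m fine_gt0// lt_neqAle eq_sym muB measure_ge0/= ltey_eq fin_num_measure.
have nh : `|L1_class mu h| <= m.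
  rewrite L1_normE L1_class_int// (int_restrict_norm measurableT mB Ig) setTI.
  by rewrite int_cst// ler_piMl// ltW.
have zs : strongly (repr z) by exact: bochner_measurable.
have p1 : `|\int[mu]_t h t (repr z t)| <= `|Loo_embed z| * m.
  rewrite -Loo_pairing_class// (le_trans (ler_dual (Loo_embed z) _))//.
  by rewrite ler_wpM2l.
have Iz := Loo_integrable z.
have hE : \int[mu]_t h t (repr z t) = \int[mu]_(t in B) g (repr z t).
  have sh : summable mu (fun t => h t (repr z t)).
    apply: pairing_summable => //; first exact: Ih.1.
    apply: (pairing_bounded (C := `|g|)) => //; first exact: Ih.1.
    by move=> t; rewrite /h; case: ifP => // _; rewrite normr0.
  rewrite (int_split measurableT mB sh) !setTI.
  rewrite [X in X + _](@eq_Rintegral _ _ _ _ B (fun t => g (repr z t))); last first.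
    by move=> t tB; rewrite /h tB.
  rewrite [X in _ + X](@eq_Rintegral _ _ _ _ (~` B) (cst 0)); last first.
    by move=> t; rewrite in_setC => /negbTE tB; rewrite /h tB.
  by rewrite /cst int_cst ?mul0r ?addr0//; exact: measurableC.
have p2 : (`|x| - e) * m <= \int[mu]_t h t (repr z t).
  rewrite hE -int_cst//; apply: int_le => //; first exact: summable_cst.
    exact: functional_summable.
  move=> t Bt; have -> : g (repr z t) = `|x| + g (repr z t - x).
    by rewrite linearB /= gx addrC subrK.
  rewrite lerD2l lerNl (le_trans (ler_norm _))// normrN.
  rewrite (le_trans (ler_dual _ _))// (le_trans (ler_wpM2r _ g1))// mul1r.
  exact: ltW.
have : (`|x| - e) * m <= `|Loo_embed z| * m.
  by rewrite (le_trans p2)// (le_trans (ler_norm _)).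
by rewrite ler_pM2r// lerBlDr.
Qed.

(** Up to a null set, each t lies in a set of positive measure where z is
    close to some x k, among countably many, so that [Loo_embed_ball] bounds
    |z t|. *)
Lemma Loo_embed_norm z : `|Loo_embed z| = `|z|.
Proof.
apply/eqP; rewrite eq_le Loo_embed_norm_le/=; apply: Loo_norm_le => //.
have zs : strongly (repr z) by exact: bochner_measurable.
have [x xd] := strongly_measurable_range zs.
pose B k j := [set t | `|repr z t - x k| < j.+1%:R^-1].
have mB k j : measurable (B k j).
  by apply: measurable_lt_set; exact: strongly_measurable_dist.
have ae1 : \forall t \ae mu, forall k j, B k j t -> mu (B k j) != 0%E.
  apply: ae_foralln => k; apply: ae_foralln => j.
  have [B0|B0] := eqVneq (mu (B k j)) 0%E; last by apply: nearW.
  exists (B k j); split => // t /= h; apply: contrapT => Bt; apply: h.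
  by move=> /Bt.
apply: filterS ae1 => t Bt; apply/ler_addgt0Pr => e e0.
have e2 : 0 < e / 2 by lra.
have [j _ /(_ j (leqnn j)) /= jP] := near_infty_natSinv_lt (PosNum e2).
have j0 : (0 : R) < j.+1%:R^-1 by rewrite invr_gt0.
have [k kP] := xd t _ j0.
have h1 := Loo_embed_ball j0 (Bt k j kP).
have h2 : `|repr z t| <= `|repr z t - x k| + `|x k|.
  by rewrite -[X in `|X| <= _](subrK (x k)) ler_normD.
rewrite (le_trans h2)// (le_trans (lerD (ltW kP) h1))//.
rewrite addrCA lerD2l [leRHS]splitr; apply: lerD; exact: ltW.
Qed.

Lemma dist_family_embed (F : set E) z :
  dist_family (fun b : F => Loo_embed (set_val b)) (Loo_embed z) =
  dist_family (@set_val _ F) z.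
Proof.
rewrite /dist_family; congr insubd; apply/funext => b.
by rewrite -Loo_embedB Loo_embed_norm.
Qed.

Section centers_in_Loo.
Variables (V : normedModType R) (iota : {linear V -> X}).
Hypothesis iota_norm : forall v, `|iota v| = `|v|.
Hypothesis Vreflexive : reflexive_space V.
Local Notation Z := [set z : E | exists h : T -> V,
  strongly h /\ \forall t \ae mu, repr z t = iota (h t)].

Lemma Loo_class_exists (h : T -> V) M : strongly h -> (forall t, `|h t| <= M) ->
  exists z : E, \forall t \ae mu, repr z t = iota (h t).
Proof.
move=> sh hM.
have si : strongly (iota \o h).
  exact: (strongly_measurableL (isometry_continuous iota_norm) sh).
have ib : iota \o h \in @bochner_pred _ T R mu +oo X.
  by apply: (bounded_bochner_pred (M := M)) => // t; rewrite /= iota_norm.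
pose b : bochner_fun mu X (leey 1%E) := @BochnerFun d T R mu +oo%E X (leey 1%E) _ ib.
by exists (\pi_E b); exact: (Lbochner_repr b).
Qed.

(** A minimizing sequence, modified on null sets, is bounded everywhere by a
    constant M, which serves as the dominating function in
    [weak_limit_exists]. *)
Theorem Loo_center (F : set E) (f : linfty R F -> {nonneg R}) :
  F !=set0 -> bounded_set F ->
  linfty_monotone f -> linfty_coercive f ->
  lower_semicontinuous
    (fun z : weakstar_space (L1_space mu (dual_space X)) =>
      (rfun (fun b : F => Loo_embed (set_val b)) f z)%:E) ->
  Cent (@set_val _ F) f Z !=set0.
Proof.
move=> [a0 Fa0] Fb fm fc flsc.
have sz0 : strongly (cst (0 : V)) by exact: strongly_measurable_cst.
have Z0 : Z !=set0.
  have b0 : forall t : T, `|cst (0 : V) t| <= 0 by move=> t; rewrite normr0.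
  have [z zP] := Loo_class_exists sz0 b0; by exists z; exists (cst 0).
have [ab|/unbounded_family_center] := pselect (bounded_set (range (@set_val _ F))); last exact.
have [z_ zP] := minimizing_sequence (@set_val _ F) f Z0.
have [M M0 MP] := coercive_bounded (exist _ a0 (mem_set Fa0)) fc
  (Defs.rad (@set_val _ F) f Z + 1) ab.
have zM n : `|z_ n| <= M.
  apply: MP; rewrite (le_trans (ltW (zP n).2))// lerD2l invf_le1 ?ltr0n//.
  by rewrite ler1n.
have hex n : exists h : T -> V, [/\ strongly h, forall t, `|h t| <= M &
    \forall t \ae mu, repr (z_ n) t = iota (h t)].
  have [[h [sh zh]] _] := zP n.
  pose A := setT `&` [set t | `|h t| <= M].
  have mA : measurable A.
    by apply: measurable_fun_le => //; exact: strongly_measurable_norm.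
  exists (fun t => if t \in A then h t else 0); split.
  - exact: strongly_measurable_restrict.
  - move=> t; case: ifPn => [/set_mem[]//|_]; rewrite normr0; exact: ltW.
  - apply: filterS2 zh (Loo_ae_le (z_ n)) => t zt ztM; rewrite mem_set//.
    by split => //=; rewrite -iota_norm -zt (le_trans ztM).
have [h hP] := choice hex.
have sh n : strongly (h n) by have [] := hP n.
have [W [Wc [w [wd [k kP]]]]] := separable_reduction sh.
have Wr := reflexive_closed_subspace Wc Vreflexive.
pose i0 : {linear submod_space W -> X} := iota \o submod_incl W.
have i0_norm v : `|i0 v| = `|v| by rewrite /i0/= iota_norm.
have sk n : strongly (k n) by have [] := kP n.
have kM n t : `|k n t| <= M.
  by have [_ hM _] := hP n; rewrite -[`|k n t|]/`|val (k n t)| (kP n).2.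
have bounded_int (k' : T -> submod_space W) : strongly k' ->
    (forall t, `|k' t| <= M) -> bochner_integrable mu k'.
  move=> s b; split => //; apply: summable_le (summable_cst mu M) _.
    exact: strongly_measurable_norm.
  by move=> t; rewrite normr_id.
have Ik n := bounded_int _ (sk n) (kM n).
have [U [UU Uoo]] := nonprincipal_ultrafilter.
have UF : ProperFilter U := @ultra_proper _ _ UU.
have intM (g : T -> R) : summable mu g -> (forall t, g t <= M) ->
    \int[mu]_t g t <= M * fine (mu setT).
  by move=> sg gM; rewrite -int_cst//; apply: int_le => //; exact: summable_cst.
have [||z [sz zM' zw]] := weak_limit_exists (rho := cst M) UU Wr wd Ik
    (fun n => intM _ (Ik n).2 (kM n)) (summable_cst mu M).
- by move=> t; exact: ltW.
- move=> g A l mA lP; have c1 : `|\int[mu]_(t in A) g (k n t)| @[n --> U] --> `|l|.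
    exact: cvg_norm.
  apply: (ler_cvg_to c1 (cvg_cst _)); apply: nearW => n.
  rewrite -intZ//; last exact: summable_cst.
  apply: int_norm_le => //; first exact: functional_summable.
    by apply: summableZ; exact: summable_cst.
  by move=> t _; rewrite (le_trans (ler_dual _ _))// ler_wpM2l.
have Iz := bounded_int _ sz zM'.
have szi : strongly (fun t => val (z t)).
  apply: (strongly_measurableL (L := submod_incl W) _ sz).
  by apply: isometry_continuous.
have [zz zzP] := Loo_class_exists szi zM'.
have Zz : Z zz by exists (fun t => val (z t)).
have Ii0 (k' : T -> submod_space W) : bochner_integrable mu k' ->
    bochner_integrable mu (i0 \o k').
  move=> [s n]; split; first exact: (strongly_measurableL (isometry_continuous i0_norm) s).
  by rewrite /summable; under eq_fun do rewrite i0_norm.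
have wcvg : Loo_embed (z_ n) @[n --> U] -->
    (Loo_embed zz : weakstar_space (L1_space mu (dual_space X))).
  apply: weakstar_space_cvg => g; rewrite /= /Loo_pairing.
  have Ig := L1_integrable g.
  have sg : strongly (repr g) := Ig.1.
  have E1 n : \int[mu]_t repr g t (repr (z_ n) t) = \int[mu]_t repr g t (i0 (k n t)).
    apply: eq_int_ae => //; first exact: pairing_measurable.
      by apply: dual_pairing_measurable => //; exact: (Ii0 _ (Ik n)).1.
    by have [_ _] := hP n; apply: filterS => t ->; rewrite /i0/= (kP n).2.
  have E2 : \int[mu]_t repr g t (repr zz t) = \int[mu]_t repr g t (i0 (z t)).
    apply: eq_int_ae => //; first exact: pairing_measurable.
      by apply: dual_pairing_measurable => //; exact: (Ii0 _ Iz).1.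
    by apply: filterS zzP => t ->.
  rewrite E2; under eq_cvg do rewrite E1.
  have sgm (k' : T -> submod_space W) : strongly k' -> (forall t, `|k' t| <= M) ->
      summable mu (fun t => `|repr g t| * `|i0 (k' t)|).
    move=> s b; apply: (summable_le (g := fun t => M * `|repr g t|)).
    - apply: measurable_funM; first exact: strongly_measurable_norm.
      by apply: strongly_measurable_norm; exact: (Ii0 _ (bounded_int _ s b)).1.
    - by apply: summableZ; exact: Ig.2.
    - by move=> t; rewrite ger0_norm ?mulr_ge0// mulrC ler_wpM2r// i0_norm.
  have intMi (k' : T -> submod_space W) : strongly k' -> (forall t, `|k' t| <= M) ->
      \int[mu]_t `|i0 (k' t)| <= M * fine (mu setT).
    move=> s b; apply: intM => [|t]; last by rewrite i0_norm.
    exact: (Ii0 _ (bounded_int _ s b)).2.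
  apply: (@weak_limit_pairing _ _ _ mu _ U _ (fun n => i0 \o k n) (i0 \o z)
      (M * fine (mu setT))) => //.
  - by move=> n; exact: Ii0.
  - exact: Ii0.
  - by move=> n; exact: intMi.
  - exact: intMi.
  - move=> psi A mA.
    have Ep (k' : T -> submod_space W) : \int[mu]_(t in A) psi ((i0 \o k') t) =
        \int[mu]_(t in A) (dual_restrict i0_norm psi) (k' t) by [].
    by rewrite Ep; under eq_cvg do rewrite Ep; exact: zw.
  - by move=> n; exact: sgm.
  - exact: sgm.
  move=> D e vD e0.
  have [K KP] := vanishing_small vD Ig.2 (fun=> normr_ge0 _) (divr_gt0 e0 M0).
  have mD : measurable (D K) by have [] := vD.
  have bnd (k' : T -> submod_space W) : strongly k' -> (forall t, `|k' t| <= M) ->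
      \int[mu]_(t in D K) (`|repr g t| * `|i0 (k' t)|) <= e.
    move=> s b; apply: (@le_trans _ _ (\int[mu]_(t in D K) (M * `|repr g t|))).
      apply: int_le => //; first exact: sgm.
        by apply: summableZ; exact: Ig.2.
      by move=> t _; rewrite mulrC ler_wpM2r// i0_norm.
    rewrite intZ//; last exact: Ig.2.
    by rewrite mulrC -ler_pdivlMr// KP.
  by exists K; split=> [n|]; exact: bnd.
have rE y : rfun (fun b : F => Loo_embed (set_val b)) f (Loo_embed y) =
    rfun (@set_val _ F) f y by rewrite /rfun dist_family_embed.
exists zz; split => //; apply/eqP; rewrite eq_le rad_le// andbT -rE.
apply: (lsc_cluster_le UF Uoo flsc wcvg) => n.
by rewrite rE ltW// (zP n).2.
Qed.

End centers_in_Loo.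

End bounded_functions.

(** * The spaces L_p(S', Y) and the theorem *)

Section subalgebra_spaces.
Local Open Scope quotient_scope.
Context d (T : measurableType d) (R : realType).
Variable mu : {finite_measure set T -> \bar R}.
Variables (X : normedModType R) (Y : submodClosed X).

Lemma L1_class_pi (u : bochner_fun mu X (@lexx _ _ 1%E)) :
  L1_class mu u = \pi_(L1_space mu X) u.
Proof.
apply/Lbochner_eqP; apply: nearW => t.
have uP : (u : T -> X) \in @bochner_pred _ T R mu 1 X by exact: valP.
by rewrite -[in RHS](insubdK (0 : bochner_fun mu X (@lexx _ _ 1%E)) uP).
Qed.

Variable S' : set (set T).
Hypotheses (S'sigma : sigma_algebra [set: T] S') (S'sub : S' `<=` measurable).
Local Notation T' := (g_sigma_algebraType S').

Lemma subalgebra_measurableE : (@measurable _ T') = S'.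
Proof. exact: sigma_algebra_id. Qed.

Lemma subalgebra_id_measurable : measurable_fun [set: T] (idfun : T -> T').
Proof.
move=> _ A mA; rewrite setTI; apply: S'sub.
by rewrite -subalgebra_measurableE.
Qed.

Definition subalgebra_id : {mfun T >-> T'} :=
  HB.pack (idfun : T -> T')
    (isMeasurableFun.Build _ _ T T' (idfun : T -> T') subalgebra_id_measurable).

Lemma Lbochner_sub_L1E :
  Lbochner_sub (mu := mu) (p1 := @lexx _ _ 1%E) S' Y =
  [set z : L1_space mu X | exists2 h : T' -> submod_space Y,
    bochner_integrable (push mu subalgebra_id) h &
    z = L1_incl mu subalgebra_id (submod_incl Y) h].
Proof.
apply/seteqP; split=> [z [u -> [g sg ug]]|z [h Ih ->]].
  have ugE : (u : T -> X) = (fun t => val (g t)) by apply/funext => t; exact: ug.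
  have sg' : strongly_measurable (@measurable _ T') g by rewrite subalgebra_measurableE.
  have [su nu] : bochner_integrable mu u by apply/bochner_integrableP; exact: valP.
  exists g; last by rewrite -L1_class_pi ugE.
  apply: bint_push => //; split.
    exact: (strongly_measurable_comp subalgebra_id sg').
  by move: nu; rewrite ugE.
have Ii := bint_incl (iota := submod_incl Y) (fun=> erefl) Ih.
have /bochner_integrableP bP := Ii.
pose b : bochner_fun mu X (@lexx _ _ 1%E) := BochnerFun _ bP.
exists b; first by rewrite -L1_class_pi.
by exists h => //; have [sh _] := Ih; rewrite -subalgebra_measurableE.
Qed.

Lemma Lbochner_sub_LooE :
  Lbochner_sub (mu := mu) (p1 := leey 1%E) measurable Y =
  [set z : Loo_space mu X | exists h : T -> submod_space Y,
    strongly_measurable (@measurable _ T) h /\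
    \forall t \ae mu, repr z t = submod_incl Y (h t)].
Proof.
apply/seteqP; split=> [z [u -> [g sg ug]]|z [h [sh zh]]].
  exists g; split => //; apply: filterS (Lbochner_repr u) => t ->.
  exact: ug.
have si : strongly_measurable (@measurable _ T) (fun t => submod_incl Y (h t)).
  apply: (strongly_measurableL _ sh).
  by apply: isometry_continuous.
have bP : (fun t => submod_incl Y (h t)) \in @bochner_pred _ T R mu +oo X.
  apply/bochner_predP; split => //.
  rewrite -(@Lnorm_ae_eq _ _ _ mu +oo (leey 1%E) (fun t => `|repr z t|)).
  - exact: bochner_finite.
  - exact/strongly_measurable_norm/bochner_measurable.
  - exact: strongly_measurable_norm.
  - by apply: filterS zh => t ->.
pose b : bochner_fun mu X (leey 1%E) := @BochnerFun d T R mu +oo%E X (leey 1%E) _ bP.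
exists b; last by exists h.
by rewrite -[z]reprK; apply/Lbochner_eqP.
Qed.

End subalgebra_spaces.

Theorem theorem3p11 (R : realType) (X : completeNormedModType R)
  (Y : submodClosed X) (Yclosed : closed [set x : X | x \in Y])
  (Yreflexive : reflexive_space (submod_space Y))
  (d : measure_display) (T : measurableType d)
  (mu : {finite_measure set T -> \bar R}) :
  (forall (F : set (L1_space mu X)) (S' : set (set T))
     (f : linfty R F -> {nonneg R}),
     F !=set0 ->
     @compact (weak_space (L1_space mu X)) F ->
     sigma_algebra [set: T] S' -> S' `<=` measurable ->
     linfty_monotone f -> linfty_coercive f ->
     lower_semicontinuous
       (fun z : weak_space (L1_space mu X) => (rfun (@set_val _ F) f z)%:E) ->
     Cent (@set_val _ F) f (Lbochner_sub (mu := mu) S' Y) !=set0) /\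
  (forall (F : set (Loo_space mu X)) (f : linfty R F -> {nonneg R}),
     F !=set0 -> closed F -> bounded_set F ->
     linfty_monotone f -> linfty_coercive f ->
     lower_semicontinuous
       (fun z : weakstar_space (L1_space mu (dual_space X)) =>
          (rfun (fun a : F => Loo_embed (set_val a)) f z)%:E) ->
     Cent (@set_val _ F) f (Lbochner_sub (mu := mu) measurable Y) !=set0).
Proof.
have iN := @submod_incl_norm R X Y.
split=> [F S' f F0 Fc S's S'm fm fc flsc|F f F0 _ Fb fm fc flsc].
  rewrite (Lbochner_sub_L1E mu Y S's S'm).
  exact: (@L1_center _ _ T (g_sigma_algebraType S') R mu (subalgebra_id S's S'm) X _ (submod_incl Y) iN Yreflexive F f F0 Fc fm fc flsc).
rewrite Lbochner_sub_LooE.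
exact: (Loo_center iN Yreflexive F0 Fb fm fc flsc).
Qed.
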